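(* Let each $f_i:\mathbb{R}^m\to\mathbb{R}$ ($i\in[n]$) be $r+1$ times continuously differentiable for some $r\ge 1$ with $\nabla f_i$ being $L_i$-Lipschitz continuous, let $F=\sum_i f_i$ be coercive, and let the digraph $\mathcal G$ be strongly connected (connected, if undirected). Let $\mathbf R,\mathbf C$ satisfy the weight-matrix assumption in the context and be nonsingular, and let the step-size $\alpha$ satisfy the step-size conditions in the context together with $0<\alpha<\sigma_{\min}(\mathbf C\mathbf R)/L_c$. Suppose furthermore that at least one of the following holds: (i) $\mathbf R$ and $\mathbf C$ are symmetric; (ii) $m=1$. Let $\{\mathbf u^\nu=(\mathbf{x}^\nu,\mathbf h^\nu)\}$ be the sequence generated by $$\mathbf{x}^{\nu+1}=\mathbf W_R\mathbf{x}^\nu-\alpha\big(\mathbf h^\nu+\nabla F_c(\mathbf{x}^\nu)\big),\qquad \mathbf h^{\nu+1}=\mathbf W_C\mathbf h^\nu+(\mathbf W_C-\mathbf I)\nabla F_c(\mathbf{x}^\nu),$$ with initialization $\mathbf u^0\in\mathcal S\triangleq\mathbb{R}^{nm}\times\mathrm{span}(\mathbf W_C-\mathbf I)$. Then $$\mathbb P_{\mathbf u^0}\Big(\lim_{\nu\to\infty}\mathbf u^\nu\in\mathcal U^*\Big)=0,$$ where the probability is taken over $\mathbf u^0\in\mathcal S$. In addition, if $F$ is a KŁ function, then $\{\mathbf{x}^\nu\}$ converges almost surely to $\mathbf 1\otimes\boldsymbol\theta^\infty$, where $\boldsymbol\theta^\infty$ is a second-order stationary (SoS) solution of $\min F$,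 at the following rate: when the function $L$ of the context is KŁ with $\phi(s)=c_0s^{1-\theta}$, $c_0>0$, $\theta\in[0,1)$, the convergence occurs in a finite number of iterations if $\theta=0$; $\|\mathbf{x}^\nu-\mathbf 1\otimes\boldsymbol\theta^\infty\|\le\bar C\tau^\nu$ for all large $\nu$, for some $\tau\in[0,1)$ and $\bar C>0$, if $\theta\in(0,1/2]$; and $\|\mathbf{x}^\nu-\mathbf 1\otimes\boldsymbol\theta^\infty\|\le\bar C\nu^{-\frac{1-\theta}{2\theta-1}}$ for all large $\nu$, for some $\bar C>0$, if $\theta\in(1/2,1)$.
   Context: Functions: $F=\sum_{i=1}^nf_i$; for $\mathbf{x}=[\mathbf{x}_1^\top,\ldots,\mathbf{x}_n^\top]^\top\in\mathbb{R}^{mn}$, $F_c(\mathbf{x})=\sum_if_i(\mathbf{x}_i)$. $L_c=\max_iL_i$ is the Lipschitz constant of $\nabla F_c$, and $\mathsf L$ denotes a Lipschitz constant of $\nabla F$. Coercive: tends to $+\infty$ as the argument tends to infinity in norm. SoS solution: a critical point of $F$ with $\nabla^2F$ positive semidefinite. $\Theta_{ss}^*=\{\boldsymbol\theta^*:\nabla F(\boldsymbol\theta^* )=\mathbf 0,\ \lambda_{\min}(\nabla^2F(\boldsymbol\theta^* ))<0\}$ (strict saddles), and $\mathcal U^*=\{(\mathbf 1_n\otimes\boldsymbol\theta^*,\,-\nabla F_c(\mathbf 1_n\otimes\boldsymbol\theta^* )):\boldsymbol\theta^*\in\Theta_{ss}^*\}$ (consensual strict saddles). KŁ property of a differentiable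 $U$ at $\acute{\mathbf z}$: there exist $\eta\in(0,+\infty]$, a neighborhood $\mathcal V$ of $\acute{\mathbf z}$ and a continuous concave $\phi:[0,\eta)\to\mathbb{R}_+$ with $\phi(0)=0$, $\phi$ $C^1$ on $(0,\eta)$, $\phi'>0$ on $(0,\eta)$, and $\phi'(U(\mathbf z)-U(\acute{\mathbf z}))\|\nabla U(\mathbf z)\|\ge1$ for all $\mathbf z\in\mathcal V$ with $U(\acute{\mathbf z})<U(\mathbf z)<U(\acute{\mathbf z})+\eta$. $U$ is a KŁ function if this holds at every point. Network and weights: $\mathcal G=([n],\mathcal E)$ is a (possibly directed) graph. For a nonnegative $\mathbf A\in\mathbb{R}^{n\times n}$, $\mathcal G_A$ is the digraph on $[n]$ with edge $(j,i)$ iff $A_{ij}>0$, and $\mathcal R_A$ is the set of roots of directed spanning trees of $\mathcal G_A$. Weight-matrix assumption: $\mathbf R$ is nonnegative row-stochastic with $R_{ii}>0$; $\mathbf C$ is nonnegative column-stochastic with $C_{ii}>0$; both are compliant to $\mathcal G$ (for $i\ne j$ the $(i,j)$ entry is zero if $(j,i)\notin\mathcal E$); $\mathcal G_R$ and $\mathcal G_{C^\top}$ each contain a spanning tree, and $\mathcal R_R\cap\mathcal R_{C^\top}\neq\emptyset$. $\mathbf W_R=\mathbf R\otimes\mathbf I_m$, $\mathbf W_C=\mathbf C\otimes\mathbf I_m$; span of a matrix = column space; $\sigma_{\min}$ = smallest singular value. Let $\mathbf r,\mathbf c$ be the stochastic vectors with $\mathbf r^\top\mathbf R=\mathbf r^\top$,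 $\mathbf C\mathbf c=\mathbf c$, with minimal/maximal entries $r_{\min},r_{\max},c_{\min},c_{\max}$ (the constants below presuppose $r_{\min},c_{\min}>0$); $\zeta=\mathbf r^\top\mathbf c>0$. Let $\|\mathbf{x}\|_R=\|(\mathrm{diag}(\sqrt{\mathbf r})\otimes\mathbf I_m)\mathbf{x}\|_2$, $\|\mathbf{y}\|_C=\|(\mathrm{diag}(\sqrt{\mathbf c})^{-1}\otimes\mathbf I_m)\mathbf{y}\|_2$, $\rho_R=\|\mathrm{diag}(\sqrt{\mathbf r})(\mathbf R-\mathbf 1\mathbf r^\top)\mathrm{diag}(\sqrt{\mathbf r})^{-1}\|_2<1$, $\rho_C=\|\mathrm{diag}(\sqrt{\mathbf c})^{-1}(\mathbf C-\mathbf c\mathbf 1^\top)\mathrm{diag}(\sqrt{\mathbf c})\|_2<1$, $\mathbf J_R=(\mathbf 1\mathbf r^\top)\otimes\mathbf I_m$, $\mathbf J_C=(\mathbf c\mathbf 1^\top)\otimes\mathbf I_m$. Constants: $K_{2,R}=1/\sqrt{r_{\min}}$, $K_{2,C}=\sqrt{c_{\max}}$, $K_{C,2}=1/\sqrt{c_{\min}}$, $K_{R,C}=\sqrt{r_{\max}c_{\max}}$; $K_2=2K_{R,C}^2(1+\frac1{\epsilon_x})$, $K_3=2n(1+\frac1{\epsilon_x})$, $K_4=3K_{C,2}^2K_{2,C}^2L_c^2$, $K_5=3K_{C,2}^2L_c^2$, $K_6=3K_{C,2}^2K_{2,R}^2L_c^2$. Step-size conditions: for some $0<\epsilon_x<\frac{1-\rho_R^2}{2\rho_R^2}$,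 $0<\epsilon_y<\frac{1-\rho_C^2}{\rho_C^2}$, $0<\epsilon<\frac{2\zeta}{1+\zeta}$, $0<\varkappa\le\frac{\rho_R^2\epsilon_x}{K_6(1+1/\epsilon_y)}$, $$\alpha<\frac{2\,(1-\rho_R^2(1+2\epsilon_x))}{nL_c^2K_{2,R}^2(1+\zeta/\epsilon)},\quad \alpha<\frac{1-\rho_C^2(1+\epsilon_y)}{\frac1{2\varkappa}K_{2,C}^2(1+\frac1\epsilon+2\mathsf L)+\frac{K_2}{\varkappa}+K_4(1+\frac1{\epsilon_y})},\quad \alpha<\frac{\zeta-\frac\epsilon2(\zeta+1)}{\mathsf L\zeta^2+K_3+K_5\varkappa}.$$ $L(\mathbf{x},\mathbf{y})=F_c(\mathbf J_R\mathbf{x})+\|(\mathbf I-\mathbf J_R)\mathbf{x}\|_R^2+\varkappa\|(\mathbf I-\mathbf J_C)\mathbf{y}\|_C^2$ (along the algorithm, $\mathbf{y}^\nu=\mathbf h^\nu+\nabla F_c(\mathbf{x}^\nu)$). Probability measures are absolutely continuous with respect to the Lebesgue measure (on the subspace $\mathcal S$). *)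

(* Defs.v *)
From HB Require Import structures.
From mathcomp Require Export all_boot all_order all_algebra.
From mathcomp Require Export mxtens.
From mathcomp Require Export all_classical all_reals all_analysis.

Set Implicit Arguments.
Unset Strict Implicit.
Unset Printing Implicit Defensive.

Import Order.TTheory GRing.Theory Num.Theory.
Import numFieldNormedType.Exports.

Local Open Scope classical_set_scope.
Local Open Scope ring_scope.

(* The library norm on matrices is the sup norm, hence the explicit Euclidean
   norm; the topology is the same. *)
Definition norm2 {R : realType} {k : nat} (x : 'cV[R]_k) : R :=
  Num.sqrt (\sum_i x i 0 ^+ 2).

Definition opnorm2 {R : realType} {p q : nat} (A : 'M[R]_(p, q)) : R :=
  sup [set norm2 (A *m v) | v in [set v : 'cV[R]_q | norm2 v <= 1]].

(* Only used for symmetric A, whose eigenvalues are all real. *)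
Definition lambda_min {R : realType} {k : nat} (A : 'M[R]_k) : R :=
  inf [set a : R | eigenvalue A a].

Definition singular_values {R : realType} {k : nat} (A : 'M[R]_k) : set R :=
  [set Num.sqrt a | a in [set a : R | eigenvalue (A^T *m A) a]].

Definition sigma_min {R : realType} {k : nat} (A : 'M[R]_k) : R :=
  inf (singular_values A).

Definition psd {R : realType} {k : nat} (A : 'M[R]_k) : Prop :=
  forall v : 'cV[R]_k, 0 <= (v^T *m A *m v) 0 0.

Definition vmin {R : realType} {k : nat} (v : 'cV[R]_k) : R :=
  inf (range (fun i : 'I_k => v i 0)).

Definition vmax {R : realType} {k : nat} (v : 'cV[R]_k) : R :=
  sup (range (fun i : 'I_k => v i 0)).

Definition basis_vec {R : realType} {k : nat} (j : 'I_k) : 'cV[R]_k :=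
  delta_mx j 0.

Definition partial {R : realType} {k : nat} (j : 'I_k) (f : 'cV[R]_k -> R)
    (x : 'cV[R]_k) : R :=
  'D_(basis_vec j) f x.

Definition gradient {R : realType} {k : nat} (f : 'cV[R]_k -> R)
    (x : 'cV[R]_k) : 'cV[R]_k :=
  \col_j partial j f x.

Definition hessian {R : realType} {k : nat} (f : 'cV[R]_k -> R)
    (x : 'cV[R]_k) : 'M[R]_k :=
  \matrix_(i, j) partial j (partial i f) x.

Fixpoint C_class {R : realType} {k : nat} (p : nat) (f : 'cV[R]_k -> R)
    {struct p} : Prop :=
  match p with
  | 0%N => continuous f
  | p'.+1 => (forall x, differentiable f x) /\
             (forall j : 'I_k, C_class p' (partial j f))
  end.

Definition lipschitz2 {R : realType} {k l : nat} (K : R)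
    (g : 'cV[R]_k -> 'cV[R]_l) : Prop :=
  forall x y, norm2 (g x - g y) <= K * norm2 (x - y).

Definition coercive {R : realType} {k : nat} (f : 'cV[R]_k -> R) : Prop :=
  forall M : R, exists B : R, forall x, B <= norm2 x -> M <= f x.

Definition strict_saddle {R : realType} {k : nat} (f : 'cV[R]_k -> R)
    (x : 'cV[R]_k) : Prop :=
  gradient f x = 0 /\ lambda_min (hessian f x) < 0.

Definition SoS {R : realType} {k : nat} (f : 'cV[R]_k -> R)
    (x : 'cV[R]_k) : Prop :=
  gradient f x = 0 /\ psd (hessian f x).

(* phi is only relevant on [0, eta), where eta may be +oo. *)
Record desingularizing {R : realType} (eta : \bar R) (phi : R -> R) : Prop :=
  Desingularizing {
    desing_eta : (0%:E < eta)%E;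
    desing_ge0 : forall s : R, 0 <= s -> (s%:E < eta)%E -> 0 <= phi s;
    desing_cont :
      {within [set s : R | 0 <= s /\ (s%:E < eta)%E], continuous phi};
    desing_concave : forall s t l : R, 0 <= s -> (s%:E < eta)%E ->
      0 <= t -> (t%:E < eta)%E -> 0 <= l -> l <= 1 ->
      l * phi s + (1 - l) * phi t <= phi (l * s + (1 - l) * t);
    desing_0 : phi 0 = 0;
    desing_derivable : forall s : R, 0 < s -> (s%:E < eta)%E ->
      derivable phi s 1;
    desing_C1 : forall s : R, 0 < s -> (s%:E < eta)%E ->
      {for s, continuous (derive1 phi)};
    desing_deriv_gt0 : forall s : R, 0 < s -> (s%:E < eta)%E -> 0 < derive1 phi s
  }.

Definition KL_ineq {R : realType} {k : nat} (U : 'cV[R]_k -> R)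
    (z0 : 'cV[R]_k) (eta : \bar R) (phi : R -> R) : Prop :=
  \forall z \near z0,
    U z0 < U z -> ((U z)%:E < (U z0)%:E + eta)%E ->
    1 <= derive1 phi (U z - U z0) * norm2 (gradient U z).

Definition KL_at_with {R : realType} {k : nat} (U : 'cV[R]_k -> R)
    (z0 : 'cV[R]_k) (phi : R -> R) : Prop :=
  exists eta : \bar R, desingularizing eta phi /\ KL_ineq U z0 eta phi.

Definition KL_function {R : realType} {k : nat} (U : 'cV[R]_k -> R) : Prop :=
  (forall z, differentiable U z) /\
  forall z0, exists phi : R -> R, KL_at_with U z0 phi.

(* The exponent theta is common to all points; the constant c0 > 0 may, like
   eta and the neighborhood, depend on the point. *)
Definition KL_function_power {R : realType} {k : nat} (U : 'cV[R]_k -> R)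
    (theta : R) : Prop :=
  (forall z, differentiable U z) /\
  forall z0, exists2 c0 : R, 0 < c0 &
    KL_at_with U z0 (fun s => c0 * s `^ (1 - theta)).

(* A directed graph on [n] is a relation e, where e j i means that (j, i) is an
   edge. For symmetric e this is the connectedness of an undirected graph. *)
Definition strongly_connected {n : nat} (e : rel 'I_n) : Prop :=
  forall i j, connect e i j.

Definition graph_of {R : realType} {n : nat} (A : 'M[R]_n) : rel 'I_n :=
  fun j i => 0 < A i j.

Definition spanning_tree {n : nat} (e T : rel 'I_n) (root : 'I_n) : Prop :=
  [/\ subrel T e,
      forall j, ~~ T j root,
      forall i, i != root -> #|[set j | T j i]%SET| = 1%N
    & forall i, connect T root i].

Definition spanning_root {R : realType} {n : nat} (A : 'M[R]_n) (i : 'I_n) :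
  Prop := exists T : rel 'I_n, spanning_tree (graph_of A) T i.

Definition compliant {R : realType} {n : nat} (e : rel 'I_n) (A : 'M[R]_n) :
  Prop := forall i j, i != j -> ~~ e j i -> A i j = 0.

Record weight_matrices {R : realType} {n : nat} (e : rel 'I_n)
    (Rw Cw : 'M[R]_n) : Prop := WeightMatrices {
  wm_R_ge0 : forall i j, 0 <= Rw i j;
  wm_R_stoch : forall i, \sum_j Rw i j = 1;
  wm_R_diag : forall i, 0 < Rw i i;
  wm_C_ge0 : forall i j, 0 <= Cw i j;
  wm_C_stoch : forall j, \sum_i Cw i j = 1;
  wm_C_diag : forall i, 0 < Cw i i;
  wm_R_compliant : compliant e Rw;
  wm_C_compliant : compliant e Cw;
  wm_R_tree : exists i, spanning_root Rw i;
  wm_C_tree : exists i, spanning_root Cw^T i;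
  wm_roots : exists i, spanning_root Rw i /\ spanning_root Cw^T i
}.

Definition stochastic {R : realType} {n : nat} (v : 'cV[R]_n) : Prop :=
  (forall i, 0 <= v i 0) /\ \sum_i v i 0 = 1.

Definition Fsum {R : realType} {n m : nat} (f : 'I_n -> 'cV[R]_m -> R)
    (theta : 'cV[R]_m) : R :=
  \sum_i f i theta.

(* x = (x_1, ..., x_n) in R^(n m), agent-major as in A *t 1%:M. *)
Definition block {R : realType} {n m : nat} (x : 'cV[R]_(n * m)) (i : 'I_n) :
  'cV[R]_m := \col_j x (mxtens_index (i, j)) 0.

Definition Fc {R : realType} {n m : nat} (f : 'I_n -> 'cV[R]_m -> R)
    (x : 'cV[R]_(n * m)) : R :=
  \sum_i f i (block x i).

Definition ones {R : realType} {n : nat} : 'cV[R]_n := const_mx 1.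

Definition lift_mx {R : realType} {n : nat} (m : nat) (A : 'M[R]_n) :
  'M[R]_(n * m) := A *t (1%:M : 'M[R]_m).

Definition consensus {R : realType} {n m : nat} (theta : 'cV[R]_m) :
  'cV[R]_(n * m) := (ones : 'cV[R]_n) *t theta.

Definition dsqrt {R : realType} {n : nat} (v : 'cV[R]_n) : 'M[R]_n :=
  diag_mx (map_mx Num.sqrt v^T).

Definition JR {R : realType} {n : nat} (m : nat) (r : 'cV[R]_n) :
  'M[R]_(n * m) := lift_mx m (ones *m r^T).

Definition JC {R : realType} {n : nat} (m : nat) (c : 'cV[R]_n) :
  'M[R]_(n * m) := lift_mx m (c *m ones^T).

Definition normR {R : realType} {n m : nat} (r : 'cV[R]_n)
    (x : 'cV[R]_(n * m)) : R :=
  norm2 (lift_mx m (dsqrt r) *m x).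

Definition normC {R : realType} {n m : nat} (c : 'cV[R]_n)
    (y : 'cV[R]_(n * m)) : R :=
  norm2 (lift_mx m (invmx (dsqrt c)) *m y).

Definition rhoR {R : realType} {n : nat} (Rw : 'M[R]_n) (r : 'cV[R]_n) : R :=
  opnorm2 (dsqrt r *m (Rw - ones *m r^T) *m invmx (dsqrt r)).

Definition rhoC {R : realType} {n : nat} (Cw : 'M[R]_n) (c : 'cV[R]_n) : R :=
  opnorm2 (invmx (dsqrt c) *m (Cw - c *m ones^T) *m dsqrt c).

Definition zeta {R : realType} {n : nat} (r c : 'cV[R]_n) : R :=
  (r^T *m c) 0 0.

Definition K2R {R : realType} {n : nat} (r : 'cV[R]_n) : R :=
  1 / Num.sqrt (vmin r).
Definition K2C {R : realType} {n : nat} (c : 'cV[R]_n) : R :=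
  Num.sqrt (vmax c).
Definition KC2 {R : realType} {n : nat} (c : 'cV[R]_n) : R :=
  1 / Num.sqrt (vmin c).
Definition KRC {R : realType} {n : nat} (r c : 'cV[R]_n) : R :=
  Num.sqrt (vmax r * vmax c).
Definition K2 {R : realType} {n : nat} (r c : 'cV[R]_n) (eps_x : R) : R :=
  2 * KRC r c ^+ 2 * (1 + 1 / eps_x).
Definition K3 {R : realType} (n : nat) (eps_x : R) : R :=
  2 * n%:R * (1 + 1 / eps_x).
Definition K4 {R : realType} {n : nat} (c : 'cV[R]_n) (Lc : R) : R :=
  3 * KC2 c ^+ 2 * K2C c ^+ 2 * Lc ^+ 2.
Definition K5 {R : realType} {n : nat} (c : 'cV[R]_n) (Lc : R) : R :=
  3 * KC2 c ^+ 2 * Lc ^+ 2.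
Definition K6 {R : realType} {n : nat} (r c : 'cV[R]_n) (Lc : R) : R :=
  3 * KC2 c ^+ 2 * K2R r ^+ 2 * Lc ^+ 2.

(* Lc, LF: Lipschitz constants of the gradients of Fc and F. The bounds on
   eps_x and eps_y read as 0 (instead of +oo) if rhoR, resp. rhoC, vanishes;
   this is harmless, since for nonsingular Rw, Cw it only happens when n = 1,
   and then rhoR = 0 already contradicts 0 < kappa. *)
Record step_size {R : realType} {n : nat} (Rw Cw : 'M[R]_n) (r c : 'cV[R]_n)
    (Lc LF eps_x eps_y eps kappa alpha : R) : Prop := StepSize {
  ss_eps_x_gt0 : 0 < eps_x;
  ss_eps_x_lt : eps_x < (1 - rhoR Rw r ^+ 2) / (2 * rhoR Rw r ^+ 2);
  ss_eps_y_gt0 : 0 < eps_y;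
  ss_eps_y_lt : eps_y < (1 - rhoC Cw c ^+ 2) / rhoC Cw c ^+ 2;
  ss_eps_gt0 : 0 < eps;
  ss_eps_lt : eps < 2 * zeta r c / (1 + zeta r c);
  ss_kappa_gt0 : 0 < kappa;
  ss_kappa_le :
    kappa <= rhoR Rw r ^+ 2 * eps_x / (K6 r c Lc * (1 + 1 / eps_y));
  ss_alpha1 : alpha <
    2 * (1 - rhoR Rw r ^+ 2 * (1 + 2 * eps_x)) /
    (n%:R * Lc ^+ 2 * K2R r ^+ 2 * (1 + zeta r c / eps));
  ss_alpha2 : alpha <
    (1 - rhoC Cw c ^+ 2 * (1 + eps_y)) /
    (1 / (2 * kappa) * K2C c ^+ 2 * (1 + 1 / eps + 2 * LF)
     + K2 r c eps_x / kappa + K4 c Lc * (1 + 1 / eps_y));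
  ss_alpha3 : alpha <
    (zeta r c - eps / 2 * (zeta r c + 1)) /
    (LF * zeta r c ^+ 2 + K3 n eps_x + K5 c Lc * kappa)
}.

(* The pair (x, y) is stacked as col_mx x y. *)
Definition lyapunov {R : realType} {n m : nat} (f : 'I_n -> 'cV[R]_m -> R)
    (r c : 'cV[R]_n) (kappa : R) (z : 'cV[R]_(n * m + n * m)) : R :=
  let x := usubmx z in let y := dsubmx z in
  Fc f (JR m r *m x) + normR r ((1%:M - JR m r) *m x) ^+ 2
  + kappa * normC c ((1%:M - JC m c) *m y) ^+ 2.

(* The state u = (x, h) is stacked as col_mx x h. *)
Definition dogt_step {R : realType} {n m : nat} (f : 'I_n -> 'cV[R]_m -> R)
    (Rw Cw : 'M[R]_n) (alpha : R) (u : 'cV[R]_(n * m + n * m)) :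
  'cV[R]_(n * m + n * m) :=
  let x := usubmx u in let h := dsubmx u in
  let WR := lift_mx m Rw in let WC := lift_mx m Cw in
  col_mx (WR *m x - alpha *: (h + gradient (Fc f) x))
         (WC *m h + (WC - 1%:M) *m gradient (Fc f) x).

Definition dogt {R : realType} {n m : nat} (f : 'I_n -> 'cV[R]_m -> R)
    (Rw Cw : 'M[R]_n) (alpha : R) (u0 : 'cV[R]_(n * m + n * m)) (nu : nat) :
  'cV[R]_(n * m + n * m) :=
  iter nu (dogt_step f Rw Cw alpha) u0.

Definition dogt_x {R : realType} {n m : nat} (f : 'I_n -> 'cV[R]_m -> R)
    (Rw Cw : 'M[R]_n) (alpha : R) (u0 : 'cV[R]_(n * m + n * m)) (nu : nat) :
  'cV[R]_(n * m) :=
  usubmx (dogt f Rw Cw alpha u0 nu).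

Definition init_space {R : realType} {n : nat} (m : nat) (Cw : 'M[R]_n) :
  set 'cV[R]_(n * m + n * m) :=
  [set u | range (fun z : 'cV[R]_(n * m) => (lift_mx m Cw - 1%:M) *m z)
             (dsubmx u)].

Definition consensual_saddles {R : realType} {n m : nat}
    (f : 'I_n -> 'cV[R]_m -> R) : set 'cV[R]_(n * m + n * m) :=
  [set col_mx (consensus theta) (- gradient (Fc f) (consensus theta))
     | theta in strict_saddle (Fsum f)].

Definition box {R : realType} {d : nat} (a b : 'cV[R]_d) : set 'cV[R]_d :=
  [set t | forall i, a i 0 <= t i 0 <= b i 0].

Definition box_vol {R : realType} {d : nat} (a b : 'cV[R]_d) : R :=
  \prod_i (b i 0 - a i 0).

(* d-dimensional Lebesgue outer measure (for d > 0), by covers by boxes. *)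
Definition lebesgue_outer {R : realType} {d : nat} (A : set 'cV[R]_d) :
  \bar R :=
  ereal_inf [set s | exists a b : nat -> 'cV[R]_d,
    [/\ forall k i, a k i 0 <= b k i 0,
        A `<=` \bigcup_k box (a k) (b k)
      & s = (\sum_(0 <= k <oo) (box_vol (a k) (b k))%:E)%E]].

(* A linear subspace V carries the Lebesgue measure transported from R^d by
   any isometry t |-> B t onto V (the columns of B are an orthonormal basis). *)
Definition lebesgue_null_on {R : realType} {k : nat} (V A : set 'cV[R]_k) :
  Prop :=
  exists (d : nat) (B : 'M[R]_(k, d)),
    [/\ B^T *m B = 1%:M, range (fun t : 'cV[R]_d => B *m t) = V
      & lebesgue_outer [set t | A (B *m t)] = 0%E].

Notation borelType R k := (g_sigma_algebraType (@open 'cV[R]_k)).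

Definition abs_cont_on {R : realType} {k : nat} (V : set 'cV[R]_k)
    (P : probability (borelType R k) R) : Prop :=
  P V = 1%E /\
  forall A : set (borelType R k), measurable A -> lebesgue_null_on V A ->
    P A = 0%E.

(* Main.v *)
(* Write the stacked vectors as m x n matrices X (the estimates), Y = H + G(X) (the trackers), G the
   map of local gradients. The step-size conditions make the Lyapunov function
   F(X r) + |X - X r 1^T|_R^2 + kappa |Y - Y 1 c^T|_C^2 decrease by a fixed multiple of
   gap = consensus error^2 + tracking error^2 + |Y 1|^2.

   Saddles. The same descent estimate holds for the linearization at a consensual strict saddle and
   its quadratic Lyapunov function q; hence V = - q - eps |.|^2 is expanded by a factor mu > 1, and by
   strict differentiability V(g u - g v) >= mu V(u - v) for u, v close to the saddle. Two orbits
   staying in a small ball thus satisfy V(u - v) <= 0, and since V > 0 in the direction of negative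
   curvature, the trapped points lie on a Lipschitz graph, a null set. As alpha < sigma_min(C R) / Lc,
   the step g is injective with Lipschitz inverse, so the preimages of null sets are null; countably
   many balls with rational data cover all saddles.

   Convergence. The iterates are bounded by coercivity. At a cluster point the KL inequality of F
   yields one for the Lyapunov value along the trajectory, and the usual length argument gives
   convergence; the limit is a consensual critical point, almost surely not a strict saddle. The
   rates follow from the KL exponent of the Lyapunov function, whose gradient is bounded by the
   square root of the gap. *)
From mathcomp Require Import zify ring lra.
Require Import Defs.

Set Implicit Arguments.
Unset Strict Implicit.
Unset Printing Implicit Defensive.

Import Order.TTheory GRing.Theory Num.Theory.
Import numFieldNormedType.Exports.

Local Open Scope classical_set_scope.
Local Open Scope ring_scope.

(** * Euclidean geometry of matrices *)

(** Agents are columns, so a Kronecker product of A with the identity acts as right multiplication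
    by the transpose of A, and the norm of an n by n matrix controls all m coordinates row by row.
    The descent holds only on the invariant subspace [H 1 = 0], where [Y 1] is the sum of the local
    gradients. This is the initialization space, so null sets must be measured inside it, in the
    coordinates of an orthonormal basis. The linearized step need not be symmetric and may have
    centre directions; instead of splitting its spectrum, one strictly expanding quadratic form does
    the work of a centre-stable manifold theorem. The form q is bounded by the gap, so it vanishes
    where the gap does; subtracting a small multiple of the squared norm makes the form negative
    there without losing its positive direction. For convergence F is assumed KL, whereas the
    decreasing quantity is the Lyapunov value. Its other terms are squares, desingularized by a
    square root, so a rescaled desingularizer of F plus a square root serves. KL bounds the root D
    of the gap from below at the index where descent bounds its square from above, hence D itself
    telescopes. *)

Definition ip {R : realType} {p q : nat} (A B : 'M[R]_(p, q)) : R :=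
  \tr (A *m B^T).

(** Frobenius norm. It agrees with [norm2] on columns ([norm2E]), and a stacked vector has the same
    norm as its matrix form ([nrm_mat]). *)
Definition nrm {R : realType} {p q : nat} (A : 'M[R]_(p, q)) : R :=
  Num.sqrt (ip A A).

Section FrobeniusInnerProduct.
Context {R : realType} {p q : nat}.
Implicit Types (A B C : 'M[R]_(p, q)) (a : R).

Lemma ipE A B : ip A B = \sum_i \sum_j A i j * B i j.
Proof.
rewrite /ip /mxtrace; apply: eq_bigr => i _; rewrite mxE.
by apply: eq_bigr => j _; rewrite mxE.
Qed.

Lemma ipC A B : ip A B = ip B A.
Proof. by rewrite /ip -mxtrace_tr trmx_mul trmxK. Qed.

Lemma ipDl A B C : ip (A + B) C = ip A C + ip B C.
Proof. by rewrite /ip mulmxDl mxtraceD. Qed.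

Lemma ipZl a A B : ip (a *: A) B = a * ip A B.
Proof. by rewrite /ip -scalemxAl mxtraceZ. Qed.

Lemma ipNl A B : ip (- A) B = - ip A B.
Proof. by rewrite -scaleN1r ipZl mulN1r. Qed.

Lemma ipBl A B C : ip (A - B) C = ip A C - ip B C.
Proof. by rewrite ipDl ipNl. Qed.

Lemma ipDr A B C : ip A (B + C) = ip A B + ip A C.
Proof. by rewrite ipC ipDl !(ipC A). Qed.

Lemma ipZr a A B : ip A (a *: B) = a * ip A B.
Proof. by rewrite ipC ipZl ipC. Qed.

Lemma ipNr A B : ip A (- B) = - ip A B.
Proof. by rewrite ipC ipNl ipC. Qed.

Lemma ipBr A B C : ip A (B - C) = ip A B - ip A C.
Proof. by rewrite ipDr ipNr. Qed.

Lemma ip0l A : ip 0 A = 0.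
Proof. by rewrite -(scale0r A) ipZl mul0r. Qed.

Lemma ip0r A : ip A 0 = 0.
Proof. by rewrite ipC ip0l. Qed.

Lemma ip_ge0 A : 0 <= ip A A.
Proof. by rewrite ipE; do 2!apply: sumr_ge0 => ? _; rewrite -expr2 sqr_ge0. Qed.

Lemma ip_entry A i j : A i j ^+ 2 <= ip A A.
Proof.
have h k : 0 <= \sum_j A k j * A k j.
  by apply: sumr_ge0 => l _; rewrite -expr2 sqr_ge0.
rewrite ipE (bigD1 i) //= (bigD1 j) //= -expr2 -addrA lerDl addr_ge0 //.
  by apply: sumr_ge0 => l _; rewrite -expr2 sqr_ge0.
by apply: sumr_ge0 => l _; apply: h.
Qed.

Lemma ip_eq0 A : ip A A = 0 -> A = 0.
Proof.
move=> A0; apply/matrixP => i j; rewrite mxE; apply/eqP.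
by rewrite -sqrf_eq0 eq_le sqr_ge0 andbT -A0 ip_entry.
Qed.

Lemma ip_CS A B : ip A B ^+ 2 <= ip A A * ip B B.
Proof.
have [B0|B0] := eqVneq (ip B B) 0.
  by rewrite (ip_eq0 B0) !ip0r expr0n mulr0.
have {}B0 : 0 < ip B B by rewrite lt_def B0 ip_ge0.
have := ip_ge0 (ip B B *: A - ip A B *: B).
rewrite ipBl !ipBr !ipZl !ipZr (ipC B A) => h.
have : 0 <= ip B B * (ip A A * ip B B - ip A B ^+ 2) by nra.
by rewrite pmulr_rge0// subr_ge0.
Qed.

Lemma nrm_sq A : nrm A ^+ 2 = ip A A.
Proof. by rewrite /nrm sqr_sqrtr ?ip_ge0. Qed.

Lemma nrm_ge0 A : 0 <= nrm A.
Proof. exact: sqrtr_ge0. Qed.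

Lemma nrm_eq0 A : nrm A = 0 -> A = 0.
Proof. by move=> A0; apply: ip_eq0; rewrite -nrm_sq A0 expr0n. Qed.

Lemma nrm0 : nrm (0 : 'M[R]_(p, q)) = 0.
Proof. by rewrite /nrm ip0l sqrtr0. Qed.

Lemma nrm_gt0 A : A != 0 -> 0 < nrm A.
Proof.
by move=> A0; rewrite lt_def nrm_ge0 andbT; apply: contra_neq A0; apply: nrm_eq0.
Qed.

Lemma nrmN A : nrm (- A) = nrm A.
Proof. by rewrite /nrm ipNl ipNr opprK. Qed.

Lemma nrmB A B : nrm (A - B) = nrm (B - A).
Proof. by rewrite -nrmN opprB. Qed.

Lemma nrmZ a A : nrm (a *: A) = `|a| * nrm A.
Proof.
by rewrite /nrm ipZl ipZr mulrA -expr2 sqrtrM ?sqr_ge0// sqrtr_sqr.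
Qed.

Lemma le_nrm A (t : R) : 0 <= t -> ip A A <= t ^+ 2 -> nrm A <= t.
Proof.
by move=> t0 h; rewrite -(ler_pXn2r (ltn0Sn 1)) ?nnegrE ?nrm_ge0// nrm_sq.
Qed.

Lemma ler_norm_ip A B : `|ip A B| <= nrm A * nrm B.
Proof.
rewrite -(ler_pXn2r (ltn0Sn 1)) ?nnegrE ?mulr_ge0 ?nrm_ge0//.
by rewrite exprMn !nrm_sq real_normK ?num_real// ip_CS.
Qed.

Lemma ler_ip A B : ip A B <= nrm A * nrm B.
Proof. exact: le_trans (ler_norm _) (ler_norm_ip A B). Qed.

Lemma nrmD A B : nrm (A + B) <= nrm A + nrm B.
Proof.
apply: le_nrm; first by rewrite addr_ge0 ?nrm_ge0.
rewrite ipDl !ipDr (ipC B A); have := ler_ip A B.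
by rewrite sqrrD !nrm_sq mulr2n; lra.
Qed.

Lemma nrmD_sub A B C : nrm (A - C) <= nrm (A - B) + nrm (B - C).
Proof. by have := nrmD (A - B) (B - C); rewrite addrA subrK. Qed.

(** Expansion of [|s A - B|^2 >= 0]. The constants of the descent estimate come from choices of the
    weight [s]. *)
Lemma nrm_young (s : R) A B : 0 < s ->
  nrm (A + B) ^+ 2 <= (1 + s) * nrm A ^+ 2 + (1 + s^-1) * nrm B ^+ 2.
Proof.
move=> s0; rewrite !nrm_sq ipDl !ipDr (ipC B A).
have := ip_ge0 (s *: A - B); rewrite ipBl !ipBr !ipZl !ipZr (ipC B A) => h.
rewrite -(ler_pM2l s0).
have -> : s * ((1 + s) * ip A A + (1 + s^-1) * ip B B)
  = s * (1 + s) * ip A A + (s + s * s^-1) * ip B B by ring.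
by rewrite mulfV ?gt_eqF//; lra.
Qed.

Lemma norm_entry_nrm A i j : `|A i j| <= nrm A.
Proof.
rewrite -(ler_pXn2r (ltn0Sn 1)) ?nnegrE ?nrm_ge0//.
by rewrite nrm_sq real_normK ?num_real// ip_entry.
Qed.

Lemma mx_norm_nrm A : `|A| <= nrm A.
Proof.
rewrite /Num.norm/= mx_normrE; apply/bigmax_leP; split; first exact: nrm_ge0.
by move=> i _; exact: norm_entry_nrm.
Qed.

Lemma norm_entry_mx_norm A i j : `|A i j| <= `|A|.
Proof. by rewrite [leRHS]/Num.norm/= mx_normrE; exact: (le_bigmax _ (fun ij => `|A ij.1 ij.2|) (i, j)). Qed.

Lemma nrm_mx_norm A : nrm A <= (p * q)%:R * `|A|.
Proof.
apply: le_nrm; first by rewrite mulr_ge0.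
rewrite ipE; apply: (@le_trans _ _ (\sum_(i < p) \sum_(j < q) `|A| ^+ 2)).
  apply: ler_sum => i _; apply: ler_sum => j _.
  by rewrite -expr2 -real_normK ?num_real// ler_pXn2r ?nnegrE// norm_entry_mx_norm.
rewrite sumr_const sumr_const !card_ord -mulrnA -[leLHS]mulr_natl mulnC exprMn.
apply: ler_wpM2r; first exact: sqr_ge0.
by rewrite -natrX ler_nat; case: (p * q)%N => // k; rewrite leq_pmulr.
Qed.

Lemma nrm_sum (I : Type) (r : seq I) (P : pred I) (F : I -> 'M[R]_(p, q)) :
  nrm (\sum_(i <- r | P i) F i) <= \sum_(i <- r | P i) nrm (F i).
Proof.
elim/big_rec2: _ => [|i y x _ h]; first by rewrite nrm0.
by rewrite (le_trans (nrmD _ _))// lerD2l.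
Qed.

End FrobeniusInnerProduct.

Section FrobeniusProduct.
Context {R : realType}.

Lemma ip_mulr {p q s : nat} (A : 'M[R]_(p, q)) (N : 'M[R]_(q, s)) (B : 'M[R]_(p, s)) :
  ip (A *m N) B = ip A (B *m N^T).
Proof. by rewrite /ip trmx_mul trmxK mulmxA. Qed.

Lemma ip_mull {p q s : nat} (N : 'M[R]_(p, q)) (A : 'M[R]_(q, s)) (B : 'M[R]_(p, s)) :
  ip (N *m A) B = ip A (N^T *m B).
Proof. by rewrite /ip trmx_mul trmxK -mulmxA mxtrace_mulC -mulmxA. Qed.

Lemma ip_tr {p q : nat} (A B : 'M[R]_(p, q)) : ip A^T B^T = ip A B.
Proof. by rewrite /ip trmxK mxtrace_mulC -mxtrace_tr trmx_mul trmxK. Qed.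

Lemma nrm_tr {p q : nat} (A : 'M[R]_(p, q)) : nrm A^T = nrm A.
Proof. by rewrite /nrm ip_tr. Qed.

Lemma ip_rows {p q : nat} (A B : 'M[R]_(p, q)) :
  ip A B = \sum_i ip (row i A) (row i B).
Proof.
rewrite ipE; apply: eq_bigr => i _; rewrite ipE big_ord1.
by apply: eq_bigr => j _; rewrite !mxE.
Qed.

Lemma ip_cols {p q : nat} (A B : 'M[R]_(p, q)) :
  ip A B = \sum_j ip (col j A) (col j B).
Proof.
rewrite -ip_tr ip_rows; apply: eq_bigr => j _.
by rewrite -!tr_col ip_tr.
Qed.

Lemma nrmM {p q s : nat} (A : 'M[R]_(p, q)) (B : 'M[R]_(q, s)) :
  nrm (A *m B) <= nrm A * nrm B.
Proof.
apply: le_nrm; first by rewrite mulr_ge0 ?nrm_ge0.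
rewrite exprMn !nrm_sq ipE ip_rows -(ip_tr B) ip_rows mulr_suml.
apply: ler_sum => i _; rewrite mulr_sumr; apply: ler_sum => j _.
have := ip_CS (row i A) (row j B^T); rewrite [X in X ^+ 2]ipE big_ord1.
rewrite -expr2; set x := (A *m B) i j; suff -> : \sum_k row i A 0 k * row j B^T 0 k = x by [].
by rewrite /x mxE; apply: eq_bigr => k _; rewrite !mxE.
Qed.

Lemma norm2E {k : nat} (x : 'cV[R]_k) : norm2 x = nrm x.
Proof.
rewrite /norm2 /nrm ipE; congr Num.sqrt; apply: eq_bigr => i _.
by rewrite big_ord1 expr2.
Qed.

Lemma opnorm2_ub {p q : nat} (N : 'M[R]_(p, q)) (v : 'cV[R]_q) :
  nrm (N *m v) <= opnorm2 N * nrm v.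
Proof.
have [->|v0] := eqVneq v 0; first by rewrite mulmx0 !nrm0 mulr0.
have nv := nrm_gt0 v0.
rewrite -ler_pdivrMr// mulrC -[_^-1]ger0_norm ?invr_ge0 ?nrm_ge0// -nrmZ.
rewrite scalemxAr -norm2E /opnorm2; apply: ub_le_sup; last first.
  exists ((nrm v)^-1 *: v) => //=.
  by rewrite norm2E nrmZ ger0_norm ?invr_ge0 ?nrm_ge0// mulVf ?gt_eqF.
(* The Frobenius norm bounds the set, which makes its [sup] a genuine least upper bound. *)
exists (nrm N) => _ [w /= w1 <-]; rewrite norm2E in w1; rewrite norm2E.
by rewrite (le_trans (nrmM _ _))// ler_piMr// nrm_ge0.
Qed.

Lemma opnorm2_ge0 {p q : nat} (N : 'M[R]_(p, q)) : 0 <= opnorm2 N.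
Proof.
rewrite /opnorm2; apply: ub_le_sup.
  exists (nrm N) => _ [w /= w1 <-]; rewrite norm2E in w1; rewrite norm2E.
  by rewrite (le_trans (nrmM _ _))// ler_piMr// nrm_ge0.
by exists 0; rewrite /= ?mulmx0 norm2E nrm0.
Qed.

(** Each row of [Z N^T] is N applied to a row of Z. This is how [rhoR] and [rhoC], norms of n by n
    matrices, act on states with m rows. *)
Lemma opnorm2_mulr {p q s : nat} (N : 'M[R]_(p, q)) (Z : 'M[R]_(s, q)) :
  nrm (Z *m N^T) <= opnorm2 N * nrm Z.
Proof.
apply: le_nrm; first by rewrite mulr_ge0 ?nrm_ge0 ?opnorm2_ge0.
rewrite exprMn nrm_sq !ip_rows mulr_sumr; apply: ler_sum => i _.
rewrite row_mul -!nrm_sq -exprMn ler_pXn2r ?nnegrE ?mulr_ge0 ?nrm_ge0 ?opnorm2_ge0//.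
by rewrite -nrm_tr trmx_mul trmxK -(nrm_tr (row i Z)) opnorm2_ub.
Qed.

End FrobeniusProduct.

(** * Gradients and Hessians *)

Section DirectionalDerivatives.
Context {R : realType} {k : nat}.
Implicit Types (f : 'cV[R]_k -> R) (x v : 'cV[R]_k).

Lemma derive_gradient f x v : differentiable f x ->
  'D_v f x = ip (gradient f x) v.
Proof.
move=> df; rewrite deriveE//.
have -> : v = \sum_j v j 0 *: basis_vec j :> 'cV[R]_k.
  rewrite [LHS]matrix_sum_delta; apply: eq_bigr => j _.
  by rewrite big_ord1.
rewrite linear_sum ipE -[LHS]/(\sum_j 'd f x _)/=.
apply: eq_bigr => j _; rewrite big_ord1 linearZ /= !mxE -deriveE//= mulrC; congr (_ * _).
rewrite summxE (bigD1 j)//= big1 => [|i ij].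
  by rewrite !mxE !eqxx mulr1 addr0.
by rewrite !mxE eq_sym (negbTE ij) mulr0.
Qed.

Lemma is_derive_line f x v (t : R) : differentiable f (x + t *: v) ->
  is_derive t 1 (fun s : R => f (x + s *: v)) (ip (gradient f (x + t *: v)) v).
Proof.
move=> df.
have eqf : (fun h : R => h^-1 *: (((fun s : R => f (x + s *: v)) \o shift t) (h *: (1 : R)) - f (x + t *: v)))
   = (fun h : R => h^-1 *: ((f \o shift (x + t *: v)) (h *: v) - f (x + t *: v))).
  apply/funext => h /=; congr (_ *: (f _ - _)).
  by rewrite scalerDl [h *: 1]mulr1 addrCA.
have dv : derivable f (x + t *: v) v by exact: diff_derivable.
apply: DeriveDef; first by rewrite /derivable eqf.
by rewrite -derive_gradient// /derive eqf.
Qed.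

Lemma mean_value_gradient f x v : (forall y, differentiable f y) ->
  exists t : R, [/\ 0 <= t, t <= 1 &
    f (x + v) - f x = ip (gradient f (x + t *: v)) v].
Proof.
move=> df.
have [|u _||t tI E] := @MVT_segment R (fun s : R => f (x + s *: v))
  (fun t => ip (gradient f (x + t *: v)) v) 0 1.
- exact: ler01.
- exact: is_derive_line.
- apply: continuous_subspaceT => u.
  by apply: differentiable_continuous; apply/derivable1_diffP;
    have /@ex_derive := is_derive_line (df (x + u *: v)).
exists t; move: tI; rewrite in_itv/= => /andP[t0 t1]; split => //.
by move: E; rewrite scale1r scale0r addr0 subr0 mulr1.
Qed.

(* The derivative of [f (x + t v) - t <gradient f x, v> - K t^2 |v|^2 / 2] is
   nonpositive for [t >= 0]. *)
Lemma lipschitz_gradient_descent f (K : R) x v :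
    (forall y, differentiable f y) -> lipschitz2 K (gradient f) ->
  f (x + v) <= f x + ip (gradient f x) v + K / 2 * nrm v ^+ 2.
Proof.
move=> df fK.
pose psi := fun t : R => f (x + t *: v) - (ip (gradient f x) v * t + K / 2 * nrm v ^+ 2 * (t * t)).
pose dpsi := fun t : R => ip (gradient f (x + t *: v)) v - (ip (gradient f x) v + K * t * nrm v ^+ 2).
have dp (t : R) : is_derive t 1 psi (dpsi t).
  rewrite /psi /dpsi; apply: is_derive_eq; first by apply: is_deriveB; first exact: is_derive_line.
  by rewrite /GRing.scale/=; lra.
have [||t tI E] := @MVT_segment R psi dpsi 0 1.
- exact: ler01.
- apply: continuous_subspaceT => u.
  by apply: differentiable_continuous; apply/derivable1_diffP; have /@ex_derive   := dp u.
move: tI; rewrite in_itv/= => /andP[t0 t1].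
have p0 : psi 0 = f x by rewrite /psi scale0r !mulr0 addr0 !addr0 subr0.
have p1 : psi 1 = f (x + v) - (ip (gradient f x) v + K / 2 * nrm v ^+ 2).
  by rewrite /psi scale1r !mulr1.
suff : dpsi t <= 0 by lra.
have := fK (x + t *: v) x; rewrite !norm2E addrAC subrr add0r nrmZ ger0_norm// => hl.
have := ler_ip (gradient f (x + t *: v) - gradient f x) v.
rewrite ipBl /dpsi => hi.
have {hl} := ler_wpM2r (nrm_ge0 v) hl.
have -> : K * (t * nrm v) * nrm v = K * t * nrm v ^+ 2 by rewrite expr2 !mulrA.
by move=> h2; rewrite subr_le0 -lerBlDl (le_trans hi)// (le_trans h2).
Qed.

End DirectionalDerivatives.

(** * Strict differentiability and Hessians *)

Section SecondOrder.
Context {R : realType} {k : nat}.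
Implicit Types (f h : 'cV[R]_k -> R) (x v : 'cV[R]_k).

Lemma nrm_le_entries {p q : nat} (A : 'M[R]_(p, q)) (e : R) :
  0 <= e -> (forall i j, `|A i j| <= e) -> nrm A <= (p * q)%:R * e.
Proof.
move=> e0 Ae; apply: le_trans (nrm_mx_norm A) _; rewrite ler_wpM2l//.
by rewrite [leLHS]/Num.norm/= mx_normrE; apply/bigmax_leP.
Qed.

(** The topology is that of the sup norm; by equivalence of the norms, neighbourhoods can be tested
    on Euclidean balls. *)
Lemma near_nrmP {p q : nat} (x : 'M[R]_(p, q)) (P : set 'M[R]_(p, q)) :
  (\forall y \near x, P y) <-> exists2 e, 0 < e & forall y, nrm (y - x) < e -> P y.
Proof.
split=> [/nbhs_normP[e/= e0 xP]|[e e0 xP]].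
  exists e => // y xy; apply: xP => /=; rewrite distrC.
  exact: le_lt_trans (mx_norm_nrm _) xy.
have pq : 0 < (p * q)%:R + 1 :> R by rewrite ltr_pwDr.
apply/nbhs_normP; exists (e / ((p * q)%:R + 1)); first by rewrite /= divr_gt0.
move=> y /=; rewrite ltr_pdivlMr// distrC mulrC => xy; apply: xP.
apply: le_lt_trans (nrm_mx_norm _) _; apply: le_lt_trans xy.
by rewrite ler_wpM2r// lerDl.
Qed.

(** One radius for finitely many coordinates or agents: monotonicity in [d] allows a minimum. *)
Lemma finite_delta (I : finType) (P : I -> R -> Prop) :
  (forall i d d', d' <= d -> P i d -> P i d') ->
  (forall i, exists2 d, 0 < d & P i d) ->
  exists2 d, 0 < d & forall i, P i d.
Proof.
move=> Pm Pd.
suff [d d0 dP] : exists2 d, 0 < d & forall i, i \in enum I -> P i d.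
  by exists d => // i; apply: dP; rewrite mem_enum.
elim: (enum I) => [|i s [d d0 dP]]; first by exists 1.
have [e e0 eP] := Pd i; exists (Num.min d e); first by rewrite lt_min d0.
move=> j; rewrite inE => /predU1P[->|/dP].
  by apply: Pm eP; rewrite ge_min lexx orbT.
by apply: Pm; rewrite ge_min lexx.
Qed.

Lemma C_class_pred p f : C_class p.+1 f -> C_class p f.
Proof.
elim: p f => [|p ih] f [df pf] /=; first by move=> x; exact: differentiable_continuous.
by split => // j; apply: ih; apply: pf.
Qed.

Lemma C_class_le p q f : (p <= q)%N -> C_class q f -> C_class p f.
Proof.
elim: q => [|q ih]; first by rewrite leqn0 => /eqP ->.
by rewrite leq_eqVlt => /predU1P[->//|pq fq]; apply: ih => //; exact: C_class_pred.
Qed.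

Lemma continuous_gradient h x (e : R) : C_class 1 h -> 0 < e ->
  exists2 d, 0 < d & forall y, nrm (y - x) < d -> nrm (gradient h y - gradient h x) <= e.
Proof.
(* [k + 1] instead of [k] keeps the divisor positive when [k = 0]. *)
move=> [_ hc] e0; have k0 : 0 < k%:R + 1 :> R by rewrite ltr_pwDr.
have [d d0 dP] : exists2 d, 0 < d & forall j : 'I_k,
    forall y, nrm (y - x) < d -> `|partial j h x - partial j h y| < e / (k%:R + 1).
  apply: finite_delta => [j d d' dd' + y yd|j]; first by apply; exact: lt_le_trans dd'.
  apply/near_nrmP; have /cvgrPdist_lt := hc j x; apply.
  by rewrite divr_gt0.
exists d => // y /dP hy.
have -> : e = (k%:R + 1) * (e / (k%:R + 1)) by rewrite mulrC divfK ?gt_eqF.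
apply: (@le_trans _ _ ((k * 1)%:R * (e / (k%:R + 1)))); last first.
  by apply: ler_wpM2r; [rewrite divr_ge0 ?ltW|rewrite muln1 lerDl].
apply: nrm_le_entries => [|i j]; first by rewrite divr_ge0 ?ltW.
by rewrite !mxE distrC ltW.
Qed.

Lemma nrm_between x y x0 (t d : R) : 0 <= t -> t <= 1 ->
  nrm (x - x0) < d -> nrm (y - x0) < d -> nrm (y + t *: (x - y) - x0) < d.
Proof.
move=> t0 t1 xd yd.
have -> : y + t *: (x - y) - x0 = t *: (x - x0) + (1 - t) *: (y - x0).
  by apply/matrixP => i j; rewrite !mxE; ring.
apply: le_lt_trans (nrmD _ _) _; rewrite !nrmZ !ger0_norm ?subr_ge0//.
move: t0; rewrite le_eqVlt => /predU1P[<-|t0]; first by rewrite mul0r subr0 mul1r add0r.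
move: t1; rewrite le_eqVlt => /predU1P[->|t1]; first by rewrite subrr mul0r mul1r addr0.
have h1 : t * nrm (x - x0) < t * d by rewrite ltr_pM2l.
have h2 : (1 - t) * nrm (y - x0) < (1 - t) * d by rewrite ltr_pM2l ?subr_gt0.
by have := ltrD h1 h2; rewrite -[X in _ < X -> _]mulrDl subrKC mul1r.
Qed.

(** Two-point differentiability, from the mean value theorem and continuity of the gradient. The
    saddle argument compares two orbits, neither of which needs to be at the saddle. *)
Lemma strict_differentiability h x0 (e : R) : C_class 1 h -> 0 < e ->
  exists2 d, 0 < d & forall x y, nrm (x - x0) < d -> nrm (y - x0) < d ->
    `|h x - h y - ip (gradient h x0) (x - y)| <= e * nrm (x - y).
Proof.
move=> hC e0; have [d d0 dP] := continuous_gradient x0 hC e0.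
exists d => // x y xd yd; have [t [t0 t1]] := mean_value_gradient y (x - y) hC.1.
rewrite subrKC => ->; rewrite -ipBl (le_trans (ler_norm_ip _ _))//.
by rewrite ler_wpM2r ?nrm_ge0//; apply: dP; exact: nrm_between.
Qed.

Lemma row_hessian f x i : (row i (hessian f x))^T = gradient (partial i f) x.
Proof. by apply/matrixP => j l; rewrite !mxE. Qed.

Lemma strict_differentiability_gradient f x0 (e : R) : C_class 2 f -> 0 < e ->
  exists2 d, 0 < d & forall x y, nrm (x - x0) < d -> nrm (y - x0) < d ->
    nrm (gradient f x - gradient f y - hessian f x0 *m (x - y)) <= e * nrm (x - y).
Proof.
move=> [_ fC] e0; have k0 : 0 < k%:R + 1 :> R by rewrite ltr_pwDr.
have [d d0 dP] : exists2 d, 0 < d & forall j : 'I_k,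
   forall x y, nrm (x - x0) < d -> nrm (y - x0) < d ->
    `|partial j f x - partial j f y - ip (gradient (partial j f) x0) (x - y)|
    <= e / (k%:R + 1) * nrm (x - y).
  apply: finite_delta => [j d d' dd' + x y xd yd|j].
    by apply; exact: lt_le_trans dd'.
  by apply: strict_differentiability => //; rewrite divr_gt0.
exists d => // x y xd yd.
have e1 : 0 <= e / (k%:R + 1) by rewrite divr_ge0 ?ltW.
apply: (@le_trans _ _ ((k * 1)%:R * (e / (k%:R + 1) * nrm (x - y)))); last first.
  rewrite muln1 mulrA ler_wpM2r ?nrm_ge0// mulrA ler_pdivrMr// mulrC.
  by apply: ler_wpM2l; [exact: ltW|rewrite lerDl].
apply: nrm_le_entries => [|i j]; first by rewrite mulr_ge0 ?nrm_ge0.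
have := dP i x y xd yd; rewrite -row_hessian.
suff -> : ip (row i (hessian f x0))^T (x - y) = (hessian f x0 *m (x - y)) i j.
  by rewrite !mxE.
rewrite ipE mxE; apply: eq_bigr => l _; rewrite big_ord1 (ord1 j) [in LHS]mxE.
by rewrite [row _ _ _ _]mxE.
Qed.

Lemma derive_shift f w v x : 'D_v (fun y => f (y + w)) x = 'D_v f (x + w).
Proof.
rewrite /derive (_ : (fun h : R => h^-1 *: (((fun y => f (y + w)) \o shift x) (h *: v) - f (x + w)))
  = (fun h : R => h^-1 *: ((f \o shift (x + w)) (h *: v) - f (x + w))))//.
by apply/funext => t /=; rewrite addrA.
Qed.

Lemma nrm_basis (i : 'I_k) : nrm (basis_vec i : 'cV[R]_k) = 1.
Proof.
rewrite /nrm ipE (bigD1 i)//= big_ord1 big1 => [|j ji].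
  by rewrite /basis_vec !mxE !eqxx mulr1 addr0 sqrtr1.
by rewrite big_ord1 /basis_vec !mxE (negbTE ji) mul0r.
Qed.

Lemma ip_basis (v : 'cV[R]_k) (i : 'I_k) : ip v (basis_vec i) = v i 0.
Proof.
rewrite ipE (bigD1 i)//= big_ord1 big1 => [|j ji].
  by rewrite /basis_vec !mxE !eqxx mulr1 addr0.
by rewrite big_ord1 /basis_vec !mxE (negbTE ji) mulr0.
Qed.

(* The second difference [f (x + s e_i + s e_j) - f (x + s e_i) - f (x + s e_j)
   + f x] is symmetric in [i, j] and equals [s^2 (hessian f x i j + o(1))]. *)
Lemma second_difference f x (i j : 'I_k) (e : R) : C_class 2 f -> 0 < e ->
  exists2 d, 0 < d & forall s, 0 < s -> s < d ->
  `|f (x + s *: basis_vec i + s *: basis_vec j) - f (x + s *: basis_vec i)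
    - (f (x + s *: basis_vec j) - f x) - s ^+ 2 * hessian f x i j| <= e * s ^+ 2.
Proof.
move=> [df fC] e0.
have [d d0 dP] := strict_differentiability x (fC i) e0.
exists (d / 2); first by rewrite divr_gt0.
move=> s s0 sd; pose w := s *: basis_vec j : 'cV[R]_k.
pose u := fun y : 'cV[R]_k => f (y + w) - f y.
have du1 y : differentiable (fun y : 'cV[R]_k => f (y + w)) y.
  by apply: differentiable_comp => //; exact: differentiableD.
have du y : differentiable u y by exact: differentiableB.
have gu y : gradient u y = gradient f (y + w) - gradient f y.
  apply/matrixP => a b; rewrite !mxE /partial deriveB; last 2 first.
  - exact: diff_derivable.
  - exact: diff_derivable.
  by rewrite derive_shift.
have [t [t0 t1]] := mean_value_gradient x (s *: basis_vec i) du.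
rewrite /u => ->; rewrite gu ipZr ipBl !ip_basis.
set z := x + t *: _; have sn l : nrm (s *: basis_vec l : 'cV[R]_k) = s.
  by rewrite nrmZ nrm_basis mulr1 gtr0_norm.
have zd : nrm (z - x) <= s.
  by rewrite /z addrAC subrr add0r nrmZ sn ger0_norm// ler_piMl// ltW.
have sdd : s < d by lra.
have := dP (z + w) z; rewrite [z + w - z]addrAC subrr add0r sn.
rewrite [z + w - x]addrAC ipZr ip_basis !mxE => h.
rewrite expr2 -!mulrA -mulrBr normrM gtr0_norm// [e * _]mulrCA ler_pM2l//.
apply: h; last exact: le_lt_trans sdd.
apply: le_lt_trans (nrmD _ _) _; rewrite sn.
by move: zd sd; rewrite ltr_pdivlMr//; lra.
Qed.

Lemma hessian_sym f x : C_class 2 f -> (hessian f x)^T = hessian f x.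
Proof.
move=> fC; apply/matrixP => j i; rewrite mxE; apply/eqP; rewrite -subr_eq0 -normr_le0.
apply/ler_addgt0Pr => e e0; rewrite add0r.
have e2 : 0 < e / 2 by rewrite divr_gt0.
have [d1 d10 h1] := second_difference x i j fC e2.
have [d2 d20 h2] := second_difference x j i fC e2.
pose s := Num.min d1 d2 / 2.
have s0 : 0 < s by rewrite divr_gt0// lt_min d10.
have m0 : 0 < Num.min d1 d2 by rewrite lt_min d10.
have sm : s < Num.min d1 d2 by rewrite /s; lra.
have [sd1 sd2] : s < d1 /\ s < d2 by move: sm; rewrite lt_min => /andP.
have {}h1 := h1 s s0 sd1.
have {}h2 := h2 s s0 sd2.
rewrite -(ler_pM2l (exprn_gt0 2 s0)) -[X in X * _]ger0_norm ?sqr_ge0// -normrM.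
move: h1 h2; rewrite [x + s *: basis_vec i + _]addrAC => h1 h2.
set a := f _ in h1 h2; set b := f _ in h1 h2; set c := f _ in h1 h2.
have -> : s ^+ 2 * (hessian f x i j - hessian f x j i)
  = (a - c - (b - f x) - s ^+ 2 * hessian f x j i)
   - (a - b - (c - f x) - s ^+ 2 * hessian f x i j) by ring.
by rewrite (le_trans (ler_normB _ _))//; lra.
Qed.

(** Up to any [e], the Hessian in direction [v] is a difference quotient of the gradient, and the
    Lipschitz constant bounds all such quotients. *)
Lemma hessian_bound f x v (K : R) : C_class 2 f -> lipschitz2 K (gradient f) ->
  nrm (hessian f x *m v) <= K * nrm v.
Proof.
move=> fC fK; have [->|v0] := eqVneq v 0; first by rewrite mulmx0 !nrm0 mulr0.
have nv := nrm_gt0 v0; apply/ler_addgt0Pr => e e0.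
have e1 : 0 < e / nrm v by rewrite divr_gt0.
have [d d0 dP] := strict_differentiability_gradient x fC e1.
pose t := d / nrm v / 2; have t0 : 0 < t by rewrite !divr_gt0.
have td : nrm (t *: v) < d.
  rewrite nrmZ gtr0_norm// /t -mulrA [_ / 2]mulrC mulrA mulfVK ?gt_eqF//.
  by lra.
have := dP (x + t *: v) x; rewrite addrAC !subrr add0r nrm0 => /(_ td d0).
have := fK (x + t *: v) x; rewrite !norm2E [x + _ - x]addrAC subrr add0r => h1 h2.
rewrite -(ler_pM2l t0) -{1}(gtr0_norm t0) -nrmZ scalemxAr.
have -> : hessian f x *m (t *: v) = (gradient f (x + t *: v) - gradient f x)
  - (gradient f (x + t *: v) - gradient f x - hessian f x *m (t *: v)) by rewrite subKr.
apply: le_trans (nrmD _ _) _; rewrite nrmN.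
apply: le_trans (lerD h1 h2) _; rewrite nrmZ gtr0_norm//.
have -> : e / nrm v * (t * nrm v) = t * e by rewrite mulrCA divfK// gt_eqF.
by rewrite mulrDr mulrCA.
Qed.

End SecondOrder.

(** * The weight matrices *)

Section Weights.
Context {R : realType} {n : nat}.
Implicit Types (v r c : 'cV[R]_n).

Lemma vmin_le v i : vmin v <= v i 0.
Proof.
apply: ge_inf; last by exists i.
by exists (- nrm v) => _ [j _ <-]; rewrite lerNl (le_trans (ler_norm _))// normrN norm_entry_nrm.
Qed.

Lemma le_vmax v i : v i 0 <= vmax v.
Proof.
apply: ub_le_sup; last by exists i.
by exists (nrm v) => _ [j _ <-]; rewrite (le_trans (ler_norm _))// norm_entry_nrm.
Qed.

(** The inverse of [dsqrt v] for positive [v] ([invmx_dsqrt]), given by its entries. *)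
Definition rdiag v : 'M[R]_n := diag_mx (\row_j (Num.sqrt (v j 0))^-1).

Lemma mul_dsqrtE {m : nat} (X : 'M[R]_(m, n)) v i j :
  (X *m dsqrt v) i j = X i j * Num.sqrt (v j 0).
Proof. by rewrite /dsqrt mul_mx_diag !mxE. Qed.

Lemma mul_rdiagE {m : nat} (X : 'M[R]_(m, n)) v i j :
  (X *m rdiag v) i j = X i j / Num.sqrt (v j 0).
Proof. by rewrite /rdiag mul_mx_diag !mxE. Qed.

Lemma dsqrtT v : (dsqrt v)^T = dsqrt v.
Proof. by rewrite /dsqrt tr_diag_mx. Qed.

Lemma rdiagT v : (rdiag v)^T = rdiag v.
Proof. by rewrite /rdiag tr_diag_mx. Qed.

Section Positive.
Variable v : 'cV[R]_n.
Hypothesis v_gt0 : forall i, 0 < v i 0.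

Lemma dsqrt_rdiag : dsqrt v *m rdiag v = 1%:M.
Proof.
apply/matrixP => i j; rewrite mul_rdiagE !mxE mulrnAl.
case: (eqVneq i j) => [->|]; last by rewrite !mulr0n.
by rewrite !mulr1n mulfV// gt_eqF// sqrtr_gt0.
Qed.

Lemma invmx_dsqrt : invmx (dsqrt v) = rdiag v.
Proof.
have [u _] := mulmx1_unit dsqrt_rdiag.
by rewrite -[LHS]mulmx1 -dsqrt_rdiag mulKmx.
Qed.

Lemma rdiag_dsqrt : rdiag v *m dsqrt v = 1%:M.
Proof. exact: mulmx1C dsqrt_rdiag. Qed.

Lemma dsqrt_dsqrt_ones : dsqrt v *m (dsqrt v *m ones) = v.
Proof.
rewrite mulmxA; apply/matrixP => i j; rewrite ord1 mxE (bigD1 i)//= big1 ?addr0.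
  by rewrite mul_dsqrtE !mxE eqxx mulr1n mulr1 -expr2 sqr_sqrtr ?ltW.
by move=> k ki; rewrite mul_dsqrtE !mxE eq_sym (negbTE ki) mulr0n !mul0r.
Qed.

Lemma rdiag_rdiag : rdiag v *m (rdiag v *m v) = ones.
Proof.
by rewrite -{3}dsqrt_dsqrt_ones !mulmxA -(mulmxA (rdiag v)) rdiag_dsqrt mulmx1
  rdiag_dsqrt mul1mx.
Qed.

Lemma nrm_dsqrt {m : nat} (X : 'M[R]_(m, n)) :
  nrm (X *m dsqrt v) ^+ 2 = \sum_i \sum_j v j 0 * X i j ^+ 2.
Proof.
rewrite nrm_sq ipE; apply: eq_bigr => i _; apply: eq_bigr => j _.
by rewrite mul_dsqrtE -expr2 exprMn sqr_sqrtr ?ltW// mulrC.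
Qed.

Lemma nrm_rdiag {m : nat} (X : 'M[R]_(m, n)) :
  nrm (X *m rdiag v) ^+ 2 = \sum_i \sum_j (v j 0)^-1 * X i j ^+ 2.
Proof.
rewrite nrm_sq ipE; apply: eq_bigr => i _; apply: eq_bigr => j _.
by rewrite mul_rdiagE -expr2 exprMn exprVn sqr_sqrtr ?ltW// mulrC.
Qed.

End Positive.

Lemma nrm_sqE {p q : nat} (X : 'M[R]_(p, q)) : nrm X ^+ 2 = \sum_i \sum_j X i j ^+ 2.
Proof. by rewrite nrm_sq ipE; do 2!apply: eq_bigr => ? _; rewrite expr2. Qed.

End Weights.

Section Comparisons.
Context {R : realType} {n m : nat} (r c : 'cV[R]_n).
Hypotheses (r_pos : 0 < vmin r) (c_pos : 0 < vmin c).
Implicit Type X : 'M[R]_(m, n).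

Lemma vmin_gt0 v : 0 < vmin v -> forall i : 'I_n, 0 < v i 0 :> R.
Proof. by move=> v0 i; exact: lt_le_trans (vmin_le _ _). Qed.

Let r_gt0 := vmin_gt0 r_pos.
Let c_gt0 := vmin_gt0 c_pos.

Lemma K2R_sq : K2R r ^+ 2 = (vmin r)^-1.
Proof. by rewrite /K2R div1r exprVn sqr_sqrtr// ltW. Qed.

Lemma KC2_sq : KC2 c ^+ 2 = (vmin c)^-1.
Proof. by rewrite /KC2 div1r exprVn sqr_sqrtr// ltW. Qed.

Lemma vmax_ge0 (v : 'cV[R]_n) : (forall i : 'I_n, 0 < v i 0 :> R) -> 0 <= vmax v.
Proof.
move=> v0; have [[i _]|n0] := pselect (exists i : 'I_n, True).
  by rewrite (le_trans (ltW (v0 i)))// le_vmax.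
(* For [n = 0] the range is empty and its [sup] is 0 by convention. *)
suff -> : vmax v = sup set0 by rewrite sup0.
by congr sup; apply/seteqP; split => // x [i _ _]; case: n0; exists i.
Qed.

Lemma K2C_sq : K2C c ^+ 2 = vmax c.
Proof. by rewrite /K2C sqr_sqrtr// vmax_ge0. Qed.

Lemma KRC_sq : KRC r c ^+ 2 = vmax r * vmax c.
Proof. by rewrite /KRC sqr_sqrtr// mulr_ge0 ?vmax_ge0. Qed.

Lemma nrm_le_dsqrt X : nrm X ^+ 2 <= K2R r ^+ 2 * nrm (X *m dsqrt r) ^+ 2.
Proof.
rewrite K2R_sq nrm_dsqrt// nrm_sqE mulr_sumr; apply: ler_sum => i _; rewrite mulr_sumr.
apply: ler_sum => j _; rewrite mulrA ler_peMl ?sqr_ge0//.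
by rewrite ler_pdivlMl// mulr1 vmin_le.
Qed.

Lemma nrm_le_rdiag X : nrm X ^+ 2 <= K2C c ^+ 2 * nrm (X *m rdiag c) ^+ 2.
Proof.
rewrite K2C_sq nrm_rdiag// nrm_sqE mulr_sumr; apply: ler_sum => i _; rewrite mulr_sumr.
apply: ler_sum => j _; rewrite mulrA ler_peMl ?sqr_ge0//.
by rewrite ler_pdivlMr// mul1r le_vmax.
Qed.

Lemma rdiag_le_nrm X : nrm (X *m rdiag c) ^+ 2 <= KC2 c ^+ 2 * nrm X ^+ 2.
Proof.
rewrite KC2_sq nrm_rdiag// nrm_sqE mulr_sumr; apply: ler_sum => i _; rewrite mulr_sumr.
apply: ler_sum => j _; rewrite ler_wpM2r ?sqr_ge0//.
by rewrite lef_pV2 ?posrE// vmin_le.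
Qed.

Lemma dsqrt_le_rdiag X :
  nrm (X *m dsqrt r) ^+ 2 <= KRC r c ^+ 2 * nrm (X *m rdiag c) ^+ 2.
Proof.
rewrite KRC_sq nrm_rdiag// nrm_dsqrt// mulr_sumr; apply: ler_sum => i _; rewrite mulr_sumr.
apply: ler_sum => j _; rewrite [leRHS]mulrA ler_wpM2r ?sqr_ge0//.
by rewrite ler_pdivlMr// ler_pM ?le_vmax// ?ltW.
Qed.

End Comparisons.

(** Transpose of [I - 1 r^T]: projections act from the right, so [X *m perpR r] is the consensus
    error [X - X r 1^T], and [Y *m perpC c] is the tracking error [Y - Y 1 c^T]. *)
Definition perpR {R : realType} {n : nat} (r : 'cV[R]_n) : 'M[R]_n :=
  1%:M - r *m ones^T.

Definition perpC {R : realType} {n : nat} (c : 'cV[R]_n) : 'M[R]_n :=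
  1%:M - ones *m c^T.

(** Stochasticity and the Perron vectors as matrix identities, so that projections are moved by
    associativity alone. *)
Record mixing {R : realType} {n : nat} (Rw Cw : 'M[R]_n) (r c : 'cV[R]_n) : Prop := Mixing {
  mix_R1 : Rw *m ones = (ones : 'cV[R]_n);
  mix_C1 : ones^T *m Cw = (ones : 'cV[R]_n)^T;
  mix_r : r^T *m Rw = r^T;
  mix_c : Cw *m c = c;
  mix_r1 : r^T *m ones = 1%:M;
  mix_c1 : c^T *m ones = 1%:M;
  mix_r_pos : 0 < vmin r;
  mix_c_pos : 0 < vmin c
}.

Section Mixing.
Context {R : realType} {n m : nat} {Rw Cw : 'M[R]_n} {r c : 'cV[R]_n}.
Hypothesis mix : mixing Rw Cw r c.
Implicit Types (X Y Z : 'M[R]_(m, n)).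

Let r_gt0 := vmin_gt0 (mix_r_pos mix).
Let c_gt0 := vmin_gt0 (mix_c_pos mix).

Lemma mix_1r : ones^T *m r = 1%:M.
Proof. by apply: trmx_inj; rewrite trmx_mul trmxK (mix_r1 mix) trmx1. Qed.

Lemma mix_1c : ones^T *m c = 1%:M.
Proof. by apply: trmx_inj; rewrite trmx_mul trmxK (mix_c1 mix) trmx1. Qed.

Lemma mix_RTr : Rw^T *m r = r.
Proof. by apply: trmx_inj; rewrite trmx_mul trmxK (mix_r mix). Qed.

Lemma mix_1RT : ones^T *m Rw^T = (ones : 'cV[R]_n)^T.
Proof. by apply: trmx_inj; rewrite trmx_mul !trmxK (mix_R1 mix). Qed.

Lemma mix_CT1 : Cw^T *m ones = (ones : 'cV[R]_n).
Proof. by apply: trmx_inj; rewrite trmx_mul trmxK (mix_C1 mix). Qed.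

Lemma mix_cCT : c^T *m Cw^T = c^T.
Proof. by rewrite -trmx_mul (mix_c mix). Qed.

Lemma ones_perpR : ones^T *m perpR r = 0.
Proof. by rewrite mulmxBr mulmx1 mulmxA mix_1r mul1mx subrr. Qed.

Lemma c_perpC : c^T *m perpC c = 0.
Proof. by rewrite mulmxBr mulmx1 mulmxA (mix_c1 mix) mul1mx subrr. Qed.

Lemma perpR_split X : X = X *m r *m ones^T + X *m perpR r.
Proof. by rewrite mulmxBr mulmx1 mulmxA addrC subrK. Qed.

Lemma perpC_split Y : Y = Y *m ones *m c^T + Y *m perpC c.
Proof. by rewrite mulmxBr mulmx1 mulmxA addrC subrK. Qed.

(** Moving the mixing step past the projection replaces R by [R - 1 r^T], the matrix whose weighted
    norm is [rhoR]. *)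
Lemma RT_perpR : Rw^T *m perpR r = perpR r *m (Rw - ones *m r^T)^T.
Proof.
have -> : (Rw - ones *m r^T)^T = Rw^T - r *m ones^T by rewrite [LHS]linearB/= trmx_mul trmxK.
rewrite mulmxBr mulmx1 mulmxA mix_RTr.
rewrite mulmxBl mul1mx [r *m ones^T *m _]mulmxBr -!mulmxA mix_1RT.
by rewrite [_ *m (r *m _)]mulmxA mix_1r mul1mx subrr subr0.
Qed.

Lemma CT_perpC : Cw^T *m perpC c = perpC c *m (Cw - c *m ones^T)^T.
Proof.
have -> : (Cw - c *m ones^T)^T = Cw^T - ones *m c^T by rewrite [LHS]linearB/= trmx_mul trmxK.
rewrite mulmxBr mulmx1 mulmxA mix_CT1.
rewrite mulmxBl mul1mx [ones *m c^T *m _]mulmxBr -!mulmxA mix_cCT.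
by rewrite [_ *m (ones *m _)]mulmxA (mix_c1 mix) mul1mx subrr subr0.
Qed.

Lemma contractionR Z :
  nrm (Z *m (Rw - ones *m r^T)^T *m dsqrt r) <= rhoR Rw r * nrm (Z *m dsqrt r).
Proof.
rewrite /rhoR; apply: le_trans (opnorm2_mulr _ _).
rewrite !trmx_mul dsqrtT invmx_dsqrt// rdiagT -!mulmxA [dsqrt r *m (rdiag r *m _)]mulmxA.
by rewrite dsqrt_rdiag// mul1mx.
Qed.

Lemma contractionC Z :
  nrm (Z *m (Cw - c *m ones^T)^T *m rdiag c) <= rhoC Cw c * nrm (Z *m rdiag c).
Proof.
rewrite /rhoC; apply: le_trans (opnorm2_mulr _ _).
rewrite !trmx_mul dsqrtT invmx_dsqrt// rdiagT -!mulmxA [rdiag c *m (dsqrt c *m _)]mulmxA.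
by rewrite rdiag_dsqrt// mul1mx.
Qed.

(** In the inner product weighted by r, [Z r 1^T] is the orthogonal projection of Z on consensus, of
    squared length [|Z r|^2] because r sums to 1. The analogue for c uses the weights [1/c] and the
    projection [Z 1 c^T]. *)
Lemma perpR_pythagoras Z :
  nrm (Z *m perpR r *m dsqrt r) ^+ 2 = nrm (Z *m dsqrt r) ^+ 2 - nrm (Z *m r) ^+ 2.
Proof.
have e1 (W : 'M[R]_(m, n)) : ip (W *m dsqrt r) (Z *m r *m ones^T *m dsqrt r) = ip (W *m r) (Z *m r).
  rewrite ipC -[Z *m r *m ones^T *m dsqrt r]mulmxA ip_mulr trmx_mul dsqrtT trmxK.
  by rewrite -mulmxA dsqrt_dsqrt_ones// ipC.
rewrite !nrm_sq mulmxBr mulmx1 mulmxA mulmxBl ipBl !ipBr e1.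
rewrite [ip (Z *m r *m _ *m _) (Z *m dsqrt r)]ipC !e1 -!mulmxA mix_1r mulmx1.
by rewrite subrr subr0.
Qed.

Lemma perpC_pythagoras Z :
  nrm (Z *m perpC c *m rdiag c) ^+ 2 = nrm (Z *m rdiag c) ^+ 2 - nrm (Z *m ones) ^+ 2.
Proof.
have e1 (W : 'M[R]_(m, n)) : ip (W *m rdiag c) (Z *m ones *m c^T *m rdiag c) = ip (W *m ones) (Z *m ones).
  rewrite ipC -[Z *m ones *m c^T *m rdiag c]mulmxA ip_mulr trmx_mul rdiagT trmxK.
  by rewrite -mulmxA rdiag_rdiag// ipC.
rewrite !nrm_sq mulmxBr mulmx1 mulmxA mulmxBl ipBl !ipBr e1.
rewrite [ip (Z *m ones *m _ *m _) (Z *m rdiag c)]ipC !e1 -!mulmxA (mix_c1 mix) mulmx1.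
by rewrite subrr subr0.
Qed.

Lemma sum_r : \sum_i r i 0 = 1.
Proof.
have := congr1 (fun A : 'M[R]_1 => A 0 0) mix_1r; rewrite !mxE eqxx mulr1n => <-.
by apply: eq_bigr => i _; rewrite !mxE mul1r.
Qed.

Lemma sum_c : \sum_i c i 0 = 1.
Proof.
have := congr1 (fun A : 'M[R]_1 => A 0 0) mix_1c; rewrite !mxE eqxx mulr1n => <-.
by apply: eq_bigr => i _; rewrite !mxE mul1r.
Qed.

Lemma r_le1 i : r i 0 <= 1.
Proof. by rewrite -sum_r (bigD1 i)//= lerDl sumr_ge0// => j _; rewrite ltW. Qed.

Lemma c_le1 i : c i 0 <= 1.
Proof. by rewrite -sum_c (bigD1 i)//= lerDl sumr_ge0// => j _; rewrite ltW. Qed.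

Lemma nrm_r_le1 : nrm r <= 1.
Proof.
apply: le_nrm => //; rewrite ipE expr1n -sum_r; apply: ler_sum => i _.
by rewrite big_ord1 ler_piMr ?r_le1// ltW.
Qed.

Lemma nrm_c_le1 : nrm c <= 1.
Proof.
apply: le_nrm => //; rewrite ipE expr1n -sum_c; apply: ler_sum => i _.
by rewrite big_ord1 ler_piMr ?c_le1// ltW.
Qed.

Lemma zetaE : zeta r c = \sum_i r i 0 * c i 0.
Proof. by rewrite /zeta mxE; apply: eq_bigr => i _; rewrite !mxE. Qed.

Lemma zeta_ge0 : 0 <= zeta r c.
Proof. by rewrite zetaE sumr_ge0// => i _; rewrite mulr_ge0 ?ltW. Qed.

Lemma zeta_le1 : zeta r c <= 1.
Proof. by rewrite zetaE -sum_r ler_sum// => i _; rewrite ler_piMr ?c_le1 ?ltW. Qed.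

Lemma cTr : c^T *m r = (zeta r c)%:M.
Proof.
apply/matrixP => i j; rewrite !ord1 [RHS]mxE mulr1n zetaE mxE.
by apply: eq_bigr => k _; rewrite !mxE mulrC.
Qed.

(* The variance under [r] of entries of [c] in [0, 1] is at most [1/4]. *)
Lemma c_perpR_bound (y : 'cV[R]_m) :
  nrm (y *m c^T *m perpR r *m dsqrt r) ^+ 2 <= 1 / 4 * nrm y ^+ 2.
Proof.
rewrite perpR_pythagoras.
have h1 : nrm (y *m c^T *m dsqrt r) ^+ 2 <= zeta r c * nrm y ^+ 2.
  rewrite nrm_dsqrt// nrm_sqE mulr_sumr; apply: ler_sum => i _.
  rewrite big_ord1 zetaE mulr_suml; apply: ler_sum => j _.
  rewrite !mxE big_ord1 !mxE.
  have -> : r j 0 * (y i 0 * c j 0) ^+ 2 = c j 0 * (r j 0 * c j 0 * y i 0 ^+ 2) by ring.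
  by rewrite ler_piMl ?c_le1// mulr_ge0 ?sqr_ge0// mulr_ge0// ltW.
have h2 : nrm (y *m c^T *m r) ^+ 2 = zeta r c ^+ 2 * nrm y ^+ 2.
  by rewrite -mulmxA cTr mul_mx_scalar nrmZ exprMn real_normK ?num_real.
have := sqr_ge0 (zeta r c - 2^-1); have := sqr_ge0 (nrm y); nra.
Qed.

End Mixing.

(** * Descent of the Lyapunov function *)

Ltac nonneg := repeat first
  [ assumption | exact: ltW | exact: ler01 | exact: ler0n | exact: sqr_ge0
  | rewrite invr_ge0 | apply: addr_ge0 | apply: mulr_ge0 ].

Section StepSizeArithmetic.
Context {R : realType}.

(** A quotient by zero is zero, so for [d = 0] the hypotheses contradict each other. The
    denominators of the step-size conditions thus need only be nonnegative. *)
Lemma lt_div_mul (a x d : R) : 0 < a -> 0 <= d -> a < x / d -> a * d < x.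
Proof.
rewrite le_eqVlt => a0 /predU1P[<-|d0]; last by rewrite ltr_pdivlMr.
by rewrite invr0 mulr0 => /(lt_trans a0); rewrite ltxx.
Qed.

Lemma le_div_mul (a x d : R) : 0 < a -> 0 <= d -> a <= x / d -> a * d <= x.
Proof.
rewrite le_eqVlt => a0 /predU1P[<-|d0]; last by rewrite ler_pdivlMr.
by rewrite invr0 mulr0 => /(lt_le_trans a0); rewrite ltxx.
Qed.

(* Here [p = rhoR^2], [q = rhoC^2], [nn = n], [L2 = Lc^2], and [k2r], [k2c], [kc2], [krc] are the
   squares of [K2R], [K2C], [KC2], [KRC]; [W] is the weight with which the squared length of the
   step of [X] enters the decrease of the Lyapunov function. *)
Section Coefficients.
Variables (p q ex ey ep ka al ze L2 k2r k2c kc2 krc nn LF : R).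
Hypotheses (p0 : 0 <= p) (q0 : 0 <= q) (ex0 : 0 < ex) (ey0 : 0 < ey) (ep0 : 0 < ep)
  (ka0 : 0 < ka) (al0 : 0 < al) (ze0 : 0 <= ze) (ze1 : ze <= 1) (L20 : 0 <= L2)
  (k2r2 : 2 <= k2r) (k2c0 : 0 <= k2c) (kc20 : 0 <= kc2) (krc0 : 0 <= krc)
  (nn2 : 2 <= nn) (LF0 : 0 <= LF).
Hypotheses (hex : ex < (1 - p) / (2 * p))
  (hka : ka <= p * ex / (3 * kc2 * k2r * L2 * (1 + 1 / ey)))
  (hal1 : al < 2 * (1 - p * (1 + 2 * ex)) / (nn * L2 * k2r * (1 + ze / ep)))
  (hal2 : al < (1 - q * (1 + ey)) /
    (1 / (2 * ka) * k2c * (1 + 1 / ep + 2 * LF) + 2 * krc * (1 + 1 / ex) / ka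
     + 3 * kc2 * k2c * L2 * (1 + 1 / ey)))
  (hal3 : al < (ze - ep / 2 * (ze + 1)) /
    (LF * ze ^+ 2 + 2 * nn * (1 + 1 / ex) + 3 * kc2 * L2 * ka)).

Variable W : R.
Hypothesis WE : W = ka * (1 + 1 / ey) * kc2 * L2.

Let iex : 0 < 1 / ex. Proof. by rewrite div1r invr_gt0. Qed.
Let iey : 0 < 1 / ey. Proof. by rewrite div1r invr_gt0. Qed.
Let iep : 0 < 1 / ep. Proof. by rewrite div1r invr_gt0. Qed.
Let k2r0 : 0 <= k2r. Proof. exact: le_trans k2r2. Qed.
Let nn0 : 0 <= nn. Proof. exact: le_trans nn2. Qed.

Let W0 : 0 <= W.
Proof. by rewrite WE; nonneg. Qed.

Let Wk2r : 3 * W * k2r <= p * ex.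
Proof.
have -> : 3 * W * k2r = ka * (3 * kc2 * k2r * L2 * (1 + 1 / ey)) by rewrite WE; ring.
by apply: le_div_mul => //; nonneg.
Qed.

Let pex : p * ex < 1 / 2.
Proof.
have : ex * (2 * p) < 1 - p by apply: lt_div_mul => //; rewrite mulr_ge0.
by move: p0; lra.
Qed.

(** [2 W <= W k2r <= p ex / 3 < 1/6], using [k2r >= 2]. *)
Let W12 : 12 * W <= 1.
Proof.
have h : W * 2 <= W * k2r by rewrite ler_wpM2l.
by move: Wk2r pex; lra.
Qed.

Let hal3' : al * (LF * ze ^+ 2 + 2 * nn * (1 + 1 / ex) + 3 * kc2 * L2 * ka)
  < ze - ep / 2 * (ze + 1).
Proof.
by apply: lt_div_mul => //; nonneg.
Qed.

Let g4 : al * (4 * (1 + 1 / ex)) <= al * (2 * nn * (1 + 1 / ex)).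
Proof. apply: ler_wpM2l; first exact: ltW.
by apply: ler_wpM2r; [rewrite addr_ge0 ?ltW|move: nn2; lra]. Qed.

(** In the third step-size condition the numerator is at most 1 and the denominator contains
    [2 nn >= 4]. *)
Lemma step_lt4 : al < 1 / 4.
Proof.
have h1 : 0 <= al * (LF * ze ^+ 2) by nonneg.
have h2 : 0 <= al * (3 * kc2 * L2 * ka) by nonneg.
have h3 : 0 < al * (1 / ex) by rewrite mulr_gt0.
have h4 : 0 <= ep / 2 * (ze + 1) by nonneg.
move: hal3' g4 ze1; rewrite !mulrDr; lra.
Qed.

(** An exact budget: the first step-size condition leaves [3/2 p ex], and the move of X costs
    [9/2 W k2r <= 3/2 p ex]. Strictness comes from the step-size condition. *)
Lemma coefficient_R :
  (1 + ex / 2) * p - 1 + al / 2 * (1 + ze / ep) * (nn * L2 * k2r)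
  + W * (9 / 8 * 4 * k2r) < 0.
Proof.
have h : al * (nn * L2 * k2r * (1 + ze / ep)) < 2 * (1 - p * (1 + 2 * ex)).
  by apply: lt_div_mul => //; nonneg.
have -> : al / 2 * (1 + ze / ep) * (nn * L2 * k2r)
  = al * (nn * L2 * k2r * (1 + ze / ep)) / 2 by ring.
by move: h Wk2r; lra.
Qed.

(** By [al < 1/4] the terms quadratic in [al] are bounded by linear ones; what remains is the second
    step-size condition multiplied by [ka]. *)
Lemma coefficient_C :
  ka * ((1 + ey) * q - 1) + al / 2 * (1 + 1 / ep + 2 * al * LF) * k2c
  + (1 + 2 * (1 / ex)) * al ^+ 2 * (2 * krc) + W * (12 * al ^+ 2 * k2c) < 0.
Proof.
have a4 := step_lt4.
have h : al * (1 / (2 * ka) * k2c * (1 + 1 / ep + 2 * LF) + 2 * krc * (1 + 1 / ex) / ka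
     + 3 * kc2 * k2c * L2 * (1 + 1 / ey)) < 1 - q * (1 + ey).
  by apply: lt_div_mul => //; nonneg.
have {}h : al * (k2c / 2 * (1 + 1 / ep + 2 * LF) + 2 * krc * (1 + 1 / ex) + 3 * W * k2c)
  < ka * (1 - q * (1 + ey)).
  rewrite -(ltr_pM2l ka0) in h; apply: le_lt_trans h; rewrite le_eqVlt; apply/orP; left.
  by apply/eqP; rewrite WE; field; rewrite !gt_eqF.
have h1 : al * k2c * (al * LF) <= al * k2c * LF.
  by apply: ler_wpM2l; [nonneg|apply: ler_piMl => //; move: a4; lra].
have h2 : (1 + 2 * (1 / ex)) * al ^+ 2 * (2 * krc) <= al * (2 * krc * (1 + 1 / ex)).
  have -> : (1 + 2 * (1 / ex)) * al ^+ 2 * (2 * krc) = al * (2 * krc) * ((1 + 2 * (1 / ex)) * al) by ring.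
  rewrite [leRHS]mulrA; apply: ler_wpM2l; first by nonneg.
  have : (1 + 2 * (1 / ex)) * al <= (1 + 2 * (1 / ex)) * (1 / 4).
    by apply: ler_wpM2l; [nonneg|exact: ltW].
  by move: iex; lra.
have h3 : W * (12 * al ^+ 2 * k2c) <= al * (3 * W * k2c).
  have -> : W * (12 * al ^+ 2 * k2c) = al * W * k2c * (12 * al) by ring.
  have -> : al * (3 * W * k2c) = al * W * k2c * 3 by ring.
  by apply: ler_wpM2l; [nonneg|move: a4; lra].
have -> : ka * ((1 + ey) * q - 1) = - (ka * (1 - q * (1 + ey))) by ring.
move: h; rewrite !mulrDr; move: h1 h2 h3; lra.
Qed.

(** After factoring out [- al] this is the third step-size condition: the surplus
    [1/2 + 1/ex + 36 W] is at most [4 (1 + 1/ex) <= 2 nn (1 + 1/ex)], since [12 W <= 1]. *)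
Lemma coefficient_mean :
  - al * (ze - ep / 2 * (1 + ze) - al * LF * ze ^+ 2)
  + (1 + 2 * (1 / ex)) * al ^+ 2 * (1 / 2) + W * (36 * al ^+ 2) < 0.
Proof.
have -> : - al * (ze - ep / 2 * (1 + ze) - al * LF * ze ^+ 2)
    + (1 + 2 * (1 / ex)) * al ^+ 2 * (1 / 2) + W * (36 * al ^+ 2)
  = - (al * (ze - ep / 2 * (ze + 1) - al * (LF * ze ^+ 2 + (1 / 2 + 1 / ex) + 36 * W))).
  by field; rewrite gt_eqF.
rewrite oppr_lt0 mulr_gt0// subr_gt0; apply: le_lt_trans hal3'.
apply: ler_wpM2l; first exact: ltW.
rewrite -!addrA lerD2l.
have h1 : 0 <= 3 * kc2 * L2 * ka by nonneg.
have : 4 * (1 + 1 / ex) <= 2 * nn * (1 + 1 / ex).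
  by apply: ler_wpM2r; [rewrite addr_ge0 ?ltW|move: nn2; lra].
by move: W12 iex h1; lra.
Qed.

End Coefficients.
End StepSizeArithmetic.

(** What the descent uses of the objective. Both the algorithm ([gradF_model]) and its linearization
    at a saddle ([hessF_model]) satisfy it with the same constants, so one estimate serves both. *)
Record descent_model {R : realType} {n m : nat} (Lc LF : R)
    (G : 'M[R]_(m, n) -> 'M[R]_(m, n)) (Phi : 'cV[R]_m -> R) : Prop := DescentModel {
  model_lip : forall X X', nrm (G X - G X') <= Lc * nrm (X - X');
  model_desc : forall t d, Phi (t + d) <=
    Phi t + ip (G (t *m ones^T) *m ones) d + LF / 2 * nrm d ^+ 2
}.

Definition stepX {R : realType} {n m : nat} (Rw : 'M[R]_n) (alpha : R)
    (X Y : 'M[R]_(m, n)) := X *m Rw^T - alpha *: Y.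

(** The recursion of the tracker [Y = H + G X], in which H no longer appears ([stY_genstep]). *)
Definition stepY {R : realType} {n m : nat} (Rw Cw : 'M[R]_n) (alpha : R)
    (G : 'M[R]_(m, n) -> 'M[R]_(m, n)) (X Y : 'M[R]_(m, n)) :=
  Y *m Cw^T + (G (stepX Rw alpha X Y) - G X).

Definition resR {R : realType} {n m : nat} (r : 'cV[R]_n) (X : 'M[R]_(m, n)) : R :=
  nrm (X *m perpR r *m dsqrt r) ^+ 2.

Definition resC {R : realType} {n m : nat} (c : 'cV[R]_n) (Y : 'M[R]_(m, n)) : R :=
  nrm (Y *m perpC c *m rdiag c) ^+ 2.

Definition gap {R : realType} {n m : nat} (r c : 'cV[R]_n) (X Y : 'M[R]_(m, n)) : R :=
  resR r X + resC c Y + nrm (Y *m ones : 'cV_m) ^+ 2.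

Definition lyap {R : realType} {n m : nat} (r c : 'cV[R]_n) (kappa : R)
    (Phi : 'cV[R]_m -> R) (X Y : 'M[R]_(m, n)) : R :=
  Phi (X *m r) + resR r X + kappa * resC c Y.

Section Descent.
Context {R : realType} {n m : nat} {Rw Cw : 'M[R]_n} {r c : 'cV[R]_n}.
Context {Lc LF eps_x eps_y eps kappa alpha : R}.
Hypothesis mix : mixing Rw Cw r c.
Hypothesis step : step_size Rw Cw r c Lc LF eps_x eps_y eps kappa alpha.
Hypotheses (alpha_gt0 : 0 < alpha) (Lc_ge0 : 0 <= Lc) (LF_ge0 : 0 <= LF).
Implicit Types (X Y : 'M[R]_(m, n)).

Lemma rhoR_neq0 : rhoR Rw r != 0.
Proof.
apply/eqP => r0; have := ss_eps_x_lt step; have := ss_eps_x_gt0 step.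
by rewrite r0 expr0n mulr0 invr0 mulr0 => /lt_trans h /h; rewrite ltxx.
Qed.

Lemma rhoC_neq0 : rhoC Cw c != 0.
Proof.
apply/eqP => r0; have := ss_eps_y_lt step; have := ss_eps_y_gt0 step.
by rewrite r0 expr0n invr0 mulr0 => /lt_trans h /h; rewrite ltxx.
Qed.

Lemma rhoR_lt1 : rhoR Rw r < 1.
Proof.
have p0 : 0 < rhoR Rw r ^+ 2 by rewrite lt_def sqr_ge0 sqrf_eq0 rhoR_neq0.
have := lt_div_mul (ss_eps_x_gt0 step) _ (ss_eps_x_lt step).
rewrite mulr_ge0 ?ltW// => /(_ isT) h.
have : 0 < eps_x * (2 * rhoR Rw r ^+ 2).
  by apply: mulr_gt0; [exact: ss_eps_x_gt0 step|exact: mulr_gt0].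
move=> /lt_trans /(_ h); rewrite subr_gt0 -[X in _ < X -> _](expr1n R 2) ltr_pXn2r ?nnegrE//.
by rewrite /rhoR opnorm2_ge0.
Qed.

Lemma rhoC_lt1 : rhoC Cw c < 1.
Proof.
have p0 : 0 < rhoC Cw c ^+ 2 by rewrite lt_def sqr_ge0 sqrf_eq0 rhoC_neq0.
have := lt_div_mul (ss_eps_y_gt0 step) (ltW p0) (ss_eps_y_lt step) => h.
have : 0 < eps_y * rhoC Cw c ^+ 2 by apply: mulr_gt0 => //; exact: ss_eps_y_gt0 step.
move=> /lt_trans /(_ h); rewrite subr_gt0 -[X in _ < X -> _](expr1n R 2) ltr_pXn2r ?nnegrE//.
by rewrite /rhoC opnorm2_ge0.
Qed.

(** For [n = 1] stochasticity gives [R = 1 r^T], hence [rhoR = 0], which is excluded. The bounds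
    [2 n >= 4] and [K2R^2 >= 2] used for the coefficients rest on this. *)
Lemma agents_ge2 : (2 <= n)%N.
Proof.
have := rhoR_neq0; have := mix_r1 mix; have := mix_R1 mix; clear mix step.
case: n Rw r => [|[|k]] // R' r' h1 h2.
  move: h2 => /(congr1 (fun A : 'M[R]_1 => A 0 0)); rewrite !mxE big_ord0 eqxx.
  by move/esym/eqP; rewrite oner_eq0.
move=> /eqP[]; rewrite /rhoR (_ : R' - ones *m r'^T = 0); last first.
  apply/matrixP => i j; rewrite !ord1; move: h1 h2.
  move=> /(congr1 (fun A : 'cV[R]_1 => A 0 0)) + /(congr1 (fun A : 'M[R]_1 => A 0 0)).
  by rewrite !mxE !big_ord1 !mxE mulr1 mul1r eqxx mulr1 => -> ->; rewrite subrr.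
rewrite mulmx0 mul0mx; apply/eqP; rewrite eq_le opnorm2_ge0 andbT.
apply: ge_sup; first by exists (norm2 ((0 : 'M[R]_1) *m (0 : 'cV[R]_1))); exists 0; rewrite //= norm2E nrm0.
by move=> _ [v _ <-]; rewrite mul0mx norm2E nrm0.
Qed.

(** The entries of r sum to 1, so the least one is at most [1/n <= 1/2]. *)
Lemma vmin_r_half : 2 <= K2R r ^+ 2.
Proof.
rewrite K2R_sq ?(mix_r_pos mix)// -[leLHS]invrK lef_pV2 ?posrE ?invr_gt0 ?(mix_r_pos mix)//.
rewrite -[leRHS]mul1r ler_pdivlMr// mulrC mulr_natl -(sum_r mix).
apply: (@le_trans _ _ (\sum_(i < n) vmin r)).
  by rewrite sumr_const card_ord ler_wpMn2l ?agents_ge2// ltW// (mix_r_pos mix).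
by apply: ler_sum => i _; exact: vmin_le.
Qed.

Let r_gt0 := vmin_gt0 (mix_r_pos mix).
Let c_gt0 := vmin_gt0 (mix_c_pos mix).
Let a0 := alpha_gt0.

Lemma stepX_mean X Y : stepX Rw alpha X Y *m r = X *m r - alpha *: (Y *m r).
Proof. by rewrite mulmxBl -mulmxA (mix_RTr mix) -scalemxAl. Qed.

Lemma Y_r Y : Y *m r = zeta r c *: (Y *m ones) + Y *m perpC c *m r.
Proof.
rewrite {1}(@perpC_split _ _ _ c Y) mulmxDl -[_ *m c^T *m r]mulmxA cTr.
by rewrite mul_mx_scalar.
Qed.

Lemma resR_step X Y : resR r (stepX Rw alpha X Y) <=
  (1 + eps_x / 2) * rhoR Rw r ^+ 2 * resR r X
  + (1 + 2 * (1 / eps_x)) * alpha ^+ 2 *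
      (2 * KRC r c ^+ 2 * resC c Y + 1 / 2 * nrm (Y *m ones : 'cV_m) ^+ 2).
Proof.
have ex0 := ss_eps_x_gt0 step.
have -> : resR r (stepX Rw alpha X Y) = nrm
   (X *m perpR r *m (Rw - ones *m r^T)^T *m dsqrt r + - alpha *: (Y *m perpR r *m dsqrt r)) ^+ 2.
  rewrite /resR /stepX mulmxBl -[X *m _ *m perpR r]mulmxA (RT_perpR mix) mulmxA mulmxBl.
  by rewrite -!scalemxAl scaleNr.
apply: le_trans (nrm_young _ _ (_ : 0 < eps_x / 2)) _; first by rewrite divr_gt0.
rewrite nrmZ exprMn normrN gtr0_norm//.
rewrite -[X in _ <= X + _]mulrA -[X in _ <= _ + X]mulrA; apply: lerD.
  apply: ler_wpM2l; first by nonneg.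
  rewrite /resR -exprMn ler_pXn2r ?nnegrE ?nrm_ge0 ?mulr_ge0 ?nrm_ge0 ?opnorm2_ge0//.
  exact: (contractionR mix).
have -> : 1 + (eps_x / 2)^-1 = 1 + 2 * (1 / eps_x) by field; rewrite gt_eqF.
apply: ler_wpM2l; first by nonneg.
apply: ler_wpM2l; first exact: sqr_ge0.
(* Even a perfectly tracked [Y = y c^T] disturbs consensus unless c is constant; that part is
   bounded by [c_perpR_bound], the rest by the tracking error. *)
rewrite {1}(@perpC_split _ _ _ c Y) !mulmxDl.
apply: le_trans (nrm_young _ _ (_ : 0 < 1)) _ => //.
have h1 := c_perpR_bound mix (Y *m ones).
have h2 : nrm (Y *m perpC c *m perpR r *m dsqrt r) ^+ 2 <= KRC r c ^+ 2 * resC c Y.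
  apply: le_trans (dsqrt_le_rdiag (mix_r_pos mix) (mix_c_pos mix) _).
  by rewrite (perpR_pythagoras mix) gerBl sqr_ge0.
move: h1 h2; rewrite invr1 /resC; lra.
Qed.

Lemma nrm_perp_le X : nrm (X *m perpR r) ^+ 2 <= K2R r ^+ 2 * resR r X.
Proof. exact: nrm_le_dsqrt (mix_r_pos mix) _. Qed.

Lemma nrm_perpC_le Y : nrm (Y *m perpC c) ^+ 2 <= K2C c ^+ 2 * resC c Y.
Proof. exact: nrm_le_rdiag (mix_c_pos mix) _. Qed.

Lemma nrm_ycT (y : 'cV[R]_m) : nrm (y *m c^T) <= nrm y.
Proof.
apply: le_trans (nrmM _ _) _; rewrite nrm_tr ler_piMr ?nrm_ge0//.
exact: nrm_c_le1 mix.
Qed.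

Lemma stepX_move X Y : stepX Rw alpha X Y - X
  = X *m perpR r *m (Rw - ones *m r^T)^T - X *m perpR r - alpha *: Y.
Proof.
rewrite /stepX addrAC; congr (_ - _).
rewrite -[X *m _ *m _]mulmxA -(RT_perpR mix) /perpR mulmxBr mulmx1 mulmxA (mix_RTr mix).
by rewrite !mulmxBr mulmx1 opprB addrA subrK.
Qed.

(* The three terms get Young weights [8/9], [1/12] and [1/36]. *)
Lemma nrm_stepX_move X Y : nrm (stepX Rw alpha X Y - X) ^+ 2 <=
  9 / 8 * 4 * K2R r ^+ 2 * resR r X + 12 * alpha ^+ 2 * K2C c ^+ 2 * resC c Y
  + 36 * alpha ^+ 2 * nrm (Y *m ones : 'cV_m) ^+ 2.
Proof.
rewrite stepX_move; set U := _ - X *m perpR r.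
have hU : nrm U ^+ 2 <= 4 * K2R r ^+ 2 * resR r X.
  apply: le_trans (nrm_le_dsqrt (mix_r_pos mix) _) _.
  rewrite [4 * _]mulrC -[leRHS]mulrA; apply: ler_wpM2l; first exact: sqr_ge0.
  have -> : 4 * resR r X = (2 * nrm (X *m perpR r *m dsqrt r)) ^+ 2.
    by rewrite exprMn -natrX.
  rewrite ler_pXn2r ?nnegrE ?mulr_ge0 ?nrm_ge0// mulmxBl.
  apply: le_trans (nrmD _ _) _; rewrite nrmN.
  have := contractionR mix (X *m perpR r); have := rhoR_lt1.
  have := nrm_ge0 (X *m perpR r *m dsqrt r); nra.
rewrite {1}(@perpC_split _ _ _ c Y) scalerDr.
apply: le_trans (nrm_young _ _ (_ : 0 < 1 / 8)) _ => //.
rewrite nrmN; set V := nrm (alpha *: _ + alpha *: _) ^+ 2.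
suff hV : V <= 4 / 3 * alpha ^+ 2 * nrm (Y *m perpC c) ^+ 2
    + 4 * alpha ^+ 2 * nrm (Y *m ones : 'cV_m) ^+ 2.
  have h3 : alpha ^+ 2 * nrm (Y *m perpC c) ^+ 2 <= alpha ^+ 2 * (K2C c ^+ 2 * resC c Y).
    by rewrite ler_wpM2l ?sqr_ge0 ?nrm_perpC_le.
  move: hU hV h3; lra.
rewrite /V addrC; apply: le_trans (nrm_young _ _ (_ : 0 < 1 / 3)) _ => //.
rewrite !nrmZ !exprMn gtr0_norm//.
have h4 : alpha ^+ 2 * nrm (Y *m ones *m c^T) ^+ 2 <= alpha ^+ 2 * nrm (Y *m ones : 'cV_m) ^+ 2.
  by rewrite ler_wpM2l ?sqr_ge0// ler_pXn2r ?nnegrE ?nrm_ge0 ?nrm_ycT.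
move: h4; lra.
Qed.

Lemma resC_step (G : 'M[R]_(m, n) -> 'M[R]_(m, n)) X Y :
  (forall X X', nrm (G X - G X') <= Lc * nrm (X - X')) ->
  resC c (stepY Rw Cw alpha G X Y) <= (1 + eps_y) * rhoC Cw c ^+ 2 * resC c Y
   + (1 + 1 / eps_y) * KC2 c ^+ 2 * Lc ^+ 2 * nrm (stepX Rw alpha X Y - X) ^+ 2.
Proof.
move=> GL; have ey0 := ss_eps_y_gt0 step.
have -> : resC c (stepY Rw Cw alpha G X Y) = nrm
   (Y *m perpC c *m (Cw - c *m ones^T)^T *m rdiag c
    + (G (stepX Rw alpha X Y) - G X) *m perpC c *m rdiag c) ^+ 2.
  by rewrite /resC /stepY mulmxDl -[Y *m _ *m perpC c]mulmxA (CT_perpC mix) mulmxA mulmxDl.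
apply: le_trans (nrm_young _ _ ey0) _; rewrite div1r.
rewrite -[X in _ <= X + _]mulrA -[X in _ <= _ + X]mulrA -[X in _ <= _ + X]mulrA; apply: lerD.
  apply: ler_wpM2l; first by nonneg.
  rewrite /resC -exprMn ler_pXn2r ?nnegrE ?nrm_ge0 ?mulr_ge0 ?nrm_ge0 ?opnorm2_ge0//.
  exact: (contractionC mix).
apply: ler_wpM2l; first by nonneg.
rewrite (perpC_pythagoras mix); set Z := G _ - _.
apply: (@le_trans _ _ (nrm (Z *m rdiag c) ^+ 2)); first by rewrite gerBl sqr_ge0.
apply: le_trans (rdiag_le_nrm (mix_c_pos mix) _) _.
apply: ler_wpM2l; first exact: sqr_ge0.
rewrite -exprMn ler_pXn2r ?nnegrE ?nrm_ge0 ?mulr_ge0 ?nrm_ge0//.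
exact: GL.
Qed.

Lemma ip_young (s : R) {p q : nat} (u v : 'M[R]_(p, q)) : 0 < s ->
  - ip u v <= s / 2 * nrm u ^+ 2 + 1 / (2 * s) * nrm v ^+ 2.
Proof.
move=> s0; have := ip_ge0 (s *: u + v); rewrite ipDl !ipDr !ipZl !ipZr (ipC v u) => h.
rewrite !nrm_sq -(ler_pM2l s0).
have -> : s * (s / 2 * ip u u + 1 / (2 * s) * ip v v) = s * (s / 2 * ip u u) + ip v v / 2.
  by field; rewrite gt_eqF.
move: h; lra.
Qed.

Lemma nrm_mul_ones (Z : 'M[R]_(m, n)) : nrm (Z *m (ones : 'cV_n)) ^+ 2 <= n%:R * nrm Z ^+ 2.
Proof.
apply: (@le_trans _ _ ((nrm Z * nrm (ones : 'cV[R]_n)) ^+ 2)).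
  by rewrite ler_pXn2r ?nnegrE ?mulr_ge0 ?nrm_ge0 ?nrmM.
rewrite exprMn mulrC [nrm (ones : 'cV_n) ^+ 2]nrm_sqE ler_wpM2r ?sqr_ge0//.
rewrite (eq_bigr (fun=> 1)) => [|i _]; last by rewrite big_ord1 mxE expr1n.
by rewrite sumr_const card_ord.
Qed.

(** [Y 1] sums the local gradients at X itself, so it differs from their sum at the mean only
    through the consensus error. *)
Lemma mean_gradient_error (G : 'M[R]_(m, n) -> 'M[R]_(m, n)) X Y :
  (forall X X', nrm (G X - G X') <= Lc * nrm (X - X')) -> Y *m ones = G X *m (ones : 'cV_n) ->
  nrm (G (X *m r *m ones^T) *m (ones : 'cV_n) - Y *m ones) ^+ 2
    <= n%:R * Lc ^+ 2 * K2R r ^+ 2 * resR r X.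
Proof.
move=> GL ->; rewrite -mulmxBl; apply: le_trans (nrm_mul_ones _) _.
rewrite -[leRHS]mulrA -[leRHS]mulrA; apply: ler_wpM2l => //.
apply: (@le_trans _ _ (Lc ^+ 2 * nrm (X *m perpR r) ^+ 2)); last first.
  by apply: ler_wpM2l; [exact: sqr_ge0|exact: nrm_perp_le].
rewrite -exprMn ler_pXn2r ?nnegrE ?mulr_ge0 ?nrm_ge0//.
apply: le_trans (GL _ _) _; apply: ler_wpM2l => //.
by rewrite nrmB mulmxBr mulmx1 mulmxA.
Qed.

(** The mean moves by [- alpha (zeta y + w)], with [y = Y 1] and w due to the tracking error, while
    the gradient at the mean is [y + e]. Products with y get the Young weight [eps], the product of
    e and w the weight 1; hence [1 + zeta / eps] and [1 + 1 / eps]. *)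
Lemma mean_descent (G : 'M[R]_(m, n) -> 'M[R]_(m, n)) (Phi : 'cV[R]_m -> R) X Y :
  descent_model Lc LF G Phi -> Y *m ones = G X *m (ones : 'cV_n) ->
  Phi (stepX Rw alpha X Y *m r) <= Phi (X *m r)
   - alpha * (zeta r c - eps / 2 * (1 + zeta r c) - alpha * LF * zeta r c ^+ 2)
      * nrm (Y *m ones : 'cV_m) ^+ 2
   + alpha / 2 * (1 + zeta r c / eps) * (n%:R * Lc ^+ 2 * K2R r ^+ 2) * resR r X
   + alpha / 2 * (1 + 1 / eps + 2 * alpha * LF) * K2C c ^+ 2 * resC c Y.
Proof.
move=> [GL PhiD] Y1; have e0 := ss_eps_gt0 step.
have E := mean_gradient_error GL Y1; rewrite stepX_mean.
apply: le_trans (PhiD _ _) _; rewrite -addrA -!addrA lerD2l.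
rewrite nrmN nrmZ exprMn gtr0_norm// ipNr ipZr.
move: E; set g := G _ *m _; set y := Y *m ones; rewrite Y_r -/y.
set w := Y *m perpC c *m r; set e := g - y => E.
have hw : nrm w ^+ 2 <= K2C c ^+ 2 * resC c Y.
  apply: le_trans (nrm_perpC_le Y); rewrite ler_pXn2r ?nnegrE ?nrm_ge0//.
  apply: le_trans (nrmM _ _) _; rewrite ler_piMr ?nrm_ge0//; exact: nrm_r_le1 mix.
have ge : g = y + e by rewrite /e subrKC.
rewrite {}ge; clearbody w e y.
have z0 := zeta_ge0 mix; set z := zeta r c in z0 *.
have n1 := nrm_young (z *: y) w ltr01; rewrite nrmZ exprMn real_normK ?num_real// invr1 in n1.
have y1 := ip_young y w e0; have y2 := ip_young y e e0; have y3 := ip_young e w ltr01.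
have i1 : - (alpha * ip (y + e) (z *: y + w)) = alpha * (- (z * nrm y ^+ 2) + - ip y w + z * - ip y e + - ip e w).
  rewrite ipDl !ipDr !ipZr (ipC e y) nrm_sq. ring.
rewrite i1.
have i2 : alpha * (- (z * nrm y ^+ 2) + - ip y w + z * - ip y e + - ip e w) <=
  alpha * (- (z * nrm y ^+ 2) + (eps / 2 * nrm y ^+ 2 + 1 / (2 * eps) * nrm w ^+ 2)
    + z * (eps / 2 * nrm y ^+ 2 + 1 / (2 * eps) * nrm e ^+ 2) + (1 / 2 * nrm e ^+ 2 + 1 / (2 * 1) * nrm w ^+ 2)).
  rewrite ler_pM2l// !lerD// ler_wpM2l//.
have i3 := ler_wpM2l (_ : 0 <= LF / 2 * alpha ^+ 2) n1.
rewrite [LF / 2 * (_ * _)]mulrA; apply: le_trans (lerD i2 (i3 _)) _; first by nonneg.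
have j1 : alpha / 2 * (1 + z / eps) * nrm e ^+ 2 <= alpha / 2 * (1 + z / eps) * (n%:R * Lc ^+ 2 * K2R r ^+ 2) * resR r X.
  by rewrite -[leRHS]mulrA; apply: ler_wpM2l => //; nonneg.
have j2 : alpha / 2 * (1 + (1 / eps + 2 * alpha * LF)) * nrm w ^+ 2 <= alpha / 2 * (1 + (1 / eps + 2 * alpha * LF)) * K2C c ^+ 2 * resC c Y.
  by rewrite -[leRHS]mulrA; apply: ler_wpM2l => //; nonneg.
apply: le_trans (lerD (lexx _) (lerD j1 j2)).
rewrite le_eqVlt; apply/orP; left; apply/eqP.
by field; rewrite gt_eqF.
Qed.

Lemma lyap_descent : exists2 c0 : R, 0 < c0 &
  forall (G : 'M[R]_(m, n) -> 'M[R]_(m, n)) (Phi : 'cV[R]_m -> R) X Y,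
  descent_model Lc LF G Phi -> Y *m ones = G X *m (ones : 'cV_n) ->
  lyap r c kappa Phi (stepX Rw alpha X Y) (stepY Rw Cw alpha G X Y)
    <= lyap r c kappa Phi X Y - c0 * gap r c X Y.
Proof.
have ex0 := ss_eps_x_gt0 step; have ey0 := ss_eps_y_gt0 step.
have ep0 := ss_eps_gt0 step; have ka0 := ss_kappa_gt0 step.
have hal3 := ss_alpha3 step; rewrite /K3 /K5 -[2 * _ * (1 + _)]/(2 * n%:R * _) in hal3.
have hal2 := ss_alpha2 step; rewrite /K2 /K4 in hal2.
have hal1 := ss_alpha1 step; have hka := ss_kappa_le step; rewrite /K6 in hka.
have hex := ss_eps_x_lt step.
pose W := kappa * (1 + 1 / eps_y) * KC2 c ^+ 2 * Lc ^+ 2.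
have n2 : 2 <= n%:R :> R by rewrite (ler_nat _ 2) agents_ge2.
have z0 := zeta_ge0 mix; have z1 := zeta_le1 mix; have k2 := vmin_r_half.
have sq (x : R) : 0 <= x ^+ 2 by exact: sqr_ge0.
have cR := coefficient_R ey0 ep0 ka0 alpha_gt0 z0 (sq Lc) k2 (sq (KC2 c)) n2 hka hal1 (erefl W).
have cC := coefficient_C ex0 ey0 ep0 ka0 alpha_gt0 z0 z1 (sq Lc) (sq (K2C c)) (sq (KC2 c)) (sq (KRC r c)) n2 LF_ge0 hal2 hal3 (erefl W).
have cM := coefficient_mean (sq (rhoR Rw r)) ex0 ey0 ka0 alpha_gt0 (sq Lc) k2 (sq (KC2 c)) n2 LF_ge0 hex hka hal3 (erefl W).
move: cR cC cM; set A := (X in X < 0 -> _); set B := (X in _ -> X < 0 -> _).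
set C := (X in _ -> _ -> X < 0 -> _) => A0 B0 C0.
(* [A], [B], [C] are the negative coefficients of [resR], [resC] and the squared mean tracker, the
   three summands of the gap; the least opposite value serves for all. *)
exists (Num.min (- A) (Num.min (- B) (- C))); first by rewrite !lt_min !oppr_gt0 A0 B0 C0.
move=> G Phi X Y model Y1; rewrite /lyap /gap.
have hP := mean_descent model Y1; have hR := resR_step X Y.
have hC := resC_step X Y (model_lip model); have hM := nrm_stepX_move X Y.
have aR0 : 0 <= resR r X by exact: sqr_ge0.
have b0 : 0 <= resC c Y by exact: sqr_ge0.
have g0 : 0 <= nrm (Y *m ones : 'cV_m) ^+ 2 by exact: sqr_ge0.
move: hP hR hC hM aR0 b0 g0; move: (Phi _) (Phi _) (resR _ _) (resR _ _) (resC _ _) (resC _ _) (nrm (Y *m ones) ^+ 2) (nrm (_ - _) ^+ 2).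
move=> P0 P' a' a b' b g mv hP hR hC hM aR0 b0 g0.
have ka_ge0 := ltW ka0.
have W0 : 0 <= W by rewrite /W; nonneg.
have h1 : kappa * b' <= kappa * ((1 + eps_y) * rhoC Cw c ^+ 2 * b) + W * mv.
  apply: le_trans (ler_wpM2l ka_ge0 hC) _; rewrite le_eqVlt; apply/orP; left.
  by apply/eqP; rewrite /W; ring.
have h2 := ler_wpM2l W0 hM.
set c0 := Num.min _ _.
have cA : c0 <= - A by rewrite ge_min lexx.
have cB : c0 <= - B by rewrite !ge_min lexx orbT.
have cC : c0 <= - C by rewrite !ge_min lexx !orbT.
have hA : c0 * a <= - A * a by rewrite ler_wpM2r.
have hB : c0 * b <= - B * b by rewrite ler_wpM2r.
have hG : c0 * g <= - C * g by rewrite ler_wpM2r.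
have E : P' + a' + kappa * b' <= P0 + a + kappa * b - (- A * a + - B * b + - C * g).
  apply: le_trans (lerD (lerD hP hR) (le_trans h1 (lerD (lexx _) h2))) _.
  rewrite le_eqVlt; apply/orP; left; apply/eqP; rewrite /A /B /C; ring.
apply: le_trans E _; rewrite lerD2l lerN2 !mulrDr.
by rewrite !lerD.
Qed.

End Descent.

(** * Symmetric matrices and orthonormal bases *)

Section SymmetricMatrices.
Context {R : realType} {k : nat}.
Implicit Types (S P : 'M[R]_k) (v : 'cV[R]_k).

(* For [P >= 0], evaluate the form at [v - P v / K], where [K > |P|]. *)
Lemma psd_image_bound P v : P^T = P -> (forall u : 'cV_k, 0 <= ip u (P *m u)) ->
  ip (P *m v) (P *m v) <= (nrm P + 1) * ip v (P *m v).
Proof.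
move=> Ps P0; set K := nrm P + 1.
have K0 : 0 < K by rewrite ltr_wpDl ?nrm_ge0.
have := P0 (v - K^-1 *: (P *m v)).
rewrite mulmxBr -scalemxAr ipBl !ipBr !ipZl !ipZr.
have -> : ip v (P *m (P *m v)) = ip (P *m v) (P *m v) by rewrite [RHS]ip_mull Ps.
have h : ip (P *m v) (P *m (P *m v)) <= K * ip (P *m v) (P *m v).
  apply: le_trans (ler_ip _ _) _.
  apply: (@le_trans _ _ (nrm (P *m v) * (nrm P * nrm (P *m v)))).
    by apply: ler_wpM2l; [exact: nrm_ge0|exact: nrmM].
  by rewrite mulrCA -expr2 nrm_sq ler_wpM2r ?ip_ge0// lerDl.
set s := ip (P *m v) (P *m v) in h *; set b := ip v (P *m v); set u := ip _ _ in h *.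
have h2 : K^-1 * (K^-1 * u) <= K^-1 * s.
  by rewrite ler_pM2l ?invr_gt0// ler_pdivrMl.
move=> h1; have {h1}h2 : K^-1 * s <= b by move: h1 h2; lra.
by rewrite ler_pdivrMl in h2.
Qed.

(** The infimum a of the form on the unit sphere is an eigenvalue without any compactness: otherwise
    [S - a] is nonnegative and invertible, so [psd_image_bound] keeps its form above a positive
    multiple of [|v|^2], against the choice of a. *)
Lemma rayleigh S : S^T = S -> (0 < k)%N ->
  exists2 a : R, eigenvalue S a & forall v, a * ip v v <= ip v (S *m v).
Proof.
move=> Ss k0; pose E := [set ip v (S *m v) | v in [set v : 'cV[R]_k | ip v v = 1]].
have E0 : has_inf E.
  split.
    exists (ip (basis_vec (Ordinal k0)) (S *m basis_vec (Ordinal k0))).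
    by exists (basis_vec (Ordinal k0)) => //=; rewrite -nrm_sq nrm_basis expr1n.
  exists (- nrm S) => _ [v /= v1 <-]; rewrite lerNl.
  apply: le_trans (ler_norm _) _; rewrite normrN; apply: le_trans (ler_norm_ip _ _) _.
  have nv : nrm v = 1 by rewrite /nrm v1 sqrtr1.
  by rewrite nv mul1r (le_trans (nrmM _ _))// nv mulr1.
pose a := inf E.
have Sa v : a * ip v v <= ip v (S *m v).
  have [->|v0] := eqVneq v 0; first by rewrite !ip0l mulr0.
  have nv := nrm_gt0 v0.
  have h : a <= ip ((nrm v)^-1 *: v) (S *m ((nrm v)^-1 *: v)).
    apply: ge_inf; first exact: E0.2.
    exists ((nrm v)^-1 *: v) => //=.
    by rewrite ipZl ipZr -nrm_sq expr2 mulrA -invfM mulVf// mulf_neq0 ?gt_eqF.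
  move: h; rewrite -scalemxAr ipZl ipZr mulrA -invfM -expr2 nrm_sq.
  by rewrite mulrC ler_pdivlMr// -nrm_sq exprn_gt0.
exists a => //; rewrite /eigenvalue /eigenspace kermx_eq0 row_free_unit.
apply/negP => Pu; set P := S - a%:M in Pu.
have Ps : P^T = P by rewrite /P linearB/= Ss tr_scalar_mx.
have Pv v : ip v (P *m v) = ip v (S *m v) - a * ip v v.
  by rewrite mulmxBl mul_scalar_mx ipBr ipZr.
have P0 (v : 'cV_k) : 0 <= ip v (P *m v) by rewrite Pv subr_ge0.
pose C := nrm (invmx P) ^+ 2 * (nrm P + 1) + 1.
have C0 : 0 < C by rewrite ltr_wpDl ?mulr_ge0 ?sqr_ge0 ?addr_ge0 ?nrm_ge0.
have hC v : ip v v <= C * ip v (P *m v).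
  apply: (@le_trans _ _ (nrm (invmx P) ^+ 2 * ip (P *m v) (P *m v))).
    rewrite -!nrm_sq -exprMn ler_pXn2r ?nnegrE ?mulr_ge0 ?nrm_ge0//.
    by rewrite -{1}(mulKmx Pu v) nrmM.
  rewrite mulrDl mul1r ler_wpDr// -mulrA ler_wpM2l ?sqr_ge0//.
  exact: psd_image_bound.
have : a + C^-1 <= a.
  rewrite {2}/a; apply: lb_le_inf; first exact: E0.1.
  move=> _ [v /= v1 <-]; have := hC v; rewrite Pv v1 mulr1 => h.
  by rewrite addrC -lerBrDr -(ler_pM2l C0) mulfV ?gt_eqF.
by rewrite gerDl leNgt invr_gt0 C0.
Qed.

(** With a pseudo-inverse Q, [S = S Q S] turns the form into that of Q at [S v]. For a Hessian,
    possibly singular, this bounds the form by the squared gradient of its quadratic model. *)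
Lemma sym_form_bound S : S^T = S ->
  exists2 C : R, 0 <= C & forall v, `|ip v (S *m v)| <= C * nrm (S *m v) ^+ 2.
Proof.
move=> Ss; have := mulmxKpV (submx_refl S); move: (pinvmx S) => Q SQ.
exists (nrm Q) => [|v]; first exact: nrm_ge0.
rewrite -{1}SQ -!mulmxA -{1}Ss -ip_mull.
apply: le_trans (ler_norm_ip _ _) _; rewrite expr2 mulrCA.
by apply: ler_wpM2l; [exact: nrm_ge0|exact: nrmM].
Qed.

Lemma psdP S : psd S <-> forall v, 0 <= ip v (S *m v).
Proof.
have E v : (v^T *m S *m v) 0 0 = ip v (S *m v).
  rewrite -mulmxA mxE ipE; apply: eq_bigr => i _.
  by rewrite big_ord1 !mxE.
by split => h v; have := h v; rewrite E.
Qed.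

Lemma lambda_min_lt0 S : lambda_min S < 0 -> exists v, ip v (S *m v) < 0.
Proof.
move=> h; have [[a aE a0]|no] := pselect (exists2 a, eigenvalue S a & a < 0).
  have /eigenvalueP[v vS v0] := aE; exists v^T.
  rewrite ipC ip_mull ipC -[S^T *m _]trmx_mul vS -ip_tr !trmxK ipZl pmulr_llt0//.
  by rewrite -nrm_sq exprn_gt0// nrm_gt0.
suff : 0 <= lambda_min S by rewrite leNgt h.
rewrite /lambda_min.
(* Without eigenvalues the [inf] is 0 by convention, hence not negative. *)
have [->|/set0P E0] := eqVneq [set a : R | eigenvalue S a] set0; last first.
  by apply: lb_le_inf => // a /= aE; rewrite leNgt; apply/negP => a0; apply: no; exists a.
by rewrite inf0.
Qed.

Lemma psd_lambda_min S : S^T = S -> ~ (lambda_min S < 0) -> psd S.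
Proof.
move=> Ss h; apply/psdP => v; have [k0|k0] := posnP k.
  by move: S v Ss h; rewrite k0 => S v _ _; rewrite (_ : v = 0) ?ip0l// [v]flatmx0.
have [a aE Sa] := rayleigh Ss k0.
apply: le_trans (Sa v); rewrite mulr_ge0 ?ip_ge0//.
rewrite leNgt; apply/negP => a0; apply: h; apply: le_lt_trans a0.
apply: ge_inf => //; exists (- nrm S) => b /= /eigenvalueP[w wS w0].
have nw := nrm_gt0 w0; rewrite lerNl -(ler_pM2r nw).
apply: (@le_trans _ _ (`|b| * nrm w)); first by rewrite ler_wpM2r ?nrm_ge0// -normrN ler_norm.
by rewrite -nrmZ -wS mulrC nrmM.
Qed.

Lemma sigma_min_bound (A : 'M[R]_k) v : sigma_min A * nrm v <= nrm (A *m v).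
Proof.
have [k0|k0] := posnP k.
  by move: A v; rewrite k0 => A v; rewrite (_ : v = 0) ?mulmx0 ?nrm0 ?mulr0// [v]flatmx0.
have [a aE Sa] : exists2 a, eigenvalue (A^T *m A) a & forall v, a * ip v v <= ip v (A^T *m A *m v).
  by apply: rayleigh => //; rewrite trmx_mul trmxK.
have sa : sigma_min A <= Num.sqrt a.
  apply: ge_inf; last by exists a.
  by exists 0 => _ [b _ <-]; exact: sqrtr_ge0.
apply: le_trans (ler_wpM2r (nrm_ge0 _) sa) _.
have [a0|a0] := leP a 0; first by rewrite ler0_sqrtr// mul0r nrm_ge0.
rewrite -(ler_pXn2r (ltn0Sn 1)) ?nnegrE ?mulr_ge0 ?sqrtr_ge0 ?nrm_ge0//.
rewrite exprMn (sqr_sqrtr (ltW a0)) !nrm_sq; apply: le_trans (Sa v) _.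
by rewrite -mulmxA [leRHS]ip_mull.
Qed.

End SymmetricMatrices.

Section OrthonormalBasis.
Context {R : realType} {k l : nat}.
Variable M : 'M[R]_(k, l).

Let orthonormal_in (d : nat) := exists B : 'M[R]_(k, d),
  B^T *m B = 1%:M /\ forall t, exists z, B *m t = M *m z :> 'cV_k.

(** Gram-Schmidt by maximality: among the orthonormal families inside the range, whose sizes are at
    most k, take a largest one. A nonzero residual of a vector of the range, once normalized, would
    extend it. *)
Lemma orthonormal_basis : exists (d : nat) (B : 'M[R]_(k, d)),
  B^T *m B = 1%:M /\ range (fun t : 'cV[R]_d => B *m t) = range (fun z : 'cV[R]_l => M *m z).
Proof.
have ex0 : exists d, `[< orthonormal_in d >].
  exists 0%N; apply/asboolP; exists 0; split; first by apply/matrixP => -[].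
  by move=> t; exists 0; rewrite mul0mx mulmx0.
have ub d : `[< orthonormal_in d >] -> (d <= k)%N.
  move=> /asboolP[B [BB _]]; rewrite -(@mxrank1 R d) -BB.
  exact: leq_trans (mxrankM_maxr _ _) (rank_leq_row _).
have [d /asboolP[B [BB BM]] dmax] := ex_maxnP ex0 ub.
exists d, B; split => //; apply/seteqP; split => [_ [t _ <-]|_ [z _ <-]].
  by have [z ->] := BM t; exists z.
exists (B^T *m (M *m z)) => //; apply/eqP; rewrite eq_sym -subr_eq0; apply/negPn/negP => w0.
set w := _ - _ in w0; have nw := nrm_gt0 w0.
have Bw : B^T *m w = 0 by rewrite /w mulmxBr [B^T *m (B *m _)]mulmxA BB mul1mx subrr.
suff : (d + 1 <= d)%N by rewrite addn1 ltnn.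
apply: dmax; apply/asboolP; pose e := (nrm w)^-1 *: w.
have Be : B^T *m e = 0 by rewrite /e -scalemxAr Bw scaler0.
exists (row_mx B e); split.
  rewrite tr_row_mx mul_col_row BB Be -[e^T *m B]trmxK trmx_mul trmxK Be trmx0.
  rewrite [e^T *m e](_ : _ = 1%:M) -?scalar_mx_block//.
  have e1 : ip e e = 1.
    by rewrite -nrm_sq /e nrmZ gtr0_norm ?invr_gt0// mulVf ?gt_eqF// expr1n.
  apply/matrixP => i j; rewrite !ord1 [RHS]mxE eqxx mulr1n -e1 ipE mxE.
  by apply: eq_bigr => s _; rewrite big_ord1 [e^T _ _]mxE.
move=> t; have [z1 E1] := BM (usubmx t - (B^T *m (M *m z)) *m ((nrm w)^-1 *: dsubmx t)).
exists (z1 + z *m ((nrm w)^-1 *: dsubmx t)).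
rewrite -[in LHS](vsubmxK t) mul_row_col mulmxDr -E1 mulmxBr !mulmxA.
rewrite /e /w -!scalemxAr -scalemxAl mulmxBl scalerBr !mulmxA.
by rewrite -!addrA; congr (_ + _); rewrite addrC.
Qed.

End OrthonormalBasis.

(** * Null sets *)

(** Null sets through covers by cubes, which a Lipschitz map preserves up to a factor. [s k] is half
    a side, so [lebesgue_outer_cube_null] carries a factor [2 ^+ d]; only finite sums occur. *)
Definition cube_null {R : realType} {d : nat} (A : set 'cV[R]_d) : Prop :=
  forall e : R, 0 < e -> exists (x : nat -> 'cV[R]_d) (s : nat -> R),
    [/\ forall k, 0 <= s k,
        A `<=` \bigcup_k [set t | `|t - x k| <= s k]
      & forall N, \sum_(k < N) s k ^+ d <= e].

Section CubeNull.
Context {R : realType} {d : nat}.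
Implicit Types A B : set 'cV[R]_d.

Lemma cube_nullS A B : A `<=` B -> cube_null B -> cube_null A.
Proof.
move=> AB Bn e e0; have [x [s [s0 sB sN]]] := Bn e e0.
by exists x, s; split => //; exact: subset_trans sB.
Qed.

Lemma lebesgue_outer_cube_null A : cube_null A -> lebesgue_outer A = 0%E.
Proof.
move=> An; apply/eqP; rewrite eq_le; apply/andP; split; last first.
  apply: le_ereal_inf_tmp => _ [a [b [ab _ ->]]].
  by apply: nneseries_ge0 => k _ _; rewrite lee_fin prodr_ge0// => i _; rewrite subr_ge0.
apply/lee_addgt0Pr => e e0; rewrite add0e.
have c0 : 0 < (2 : R) ^+ d by rewrite exprn_gt0.
have [x [s [s0 xA sN]]] := An (e / 2 ^+ d) (divr_gt0 e0 c0).
pose a k : 'cV[R]_d := x k - const_mx (s k); pose b k : 'cV[R]_d := x k + const_mx (s k).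
apply: (@le_trans _ _ (\sum_(0 <= k <oo) (box_vol (a k) (b k))%:E)%E).
  apply: ereal_inf_lbound; exists a, b; split => //.
    by move=> k i; rewrite !mxE lerD2l ge0_cp.
  move=> t /xA[k _ /= tk]; exists k => // i; rewrite !mxE.
  have := le_trans (norm_entry_mx_norm (t - x k) i 0) tk.
  by rewrite !mxE ler_norml => /andP[h1 h2]; apply/andP; split; lra.
have vE k : box_vol (a k) (b k) = 2 ^+ d * s k ^+ d.
  rewrite /box_vol (eq_bigr (fun=> 2 * s k)) => [|i _]; last by rewrite !mxE; ring.
  by rewrite prodr_const card_ord exprMn.
apply: lime_le; first by apply: is_cvg_nneseries => k _ _; rewrite lee_fin vE mulr_ge0 ?exprn_ge0.
near=> N; rewrite sumEFin lee_fin big_mkord.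
under eq_bigr do rewrite vE.
by rewrite -mulr_sumr mulrC -ler_pdivlMr.
Unshelve. all: by end_near. Qed.

Lemma sum_half_powers (e : R) K : 0 <= e -> \sum_(i < K) e / 2 ^+ i.+1 <= e.
Proof.
move=> e0; suff -> : \sum_(i < K) e / 2 ^+ i.+1 = e - e / 2 ^+ K.
  by rewrite gerBl divr_ge0 ?exprn_ge0.
elim: K => [|K ih]; first by rewrite big_ord0 expr0 divr1 subrr.
rewrite big_ord_recr/= ih exprS; field.
by rewrite expf_neq0 ?pnatr_eq0.
Qed.

Lemma ler_sum_uniq_sub (I : eqType) (s t : seq I) (F : I -> R) :
  (forall i, 0 <= F i) -> uniq s -> uniq t -> {subset s <= t} ->
  \sum_(i <- s) F i <= \sum_(i <- t) F i.
Proof.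
move=> F0 su tu st; rewrite [leRHS](bigID (mem s))/= -[X in _ <= X + _]big_filter.
have ps : perm_eq [seq i <- t | i \in s] s.
  apply: uniq_perm => //; first exact: filter_uniq.
  by move=> i; rewrite mem_filter; case: (boolP (i \in s)) => // /st ->.
by rewrite (perm_big _ ps)/= lerDl sumr_ge0.
Qed.

(** The pairs with code below N lie in a square of side K, so a partial sum in the order of the
    codes is bounded by full rows. *)
Lemma ler_sum_double (F : nat -> nat -> R) (e : nat -> R) (N : nat) :
  (forall i k, 0 <= F i k) -> (forall i K, \sum_(k < K) F i k <= e i) ->
  exists K : nat,
  \sum_(m < N) (if pickle_inv m is Some ik then F ik.1 ik.2 else 0) <= \sum_(i < K) e i.
Proof.
move=> F0 Fe; pose s := pmap (@pickle_inv (nat * nat)%type) (iota 0 N).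
pose K := \max_(ik <- s) (maxn ik.1 ik.2).+1.
exists K; apply: (@le_trans _ _ (\sum_(ik <- s) F ik.1 ik.2)).
  rewrite -(big_mkord xpredT (fun m => if pickle_inv m is Some ik then F ik.1 ik.2 else 0)).
  rewrite /s /index_iota subn0; elim: (iota 0 N) => [|m l ih]; first by rewrite !big_nil.
  rewrite big_cons /=; case: (pickle_inv m) => [ik|] /=; last by rewrite add0r.
  by rewrite big_cons lerD2l.
apply: (@le_trans _ _ (\sum_(ik <- [seq (i, k) | i <- iota 0 K, k <- iota 0 K]) F ik.1 ik.2)).
  apply: ler_sum_uniq_sub => //.
  - exact: (pmap_uniq (@pickle_invK _)) (iota_uniq _ _).
  - by apply: allpairs_uniq; rewrite ?iota_uniq// => -[? ?] [? ?].
  move=> ik iks; apply/allpairsP; exists ik; rewrite !mem_iota !add0n.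
  have := @leq_bigmax_seq _ s xpredT (fun ik => (maxn ik.1 ik.2).+1) ik iks isT.
  rewrite -/K gtn_max => /andP[h1 h2]; split => //; last by case: ik {iks h1 h2}.
rewrite big_allpairs -[leRHS](big_mkord xpredT) /index_iota subn0.
apply: ler_sum => i _; have := Fe i K.
by rewrite -(big_mkord xpredT) /index_iota subn0.
Qed.

Hypothesis d_gt0 : (0 < d)%N.

Lemma cube_null_bigcup (A : nat -> set 'cV[R]_d) :
  (forall i, cube_null (A i)) -> cube_null (\bigcup_i A i).
Proof.
move=> An e e0.
have /choice[xs xsP] : forall i, exists xs : (nat -> 'cV[R]_d) * (nat -> R),
    [/\ forall k, 0 <= xs.2 k,
        A i `<=` \bigcup_k [set t | `|t - xs.1 k| <= xs.2 k]
      & forall N, \sum_(k < N) xs.2 k ^+ d <= e / 2 ^+ i.+1].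
  move=> i; have [|x [s h]] := An i (e / 2 ^+ i.+1).
    by rewrite divr_gt0// exprn_gt0.
  by exists (x, s).
exists (fun m => if pickle_inv m is Some ik then (xs ik.1).1 ik.2 else 0).
exists (fun m => if pickle_inv m is Some ik then (xs ik.1).2 ik.2 else 0).
split.
- by move=> m; case: (pickle_inv m) => [[i k]|]//=; have [] := xsP i.
- move=> t [i _]; have [_ h _] := xsP i => /h[k _ tk].
  by exists (pickle (i, k)) => //=; rewrite pickleK_inv.
move=> N; have [i k|i K|K hK] := @ler_sum_double (fun i k => (xs i).2 k ^+ d) (fun i => e / 2 ^+ i.+1) N.
- by have [h _ _] := xsP i; rewrite exprn_ge0.
- by have [] := xsP i.
apply: le_trans (sum_half_powers K (ltW e0)); apply: le_trans hK.
apply: ler_sum => m _; case: (pickle_inv m) => [ik|]//.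
(* An index that codes no pair gets a cube of side 0, of volume 0 because [d > 0]. *)
by rewrite expr0n; case: d d_gt0.
Qed.

Lemma cube_null0 : cube_null (set0 : set 'cV[R]_d).
Proof.
move=> e e0; exists (fun=> 0), (fun=> 0); split => // N.
by rewrite big1 ?ltW// => k _; rewrite expr0n; case: d d_gt0.
Qed.

Lemma cube_null_countable (I : countType) (A : I -> set 'cV[R]_d) :
  (forall i, cube_null (A i)) -> cube_null (\bigcup_i A i).
Proof.
move=> An; pose A' m := if unpickle m is Some i then A i else set0.
apply: (@cube_nullS _ (\bigcup_m A' m)); last first.
  by apply: cube_null_bigcup => m; rewrite /A'; case: unpickle => [i|]; [exact: An|exact: cube_null0].
by move=> t [i _ ti]; exists (pickle i) => //; rewrite /A' pickleK.
Qed.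

(* The part of [Phi @^-1` A] over a cube of radius [s] has diameter at most [2 C s]. *)
Lemma cube_null_preimage (Phi : 'cV[R]_d -> 'cV[R]_d) (C : R) A : 0 <= C ->
  (forall t t', `|t - t'| <= C * `|Phi t - Phi t'|) ->
  cube_null A -> cube_null (Phi @^-1` A).
Proof.
move=> C0 PhiC An e e0.
have c0 : 0 < (2 * C) ^+ d + 1 by rewrite ltr_wpDl ?exprn_ge0 ?mulr_ge0.
have [x [s [s0 xA sN]]] := An (e / ((2 * C) ^+ d + 1)) (divr_gt0 e0 c0).
have /choice[y yP] : forall k, exists y, forall t, `|Phi t - x k| <= s k -> `|t - y| <= 2 * C * s k.
  move=> k; have [[t0 t0k]|no] := pselect (exists t, `|Phi t - x k| <= s k); last first.
    by exists 0 => t tk; case: no; exists t.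
  exists t0 => t tk; apply: le_trans (PhiC t t0) _.
  rewrite [2 * C]mulrC -mulrA; apply: ler_wpM2l => //.
  have -> : Phi t - Phi t0 = (Phi t - x k) - (Phi t0 - x k) by rewrite opprB addrA subrK.
  by apply: le_trans (ler_normB _ _) _; rewrite mulr_natl mulr2n lerD.
exists y, (fun k => 2 * C * s k); split.
- by move=> k; rewrite !mulr_ge0.
- by move=> t /xA[k _ tk]; exists k => //=; exact: yP.
move=> N; under eq_bigr do rewrite exprMn.
rewrite -mulr_sumr; have h := sN N.
apply: (@le_trans _ _ (((2 * C) ^+ d + 1) * \sum_(k < N) s k ^+ d)).
  by apply: ler_wpM2r; [rewrite sumr_ge0// => k _; rewrite exprn_ge0|rewrite lerDl].
by rewrite mulrC -ler_pdivlMr.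
Qed.

Lemma cube_null_finite A :
  (forall e : R, 0 < e -> exists (K : nat) (x : nat -> 'cV[R]_d) (s : R),
    [/\ 0 <= s, forall t, A t -> exists2 k, (k < K)%N & `|t - x k| <= s
      & K%:R * s ^+ d <= e]) -> cube_null A.
Proof.
move=> h e e0; have [K [x [s [s0 xA Ks]]]] := h e e0.
exists x, (fun k => if (k < K)%N then s else 0); split.
- by move=> k; case: ifP.
- by move=> t /xA[k kK tk]; exists k => //=; rewrite kK.
move=> N; apply: le_trans Ks.
have -> : K%:R * s ^+ d = \sum_(k < K) s ^+ d by rewrite sumr_const card_ord mulr_natl.
rewrite -(big_mkord xpredT (fun k => (if (k < K)%N then s else 0) ^+ d)) -(big_mkord xpredT (fun=> s ^+ d)).
rewrite (eq_bigr (fun k => if (k < K)%N then s ^+ d else 0)) => [|k _]; last first.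
  by case: ifP => // _; rewrite expr0n; case: d d_gt0.
rewrite -big_mkcond /index_iota !subn0 -big_filter.
apply: ler_sum_uniq_sub; rewrite ?filter_uniq ?iota_uniq//.
  by move=> ?; exact: exprn_ge0.
by move=> k; rewrite mem_filter !mem_iota => /andP[].
Qed.

End CubeNull.

(** * Lipschitz graphs and cone conditions *)

Section LipschitzGraph.
Context {R : realType}.

Lemma mx_norm_le {p q : nat} (A : 'M[R]_(p, q)) (e : R) :
  0 <= e -> (forall i j, `|A i j| <= e) -> `|A| <= e.
Proof. by move=> e0 Ae; rewrite [leLHS]/Num.norm/= mx_normrE; apply/bigmax_leP. Qed.

Lemma truncn_eq_dist (a b : R) : 0 <= a -> 0 <= b -> Num.truncn a = Num.truncn b -> `|a - b| <= 1.
Proof.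
move=> a0 b0 E; have := truncn_itv a0; have := truncn_itv b0; rewrite E -natr1.
move=> /andP[h1 h2] /andP[h3 h4]; rewrite ler_norml; apply/andP; split; lra.
Qed.

(* Cut the hyperplane into [N^d] cubes of side [2 M / N]: the part of [T] over each of
   them fits into a cube of side [O(1/N)] in dimension [d.+1]. *)
Lemma cube_null_graph (d : nat) (T : set 'cV[R]_d.+1) (j : 'I_d.+1)
    (w : 'cV[R]_d.+1 -> 'cV[R]_d.+1) (M C : R) : 0 < M -> 0 <= C ->
  (forall t, T t -> w t j 0 = 0) -> (forall t, T t -> `|w t| < M) ->
  (forall t t', T t -> T t' -> `|t - t'| <= C * `|w t - w t'|) -> cube_null T.
Proof.
move=> M0 C0 wj wM wC; apply: cube_null_finite => // e e0.
pose B := (C * (2 * M)) ^+ d.+1; have B0 : 0 <= B by rewrite exprn_ge0// !mulr_ge0// ltW.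
pose N := Num.truncn (B / e); have NB : B / e < N.+1%:R by exact: truncnS_gt.
have N0 : 0 < N.+1%:R :> R by [].
pose h := 2 * M / N.+1%:R; have h0 : 0 < h by rewrite divr_gt0// mulr_gt0.
pose g (t : 'cV[R]_d.+1) i := (w t (lift j i) 0 + M) / h.
have g0 t i : T t -> 0 <= g t i.
  move=> /wM/(le_lt_trans (norm_entry_mx_norm _ (lift j i) 0)).
  by rewrite ltr_norml => /andP[h1 _]; rewrite divr_ge0 ?(ltW h0)//; lra.
have gN t i : T t -> (Num.truncn (g t i) < N.+1)%N.
  move=> Tt; rewrite truncn_lt_nat ?g0//.
  have := le_lt_trans (norm_entry_mx_norm _ (lift j i) 0) (wM _ Tt).
  rewrite ltr_norml => /andP[_ h1]; rewrite ltr_pdivrMr// /h mulrCA mulfV ?gt_eqF// mulr1.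
  by lra.
pose cell t := [ffun i : 'I_d => inord (Num.truncn (g t i)) : 'I_N.+1].
have same t t' : T t -> T t' -> cell t = cell t' -> `|t - t'| <= C * h.
  move=> Tt Tt' E; apply: le_trans (wC _ _ Tt Tt') _; apply: ler_wpM2l => //.
  apply: mx_norm_le; first exact: ltW.
  move=> i k; rewrite ord1 !mxE; case: (unliftP j i) => [l ->|->]; last first.
    by rewrite !wj// subrr normr0 ltW.
  have : `|g t l - g t' l| <= 1.
    apply: truncn_eq_dist; rewrite ?g0//.
    have := congr1 (fun f : {ffun 'I_d -> 'I_N.+1} => val (f l)) E.
    by rewrite !ffunE /= !inordK ?gN.
  rewrite -mulrBl opprD addrACA subrr addr0 normrM [`|h^-1|]gtr0_norm ?invr_gt0//.
  by rewrite ler_pdivrMr// mul1r.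
have /choice[y yP] : forall phi, exists y, forall t, T t -> cell t = phi -> `|t - y| <= C * h.
  move=> phi; have [[t0 Tt0 ct0]|no] := pselect (exists2 t, T t & cell t = phi); last first.
    by exists 0 => t Tt ct; case: no; exists t.
  by exists t0 => t Tt ct; apply: same => //; rewrite ct.
pose s := enum {ffun 'I_d -> 'I_N.+1}; pose phi0 : {ffun 'I_d -> 'I_N.+1} := [ffun=> ord0].
exists (size s), (fun k => y (nth phi0 s k)), (C * h); split.
- by rewrite mulr_ge0// ltW.
- move=> t Tt; exists (index (cell t) s); first by rewrite index_mem mem_enum.
  by apply: yP => //; rewrite nth_index ?mem_enum.
have -> : (size s)%:R = N.+1%:R ^+ d :> R by rewrite -cardE card_ffun !card_ord natrX.
have -> : N.+1%:R ^+ d * (C * h) ^+ d.+1 = B / N.+1%:R.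
  have -> : (C * h) ^+ d.+1 = B / N.+1%:R ^+ d.+1 by rewrite /B /h mulrA expr_div_n.
  rewrite [X in B / X]exprS; have : N.+1%:R ^+ d != 0 :> R by rewrite expf_neq0// gt_eqF.
  move: (N.+1%:R ^+ d) => P P0; field.
  by rewrite P0 addrC natr1 gt_eqF.
by rewrite ler_pdivrMr// mulrC -ler_pdivrMr// ltW.
Qed.

(** If the bound failed, then [x <= s], and [q s^2] would exceed [(2 b + g) s x], which dominates
    the right-hand side of the hypothesis. *)
Lemma cone_coordinate_bound (q b g s x : R) : 0 < q -> 0 <= b -> 0 <= g -> 0 <= s -> 0 <= x ->
  q * s ^+ 2 <= 2 * b * s * x + g * x ^+ 2 -> s <= ((2 * b + g) / q + 1) * x.
Proof.
move=> q0 b0 g0 s0 x0 h; rewrite leNgt; apply/negP => hs.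
have k0 : 0 <= (2 * b + g) / q by rewrite divr_ge0 ?addr_ge0 ?mulr_ge0// ltW.
have xs : x <= s.
  by apply: le_trans (ltW hs); rewrite mulrDl mul1r lerDr mulr_ge0.
have s1 : 0 < s by apply: le_lt_trans hs; rewrite mulr_ge0 ?addr_ge0.
have h1 : q * s * (((2 * b + g) / q + 1) * x) < q * s * s by rewrite ltr_pM2l ?mulr_gt0.
have h2 : q * s * (((2 * b + g) / q + 1) * x) = (2 * b + g) * s * x + q * s * x.
  by field; rewrite gt_eqF.
have h3 : g * x * x <= g * x * s by rewrite ler_wpM2l// mulr_ge0.
have h4 : 0 <= q * s * x by rewrite !mulr_ge0// ltW.
move: h h1 h3 h4; rewrite h2; lra.
Qed.

(** Normalize a positive direction u to have j-th coordinate 1 and project along u to the hyperplane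
    where that coordinate vanishes. For a difference of nonpositive form, the u-component is bounded
    by the projection, so T is a Lipschitz graph over its projection. *)
Lemma cube_null_cone (d : nat) (T : set 'cV[R]_d) (Q : 'M[R]_d) (u0 : 'cV[R]_d) (M : R) :
  0 < ip u0 (Q *m u0) -> (forall t, T t -> nrm t <= M) ->
  (forall t t', T t -> T t' -> ip (t - t') (Q *m (t - t')) <= 0) -> cube_null T.
Proof.
case: d T Q u0 => [|d] T Q u0 Qu0 TM TQ.
  by move: Qu0; rewrite (_ : u0 = 0) ?ip0l ?ltxx// [u0]flatmx0.
have [j uj] : exists j, u0 j 0 != 0.
  apply: contrapT => no; move: Qu0; suff -> : u0 = 0 by rewrite ip0l ltxx.
  apply/matrixP => i k; rewrite ord1 mxE; apply/eqP/negPn/negP => ui.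
  by apply: no; exists i.
have [u u1 q0] : exists2 u : 'cV[R]_d.+1, u j 0 = 1 & 0 < ip u (Q *m u).
  exists ((u0 j 0)^-1 *: u0); first by rewrite mxE mulVf.
  by rewrite -scalemxAr ipZl ipZr mulrA -expr2 mulr_gt0// exprn_even_gt0//= invr_neq0.
pose w (t : 'cV[R]_d.+1) : 'cV[R]_d.+1 := t - t j 0 *: u.
pose b := nrm Q * nrm u; pose C1 := (2 * b + nrm Q) / ip u (Q *m u) + 1.
have b0 : 0 <= b by rewrite mulr_ge0 ?nrm_ge0.
have C10 : 0 <= C1 by rewrite addr_ge0 ?divr_ge0 ?addr_ge0 ?mulr_ge0 ?nrm_ge0// ltW.
pose C := (C1 * nrm u + 1) * (d.+1 * 1)%:R.
have C0 : 0 <= C by rewrite !mulr_ge0// addr_ge0// mulr_ge0 ?nrm_ge0.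
have M1 : 0 < `|M| + `|M| * nrm u + 1 by rewrite ltr_wpDl ?addr_ge0 ?mulr_ge0 ?nrm_ge0.
apply: (@cube_null_graph d T j w (`|M| + `|M| * nrm u + 1) C) => //.
- by move=> t _; rewrite !mxE u1 mulr1 subrr.
- move=> t Tt; have tM := le_trans (TM t Tt) (ler_norm M).
  apply: (@le_lt_trans _ _ (`|M| + `|M| * nrm u)); last by rewrite ltrDl.
  apply: le_trans (mx_norm_nrm _) _; apply: le_trans (nrmD _ _) _.
  rewrite nrmN nrmZ lerD// ler_wpM2r ?nrm_ge0//.
  exact: le_trans (norm_entry_nrm _ _ _) tM.
move=> t t' Tt Tt'; pose D := t - t'; pose o := w t - w t'.
have Do : D = D j 0 *: u + o.
  by rewrite /o /w /D; apply/matrixP => i k; rewrite !mxE; ring.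
have s1 : `|D j 0| <= C1 * nrm o.
  apply: cone_coordinate_bound => //; rewrite ?nrm_ge0//.
  have h : ip (D j 0 *: u + o) (Q *m (D j 0 *: u + o)) <= 0 by rewrite -Do; exact: TQ.
  rewrite mulmxDr -scalemxAr ipDl !ipDr !ipZl !ipZr in h.
  rewrite real_normK ?num_real//.
  have h1 : - (D j 0 * ip u (Q *m o)) <= `|D j 0| * (b * nrm o).
    rewrite -mulrN; apply: le_trans (ler_norm _) _; rewrite normrM normrN ler_wpM2l//.
    apply: le_trans (ler_norm_ip _ _) _; rewrite /b -mulrA mulrCA ler_wpM2l ?nrm_ge0//.
    exact: nrmM.
  have h2 : - (D j 0 * ip o (Q *m u)) <= `|D j 0| * (b * nrm o).
    rewrite -mulrN; apply: le_trans (ler_norm _) _; rewrite normrM normrN ler_wpM2l//.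
    apply: le_trans (ler_norm_ip _ _) _; rewrite mulrC ler_wpM2r ?nrm_ge0//.
    exact: nrmM.
  have h3 : - ip o (Q *m o) <= nrm Q * nrm o ^+ 2.
    apply: le_trans (ler_norm _) _; rewrite normrN; apply: le_trans (ler_norm_ip _ _) _.
    by rewrite expr2 mulrCA ler_wpM2l ?nrm_ge0// nrmM.
  move: h h1 h2 h3. lra.
apply: le_trans (mx_norm_nrm _) _; rewrite -/D Do /C -mulrA.
apply: (@le_trans _ _ ((C1 * nrm u + 1) * nrm o)); last first.
  by apply: ler_wpM2l; [rewrite addr_ge0// mulr_ge0 ?nrm_ge0|exact: nrm_mx_norm].
apply: le_trans (nrmD _ _) _; rewrite nrmZ mulrDl mul1r lerD2r -mulrA [nrm u * _]mulrC mulrA.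
by rewrite ler_wpM2r ?nrm_ge0.
Qed.

End LipschitzGraph.

(** * The algorithm in matrix form *)

(** Agent i becomes column i; thus [lift_mx m A] turns into right multiplication by [A^T]
    ([mat_lift]). *)
Definition mat {R : realType} {n m : nat} (x : 'cV[R]_(n * m)) : 'M[R]_(m, n) :=
  \matrix_(k, i) x (mxtens_index (i, k)) 0.

Definition unmat {R : realType} {n m : nat} (X : 'M[R]_(m, n)) : 'cV[R]_(n * m) :=
  \col_l X (mxtens_unindex l).2 (mxtens_unindex l).1.

Section Matricization.
Context {R : realType} {n m : nat}.
Implicit Types (x y : 'cV[R]_(n * m)) (X : 'M[R]_(m, n)).

Lemma unmatK : cancel (@unmat R n m) mat.
Proof. by move=> X; apply/matrixP => k i; rewrite !mxE mxtens_indexK. Qed.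

Lemma matK : cancel (@mat R n m) unmat.
Proof.
move=> x; apply/matrixP => l o; rewrite ord1 !mxE; congr (x _ _).
by rewrite -[RHS]mxtens_unindexK; case: mxtens_unindex.
Qed.

Lemma matD x y : mat (x + y) = mat x + mat y.
Proof. by apply/matrixP => k i; rewrite !mxE. Qed.

Lemma matZ (a : R) x : mat (a *: x) = a *: mat x.
Proof. by apply/matrixP => k i; rewrite !mxE. Qed.

Lemma matN x : mat (- x) = - mat x.
Proof. by apply/matrixP => k i; rewrite !mxE. Qed.

Lemma matB x y : mat (x - y) = mat x - mat y.
Proof. by rewrite matD matN. Qed.

Lemma sum_mxtens (F : 'I_(n * m) -> R) :
  \sum_l F l = \sum_(i < n) \sum_(k < m) F (mxtens_index (i, k)).
Proof.
rewrite pair_big /= (reindex (@mxtens_index n m)) /=; first by apply: eq_bigr => -[].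
exists (@mxtens_unindex n m) => ? _; [exact: mxtens_indexK|exact: mxtens_unindexK].
Qed.

Lemma ip_mat x y : ip (mat x) (mat y) = ip x y.
Proof.
rewrite !ipE sum_mxtens exchange_big; apply: eq_bigr => i _; apply: eq_bigr => k _.
by rewrite big_ord1 !mxE.
Qed.

Lemma nrm_mat x : nrm (mat x) = nrm x.
Proof. by rewrite /nrm ip_mat. Qed.

Lemma mat_lift (A : 'M[R]_n) x : mat (lift_mx m A *m x) = mat x *m A^T.
Proof.
apply/matrixP => k i; rewrite !mxE sum_mxtens; apply: eq_bigr => j _.
rewrite (bigD1 k)//= big1 ?addr0 => [|l lk].
  by rewrite /lift_mx tensmxE !mxE eqxx mulr1 mulrC.
by rewrite /lift_mx tensmxE !mxE eq_sym (negbTE lk) mulr0 mul0r.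
Qed.

Lemma mat_consensus (theta : 'cV[R]_m) :
  mat (consensus theta : 'cV[R]_(n * m)) = theta *m ones^T.
Proof.
apply/matrixP => k i; rewrite !mxE big_ord1 !mxE mulr1 mul1r mxtens_indexK.
by congr (theta _ _); exact: ord1.
Qed.

Lemma block_mat x i : block x i = col i (mat x).
Proof. by apply/matrixP => k o; rewrite !mxE. Qed.

End Matricization.

Definition gradF {R : realType} {n m : nat} (f : 'I_n -> 'cV[R]_m -> R)
    (X : 'M[R]_(m, n)) : 'M[R]_(m, n) :=
  \matrix_(k, i) gradient (f i) (col i X) k 0.

(** The derivative of [gradF f] at the consensus matrix [theta 1^T], in direction X. *)
Definition hessF {R : realType} {n m : nat} (f : 'I_n -> 'cV[R]_m -> R)
    (theta : 'cV[R]_m) (X : 'M[R]_(m, n)) : 'M[R]_(m, n) :=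
  \matrix_(k, i) (hessian (f i) theta *m col i X) k 0.

Section Models.
Context {R : realType} {n m : nat} (f : 'I_n -> 'cV[R]_m -> R).
Hypothesis f_C2 : forall i, C_class 2 (f i).
Implicit Types (X : 'M[R]_(m, n)) (t : 'cV[R]_m).

Let f_diff i x : differentiable (f i) x.
Proof. by have [h _] := f_C2 i. Qed.

Lemma col_gradF X (i : 'I_n) : col i (gradF f X) = gradient (f i) (col i X).
Proof. by apply/matrixP => k o; rewrite (ord1 o) mxE [LHS]mxE. Qed.

Lemma col_hessF theta X (i : 'I_n) : col i (hessF f theta X) = hessian (f i) theta *m col i X.
Proof. by apply/matrixP => k o; rewrite (ord1 o) mxE [LHS]mxE. Qed.

Lemma mul_onesE (X : 'M[R]_(m, n)) : X *m (ones : 'cV_n) = \sum_i col i X.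
Proof.
apply/matrixP => k o; rewrite mxE summxE; apply: eq_bigr => i _.
by rewrite !mxE mulr1.
Qed.

Lemma col_ones t (i : 'I_n) : col i (t *m ones^T) = t.
Proof. by apply/matrixP => k o; rewrite !mxE big_ord1 (ord1 o) !mxE mulr1. Qed.

(** A change of one coordinate moves a single block, so the other summands cancel in the difference
    quotient. *)
Lemma mat_gradient_Fc (x : 'cV[R]_(n * m)) : mat (gradient (Fc f) x) = gradF f (mat x).
Proof.
apply/matrixP => k i; rewrite mxE [LHS]mxE [RHS]mxE mxE /partial /derive.
rewrite (_ : (fun h : R => h^-1 *: ((Fc f \o shift x) (h *: basis_vec (mxtens_index (i, k))) - Fc f x))
  = (fun h : R => h^-1 *: ((f i \o shift (col i (mat x))) (h *: basis_vec k) - f i (col i (mat x)))))//.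
apply/funext => h /=; congr (_ *: _); rewrite /Fc -sumrB (bigD1 i)//= big1 ?addr0 => [|j ji].
  rewrite !block_mat; congr (f i _ - _); apply/matrixP => l o.
  rewrite !mxE (ord1 o) eqxx !andbT; congr (h * _ + _).
  by rewrite (can_eq (@mxtens_indexK n m)) xpair_eqE eqxx.
rewrite [block (_ + x) j](_ : _ = block x j) ?subrr//; apply/matrixP => l o.
by rewrite !mxE (can_eq (@mxtens_indexK n m)) xpair_eqE (negbTE ji) mulr0 add0r.
Qed.

Lemma derivable_f i x v : derivable (f i) x v.
Proof. exact: diff_derivable. Qed.

Lemma gradient_Fsum t : gradient (Fsum f) t = \sum_i gradient (f i) t.
Proof.
apply/matrixP => k o; rewrite mxE summxE /partial.
have -> : Fsum f = \sum_i f i by apply/funext => s; rewrite fct_sumE.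
rewrite derive_sum => [|i]; last exact: derivable_f.
by apply: eq_bigr => i _; rewrite mxE.
Qed.

Lemma gradient_Fsum_gradF t : gradient (Fsum f) t = gradF f (t *m ones^T) *m ones.
Proof.
rewrite gradient_Fsum mul_onesE; apply: eq_bigr => i _.
by rewrite col_gradF col_ones.
Qed.

Lemma differentiable_Fsum t : differentiable (Fsum f) t.
Proof.
have -> : Fsum f = \sum_i f i by apply/funext => s; rewrite fct_sumE.
exact: differentiable_sum.
Qed.

Lemma partial_Fsum k : partial k (Fsum f) = \sum_i partial k (f i).
Proof.
apply/funext => t; have := congr1 (fun A : 'cV[R]_m => A k 0) (gradient_Fsum t).
rewrite !mxE summxE fct_sumE => ->; by apply: eq_bigr => i _; rewrite mxE.
Qed.

Lemma hessian_Fsum t : hessian (Fsum f) t = \sum_i hessian (f i) t.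
Proof.
apply/matrixP => k l; rewrite mxE summxE partial_Fsum {1}/partial.
rewrite derive_sum => [|i]; last by apply: diff_derivable; have [_ /(_ k)[]] := f_C2 i.
by apply: eq_bigr => i _; rewrite mxE.
Qed.

Lemma hessian_Fsum_hessF theta t :
  hessian (Fsum f) theta *m t = hessF f theta (t *m ones^T) *m ones.
Proof.
rewrite hessian_Fsum mul_onesE mulmx_suml; apply: eq_bigr => i _.
by rewrite col_hessF col_ones.
Qed.

Lemma Fsum_C2 : C_class 2 (Fsum f).
Proof.
split; first exact: differentiable_Fsum.
move=> k; rewrite partial_Fsum; split.
  by move=> t; apply: differentiable_sum => i; have [_ /(_ k)[]] := f_C2 i.
move=> l; have -> : partial l (\sum_i partial k (f i)) = \sum_i partial l (partial k (f i)).
  apply/funext => t; rewrite [X in _ = X t]fct_sumE {1}/partial derive_sum// => i.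
  by apply: diff_derivable; have [_ /(_ k)[]] := f_C2 i.
apply: (big_ind (fun g : 'cV[R]_m -> R => continuous g)).
- exact: cst_continuous.
- by move=> g h gc hc t; apply: continuousD; [exact: gc|exact: hc].
by move=> i _; have [_ /(_ k)[_ /(_ l)]] := f_C2 i.
Qed.

Lemma hessFD theta X Y : hessF f theta (X + Y) = hessF f theta X + hessF f theta Y.
Proof.
apply/matrixP => k i; have -> : (hessF f theta X + hessF f theta Y) k i
  = hessF f theta X k i + hessF f theta Y k i by rewrite [LHS]mxE.
rewrite /hessF [LHS]mxE [X in _ = X + _]mxE [X in _ = _ + X]mxE.
have -> : col i (X + Y) = col i X + col i Y by apply/matrixP => a b; rewrite !mxE.
by rewrite mulmxDr [LHS]mxE.
Qed.

Lemma hessFZ theta a X : hessF f theta (a *: X) = a *: hessF f theta X.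
Proof.
apply/matrixP => k i; have -> : (a *: hessF f theta X) k i = a * hessF f theta X k i.
  by rewrite [LHS]mxE.
rewrite /hessF [LHS]mxE [X in _ = _ * X]mxE.
have -> : col i (a *: X) = a *: col i X by apply/matrixP => u v; rewrite !mxE.
by rewrite -scalemxAr [LHS]mxE.
Qed.

Lemma hessFB theta X Y : hessF f theta (X - Y) = hessF f theta X - hessF f theta Y.
Proof. by rewrite hessFD -scaleN1r hessFZ scaleN1r. Qed.

Lemma nrm_cols_le (A B : 'M[R]_(m, n)) (K : R) : 0 <= K ->
  (forall i, nrm (col i A) <= K * nrm (col i B)) -> nrm A <= K * nrm B.
Proof.
move=> K0 h; apply: le_nrm; first by rewrite mulr_ge0 ?nrm_ge0.
rewrite exprMn nrm_sq !ip_cols mulr_sumr; apply: ler_sum => i _.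
by rewrite -!nrm_sq -exprMn ler_pXn2r ?nnegrE ?mulr_ge0 ?nrm_ge0.
Qed.

Section Lipschitz.
Variables (L : 'I_n -> R) (LF : R).
Hypotheses (m_gt0 : (0 < m)%N) (f_lip : forall i, lipschitz2 (L i) (gradient (f i)))
  (F_lip : lipschitz2 LF (gradient (Fsum f))).

(** For [m = 0] every K, even a negative one, would be a Lipschitz constant; a basis vector rules
    this out. *)
Lemma lipschitz2_ge0 (K : R) (g : 'cV[R]_m -> 'cV[R]_m) : lipschitz2 K g -> 0 <= K.
Proof.
move=> gK; have := gK (basis_vec (Ordinal m_gt0)) 0.
by rewrite subr0 !norm2E nrm_basis mulr1; apply: le_trans; exact: nrm_ge0.
Qed.

Lemma L_le_sup i : L i <= sup (range L).
Proof.
apply: ub_le_sup; last by exists i.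
exists (\sum_j `|L j|) => _ [j _ <-]; rewrite (bigD1 j)//= (le_trans (ler_norm _))//.
by rewrite lerDl sumr_ge0.
Qed.

Lemma sup_L_ge0 : 0 <= sup (range L).
Proof.
have [[i _]|no] := pselect (exists i : 'I_n, True).
  by apply: le_trans (L_le_sup i); exact: lipschitz2_ge0 (f_lip i).
suff -> : range L = set0 by rewrite sup0.
by apply/seteqP; split => // x [i _ _]; case: no; exists i.
Qed.

Lemma gradF_lip X X' : nrm (gradF f X - gradF f X') <= sup (range L) * nrm (X - X').
Proof.
apply: nrm_cols_le; first exact: sup_L_ge0.
move=> i; rewrite !linearB/= !col_gradF.
have := f_lip i (col i X) (col i X'); rewrite !norm2E => h; apply: le_trans h _.
by rewrite ler_wpM2r ?nrm_ge0 ?L_le_sup.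
Qed.

Lemma gradF_model : descent_model (sup (range L)) LF (gradF f) (Fsum f).
Proof.
split=> [X X'|t d]; first exact: gradF_lip.
rewrite -gradient_Fsum_gradF; apply: lipschitz_gradient_descent => //.
exact: differentiable_Fsum.
Qed.

(** Lipschitz constants of gradients bound the Hessians, so the quadratic model at [theta] obeys the
    same constants and the same step-size conditions apply. *)
Lemma hessF_model theta : descent_model (sup (range L)) LF (hessF f theta)
  (fun t => 1 / 2 * ip t (hessian (Fsum f) theta *m t)).
Proof.
split=> [X X'|t d].
  rewrite -hessFB; apply: nrm_cols_le; first exact: sup_L_ge0.
  move=> i; rewrite col_hessF; apply: le_trans (hessian_bound _ _ (f_C2 i) (f_lip i)) _.
  by rewrite ler_wpM2r ?nrm_ge0 ?L_le_sup.
rewrite -hessian_Fsum_hessF; set H := hessian _ _.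
have Hs : H^T = H by apply: hessian_sym; exact: Fsum_C2.
have hd : ip d (H *m d) <= LF * nrm d ^+ 2.
  apply: le_trans (ler_ip _ _) _; rewrite expr2 mulrCA ler_wpM2l ?nrm_ge0//.
  exact: hessian_bound Fsum_C2 F_lip.
rewrite mulmxDr ipDl !ipDr [ip d (H *m t)]ipC.
have -> : ip t (H *m d) = ip (H *m t) d by rewrite [RHS]ip_mull Hs.
by move: hd; lra.
Qed.

End Lipschitz.
End Models.

(** * Linear maps and quadratic forms *)

Definition linmap {R : realType} {k p q : nat} (T : 'cV[R]_k -> 'M[R]_(p, q)) : Prop :=
  forall (a : R) u v, T (a *: u + v) = a *: T u + T v.

Section LinearMaps.
Context {R : realType} {k p q : nat}.
Implicit Types (T : 'cV[R]_k -> 'M[R]_(p, q)).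

Lemma linmap_sum T : linmap T -> forall u, T u = \sum_j u j 0 *: T (basis_vec j).
Proof.
move=> TL u; have T0 : T 0 = 0.
  by have := TL (-1) 0 0; rewrite scaler0 addr0 scaleN1r addNr.
have {1}-> : u = \sum_j u j 0 *: basis_vec j :> 'cV[R]_k.
  by rewrite [LHS]matrix_sum_delta; apply: eq_bigr => j _; rewrite big_ord1.
elim: (index_enum _) => [|j s ih]; first by rewrite !big_nil.
by rewrite !big_cons TL ih.
Qed.

Lemma linmap_bounded T : linmap T ->
  exists2 K : R, 0 <= K & forall u, nrm (T u) <= K * nrm u.
Proof.
move=> TL; exists (\sum_j nrm (T (basis_vec j))); first by rewrite sumr_ge0// => j _; exact: nrm_ge0.
move=> u; rewrite (linmap_sum TL) mulr_suml; apply: le_trans (nrm_sum _ _ _) _.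
apply: ler_sum => j _; rewrite nrmZ mulrC; apply: ler_wpM2l; first exact: nrm_ge0.
exact: norm_entry_nrm.
Qed.

Lemma linmap_mulr {s : nat} T (N : 'M[R]_(q, s)) : linmap T -> linmap (fun u => T u *m N).
Proof. by move=> TL a u v; rewrite TL mulmxDl scalemxAl. Qed.

Lemma linmap_mull {s : nat} T (N : 'M[R]_(s, p)) : linmap T -> linmap (fun u => N *m T u).
Proof. by move=> TL a u v; rewrite TL mulmxDr scalemxAr. Qed.

Lemma linmapB_eq T : linmap T -> forall u v, T (u - v) = T u - T v.
Proof. by move=> TL u v; rewrite addrC -scaleN1r TL scaleN1r addrC. Qed.

End LinearMaps.

Definition quadratic {R : realType} {k : nat} (V : 'cV[R]_k -> R) : Prop :=
  exists Q : 'M[R]_k, forall u, V u = ip u (Q *m u).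

Section QuadraticForms.
Context {R : realType} {k : nat}.
Implicit Types (V : 'cV[R]_k -> R).

Lemma quadraticD V W : quadratic V -> quadratic W -> quadratic (fun u => V u + W u).
Proof. by move=> [Q QV] [P PW]; exists (Q + P) => u; rewrite mulmxDl ipDr QV PW. Qed.

Lemma quadraticZ (a : R) V : quadratic V -> quadratic (fun u => a * V u).
Proof. by move=> [Q QV]; exists (a *: Q) => u; rewrite -scalemxAl ipZr QV. Qed.

Lemma ip_sumlr {p q : nat} (F F' : 'I_k -> 'M[R]_(p, q)) :
  ip (\sum_i F i) (\sum_j F' j) = \sum_i \sum_j ip (F i) (F' j).
Proof.
rewrite (big_morph (fun A => ip A (\sum_j F' j)) (id1 := 0) (op1 := +%R))//; last 2 first.
- by move=> A B; rewrite ipDl.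
- by rewrite ip0l.
apply: eq_bigr => i _.
rewrite (big_morph (fun A => ip (F i) A) (id1 := 0) (op1 := +%R))//.
- by move=> A B; rewrite ipDr.
- by rewrite ip0r.
Qed.

Lemma quadratic_ip {p q : nat} (T T' : 'cV[R]_k -> 'M[R]_(p, q)) :
  linmap T -> linmap T' -> quadratic (fun u => ip (T u) (T' u)).
Proof.
move=> TL TL'; exists (\matrix_(i, j) ip (T (basis_vec i)) (T' (basis_vec j))) => u.
rewrite (linmap_sum TL) (linmap_sum TL') ip_sumlr ipE; apply: eq_bigr => i _.
rewrite big_ord1 mxE mulr_sumr; apply: eq_bigr => j _.
by rewrite ipZl ipZr mxE; ring.
Qed.

Lemma quadratic_perturbation (Q : 'M[R]_k) (a e : 'cV[R]_k) :
  ip a (Q *m a) - (2 * nrm Q * nrm a * nrm e + nrm Q * nrm e ^+ 2)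
    <= ip (a + e) (Q *m (a + e)).
Proof.
rewrite mulmxDr ipDl !ipDr.
have b (x y : 'cV[R]_k) : - ip x (Q *m y) <= nrm x * (nrm Q * nrm y).
  apply: le_trans (ler_norm _) _; rewrite normrN; apply: le_trans (ler_norm_ip _ _) _.
  by rewrite ler_wpM2l ?nrm_ge0 ?nrmM.
have := b a e; have := b e a; have := b e e; lra.
Qed.

End QuadraticForms.

(** * States and one step of the dynamics *)

Section State.
Context {R : realType} {n m : nat}.
Implicit Types (u v : 'cV[R]_(n * m + n * m)).

Definition stX u : 'M[R]_(m, n) := mat (usubmx u).
Definition stH u : 'M[R]_(m, n) := mat (dsubmx u).
Definition stY (G : 'M[R]_(m, n) -> 'M[R]_(m, n)) u := stH u + G (stX u).
Definition state (X H : 'M[R]_(m, n)) := col_mx (unmat X) (unmat H).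

Lemma stX_state X H : stX (state X H) = X.
Proof. by rewrite /stX col_mxKu unmatK. Qed.

Lemma stH_state X H : stH (state X H) = H.
Proof. by rewrite /stH col_mxKd unmatK. Qed.

Lemma stateK u : state (stX u) (stH u) = u.
Proof. by rewrite /state /stX /stH !matK vsubmxK. Qed.

Lemma nrm_stateE u : nrm u ^+ 2 = nrm (stX u) ^+ 2 + nrm (stH u) ^+ 2.
Proof.
rewrite !nrm_sq !ip_mat -{1 2}(vsubmxK u) /ip tr_col_mx mul_col_row.
by rewrite mxtrace_block.
Qed.

Lemma linmap_stX : linmap stX.
Proof. by move=> a u v; rewrite /stX linearP/= matD matZ. Qed.

Lemma linmap_stH : linmap stH.
Proof. by move=> a u v; rewrite /stH linearP/= matD matZ. Qed.

Lemma nrm_stX u : nrm (stX u) <= nrm u.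
Proof.
by apply: le_nrm; [exact: nrm_ge0|rewrite nrm_stateE -nrm_sq lerDl sqr_ge0].
Qed.

Lemma nrm_stH u : nrm (stH u) <= nrm u.
Proof.
by apply: le_nrm; [exact: nrm_ge0|rewrite nrm_stateE -nrm_sq lerDr sqr_ge0].
Qed.

Lemma nrm_state_le u : nrm u <= nrm (stX u) + nrm (stH u).
Proof.
apply: le_nrm; first by rewrite addr_ge0 ?nrm_ge0.
rewrite -nrm_sq nrm_stateE sqrrD addrAC lerDl.
by rewrite mulrn_wge0// mulr_ge0 ?nrm_ge0.
Qed.

(** With [G = gradF f] this is the algorithm ([dogt_stepE]), with [G = hessF f theta] its
    linearization at a saddle. *)
Definition genstep (Rw Cw : 'M[R]_n) (alpha : R) (G : 'M[R]_(m, n) -> 'M[R]_(m, n)) u :=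
  state (stepX Rw alpha (stX u) (stY G u))
    (stH u *m Cw^T + G (stX u) *m (Cw^T - 1%:M)).

Lemma dogt_stepE (f : 'I_n -> 'cV[R]_m -> R) (Rw Cw : 'M[R]_n) (alpha : R) u :
  dogt_step f Rw Cw alpha u = genstep Rw Cw alpha (gradF f) u.
Proof.
rewrite -[LHS]stateK /genstep; congr state.
  by rewrite /stX col_mxKu matB mat_lift matZ matD mat_gradient_Fc.
rewrite /stH col_mxKd matD mat_lift -mat_gradient_Fc; congr (_ + _).
rewrite mulmxBl mul1mx matB mat_lift.
by rewrite mulmxBr mulmx1.
Qed.

Lemma stX_genstep Rw Cw alpha G u :
  stX (genstep Rw Cw alpha G u) = stepX Rw alpha (stX u) (stY G u).
Proof. exact: stX_state. Qed.

Lemma stH_genstep Rw Cw alpha G u :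
  stH (genstep Rw Cw alpha G u) = stH u *m Cw^T + G (stX u) *m (Cw^T - 1%:M).
Proof. exact: stH_state. Qed.

Lemma stY_genstep Rw Cw alpha G u :
  stY G (genstep Rw Cw alpha G u) = stepY Rw Cw alpha G (stX u) (stY G u).
Proof.
rewrite /stY stH_state stX_genstep /stepY -/(stY G u) /stY mulmxDl mulmxBr mulmx1.
by rewrite -!addrA; congr (_ + (_ + _)); rewrite addrC.
Qed.

#[global] Opaque genstep.

(** The trackers then sum to the local gradients ([stY_balanced]). It is the invariant form of
    membership in the initialization space ([balancedP]). *)
Definition balanced u : Prop := stH u *m (ones : 'cV[R]_n) = 0.

Lemma balancedB u v : balanced u -> balanced v -> balanced (u - v).
Proof. by rewrite /balanced (linmapB_eq linmap_stH) mulmxBl => -> ->; rewrite subrr. Qed.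

End State.

Section Dynamics.
Context {R : realType} {n m : nat} {Rw Cw : 'M[R]_n} {r c : 'cV[R]_n}.
Context {Lc LF eps_x eps_y eps kappa alpha : R}.
Hypothesis mix : mixing Rw Cw r c.
Hypothesis step : step_size Rw Cw r c Lc LF eps_x eps_y eps kappa alpha.
Hypotheses (alpha_gt0 : 0 < alpha) (Lc_ge0 : 0 <= Lc) (LF_ge0 : 0 <= LF).
Implicit Types (u v : 'cV[R]_(n * m + n * m)) (G : 'M[R]_(m, n) -> 'M[R]_(m, n)).

Let gstep G := genstep Rw Cw alpha G.

Definition stgap (G : 'M[R]_(m, n) -> 'M[R]_(m, n)) u : R := gap r c (stX u) (stY G u).

Definition stlyap (G : 'M[R]_(m, n) -> 'M[R]_(m, n)) (Phi : 'cV[R]_m -> R) u : R :=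
  lyap r c kappa Phi (stX u) (stY G u).

Lemma balanced_genstep G u : balanced u -> balanced (gstep G u).
Proof.
rewrite /balanced /gstep stH_genstep mulmxDl -!mulmxA mulmxBl mul1mx (mix_CT1 mix) subrr.
by rewrite mulmx0 addr0.
Qed.

Lemma stY_balanced G u : balanced u -> stY G u *m ones = G (stX u) *m (ones : 'cV_n).
Proof. by move=> Su; rewrite /stY mulmxDl Su add0r. Qed.

Lemma gap_ge0 (X Y : 'M[R]_(m, n)) : 0 <= gap r c X Y.
Proof. by rewrite /gap !addr_ge0 ?sqr_ge0. Qed.

Lemma resR_le_gap (X Y : 'M[R]_(m, n)) : resR r X <= gap r c X Y.
Proof. by rewrite /gap -addrA lerDl addr_ge0 ?sqr_ge0. Qed.

Lemma resC_le_gap (X Y : 'M[R]_(m, n)) : resC c Y <= gap r c X Y.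
Proof. by rewrite /gap addrAC lerDr addr_ge0 ?sqr_ge0. Qed.

Lemma mean_le_gap (X Y : 'M[R]_(m, n)) : nrm (Y *m ones : 'cV_m) ^+ 2 <= gap r c X Y.
Proof. by rewrite /gap lerDr addr_ge0 ?sqr_ge0. Qed.

Lemma nrm_Y_gap (X Y : 'M[R]_(m, n)) : nrm Y ^+ 2 <= 2 * (1 + K2C c ^+ 2) * gap r c X Y.
Proof.
rewrite {1}(@perpC_split _ _ _ c Y).
apply: le_trans (nrm_young _ _ ltr01) _; rewrite invr1.
have h1 : nrm (Y *m ones *m c^T) ^+ 2 <= gap r c X Y.
  apply: le_trans (mean_le_gap X Y).
  by rewrite ler_pXn2r ?nnegrE ?nrm_ge0//; exact: nrm_ycT mix _.
have h2 : nrm (Y *m perpC c) ^+ 2 <= K2C c ^+ 2 * gap r c X Y.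
  apply: le_trans (nrm_perpC_le mix Y) _; apply: ler_wpM2l; first exact: sqr_ge0.
  exact: resC_le_gap.
by move: h1 h2; lra.
Qed.

(** Both halves of the move vanish with the gap: that of X by [nrm_stepX_move], while H moves by
    exactly [Y (C^T - I)]. *)
Lemma genstep_move : exists2 K : R, 0 <= K &
  forall G u, nrm (gstep G u - u) ^+ 2 <= K * stgap G u.
Proof.
pose K1 := 9 / 8 * 4 * K2R r ^+ 2 + 12 * alpha ^+ 2 * K2C c ^+ 2 + 36 * alpha ^+ 2.
pose K3 := nrm (Cw^T - 1%:M) ^+ 2 * (2 * (1 + K2C c ^+ 2)).
have K10 : 0 <= K1 by rewrite /K1; nonneg.
have K30 : 0 <= K3 by rewrite /K3; nonneg.
exists (K1 + K3); first by rewrite addr_ge0.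
move=> G u; rewrite nrm_stateE (linmapB_eq linmap_stX) (linmapB_eq linmap_stH) mulrDl.
apply: lerD.
  rewrite /gstep stX_genstep; apply: le_trans (nrm_stepX_move mix step alpha_gt0 _ _) _.
  rewrite /stgap; set X := stX u; set Y := stY G u.
  have g0 := gap_ge0 X Y; rewrite /K1 [leRHS]mulrDl [X in _ <= X + _]mulrDl; apply: lerD; first apply: lerD.
  - by apply: ler_wpM2l; [nonneg|exact: resR_le_gap].
  - by apply: ler_wpM2l; [nonneg|exact: resC_le_gap].
  - by apply: ler_wpM2l; [nonneg|exact: mean_le_gap].
rewrite /gstep stH_genstep.
have -> : stH u *m Cw^T + G (stX u) *m (Cw^T - 1%:M) - stH u = stY G u *m (Cw^T - 1%:M).
  by rewrite /stY mulmxDl [stH u *m (_ - _)]mulmxBr mulmx1 addrAC.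
apply: (@le_trans _ _ ((nrm (stY G u) * nrm (Cw^T - 1%:M)) ^+ 2)).
  by rewrite ler_pXn2r ?nnegrE ?mulr_ge0 ?nrm_ge0 ?nrmM.
rewrite exprMn mulrC /K3 -[leRHS]mulrA; apply: ler_wpM2l; first exact: sqr_ge0.
exact: nrm_Y_gap.
Qed.

Lemma stlyap_descent : exists2 c0 : R, 0 < c0 &
  forall G Phi u, descent_model Lc LF G Phi -> balanced u ->
  stlyap G Phi (gstep G u) <= stlyap G Phi u - c0 * stgap G u.
Proof.
have [c0 c00 h] := @lyap_descent R n m _ _ _ _ _ _ _ _ _ _ _ mix step alpha_gt0 Lc_ge0 LF_ge0.
exists c0 => // G Phi u GP Su; rewrite /stlyap /gstep stX_genstep stY_genstep.
by apply: h GP _; exact: stY_balanced.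
Qed.

Lemma mean_gradient_gap : exists2 K : R, 0 <= K &
  forall G u, (forall X X', nrm (G X - G X') <= Lc * nrm (X - X')) -> balanced u ->
  nrm (G (stX u *m r *m ones^T) *m (ones : 'cV_n)) ^+ 2 <= K * stgap G u.
Proof.
pose K1 := n%:R * Lc ^+ 2 * K2R r ^+ 2; have K10 : 0 <= K1 by rewrite !mulr_ge0 ?sqr_ge0.
exists (2 * K1 + 2); first by rewrite addr_ge0 ?mulr_ge0.
move=> G u GL Su; have h1 := mean_gradient_error mix Lc_ge0 GL (stY_balanced G Su).
rewrite -/K1 in h1.
have h2 : K1 * resR r (stX u) <= K1 * stgap G u by apply: ler_wpM2l => //; exact: resR_le_gap.
have h3 : nrm (stY G u *m ones : 'cV_m) ^+ 2 <= stgap G u by exact: mean_le_gap.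
set g := G _ *m _ in h1 *.
rewrite -[g](subrK (stY G u *m ones)); apply: le_trans (nrm_young _ _ ltr01) _.
rewrite invr1; move: h1 h2 h3; lra.
Qed.

End Dynamics.

(** * Instability of strict saddles *)

Section Instability.
Context {R : realType} {n m : nat} {Rw Cw : 'M[R]_n} {r c : 'cV[R]_n}.
Context {LF eps_x eps_y eps kappa alpha : R} {f : 'I_n -> 'cV[R]_m -> R} {L : 'I_n -> R}.
Hypothesis mix : mixing Rw Cw r c.
Hypothesis step : step_size Rw Cw r c (sup (range L)) LF eps_x eps_y eps kappa alpha.
Hypotheses (alpha_gt0 : 0 < alpha) (m_gt0 : (0 < m)%N).
Hypothesis f_C2 : forall i, C_class 2 (f i).
Hypotheses (f_lip : forall i, lipschitz2 (L i) (gradient (f i)))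
  (F_lip : lipschitz2 LF (gradient (Fsum f))).
Variable theta : 'cV[R]_m.
Implicit Types (u v : 'cV[R]_(n * m + n * m)).

Let G := hessF f theta.
Let H := hessian (Fsum f) theta.
Let Lam := genstep Rw Cw alpha G.
Let Lc_ge0 : 0 <= sup (range L) := sup_L_ge0 m_gt0 f_lip.
Let LF_ge0 : 0 <= LF := lipschitz2_ge0 m_gt0 F_lip.

Lemma linmap_stY_hessF : linmap (stY G).
Proof.
move=> a u v; rewrite /stY linmap_stX linmap_stH /G hessFD hessFZ scalerDr.
by rewrite addrACA.
Qed.

Lemma linmap_genstep_hessF : linmap Lam.
Proof.
move=> a u v; rewrite -[LHS]stateK -[RHS]stateK; congr state.
  rewrite linmap_stX !stX_genstep /stepX linmap_stX linmap_stY_hessF mulmxDl -scalemxAl.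
  by rewrite scalerDr scalerBr !scalerA [alpha * a]mulrC opprD addrACA.
rewrite linmap_stH !stH_genstep linmap_stX linmap_stH /G hessFD hessFZ !mulmxDl.
by rewrite scalerDr -!scalemxAl addrACA.
Qed.

Definition quadlyap u : R :=
  stlyap (r := r) (c := c) (kappa := kappa) G (fun t => 1 / 2 * ip t (H *m t)) u.

Lemma quadratic_quadlyap : quadratic quadlyap.
Proof.
have lX := linmap_stX; have lY := linmap_stY_hessF.
rewrite /quadlyap /stlyap /lyap /resR /resC.
apply: quadraticD; first apply: quadraticD.
- by apply: quadraticZ; apply: quadratic_ip; [|apply: linmap_mull]; apply: linmap_mulr.
- have [Q hQ] : quadratic (fun u => ip (stX u *m perpR r *m dsqrt r) (stX u *m perpR r *m dsqrt r)).
    by apply: quadratic_ip; do 2!apply: linmap_mulr.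
  by exists Q => u; rewrite nrm_sq hQ.
have [Q hQ] : quadratic (fun u => ip (stY G u *m perpC c *m rdiag c) (stY G u *m perpC c *m rdiag c)).
  by apply: quadratic_ip; do 2!apply: linmap_mulr.
by exists (kappa *: Q) => u; rewrite nrm_sq hQ -scalemxAl ipZr.
Qed.

(** The error terms belong to the gap. The Hessian form is bounded by [|H t|^2] ([sym_form_bound]),
    and [H t] is the gradient of the model at the mean, which the gap controls. *)
Lemma quadlyap_gap : exists2 K : R, 0 <= K &
  forall u, balanced u -> `|quadlyap u| <= K * stgap (r := r) (c := c) G u.
Proof.
have ka0 := ss_kappa_gt0 step.
have [K K0 hK] := mean_gradient_gap (m := m) mix Lc_ge0.
have Hs : H^T = H by apply: hessian_sym; exact: Fsum_C2.
have [C C0 hC] := sym_form_bound Hs.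
have CK0 : 0 <= C * K by rewrite mulr_ge0.
exists (C * K + 1 + kappa); first by rewrite !addr_ge0 ?mulr_ge0// ltW.
move=> u Su; set t := stX u *m r.
have h1 : `|ip t (H *m t)| <= C * K * stgap (r := r) (c := c) G u.
  apply: le_trans (hC t) _; rewrite -mulrA; apply: ler_wpM2l => //.
  rewrite /H (hessian_Fsum_hessF f_C2); apply: hK => //.
  exact: model_lip (hessF_model f_C2 m_gt0 f_lip F_lip theta).
have h2 := resR_le_gap (r := r) (c := c) (stX u) (stY G u).
have h3 := resC_le_gap (r := r) (c := c) (stX u) (stY G u).
have g0 := gap_ge0 (r := r) (c := c) (stX u) (stY G u).
have a0 : 0 <= resR r (stX u) by exact: sqr_ge0.
have b0 : 0 <= resC c (stY G u) by exact: sqr_ge0.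
rewrite /quadlyap /stlyap /lyap -/t.
apply: le_trans (ler_normD _ _) _; rewrite mulrDl mulrDl (mul1r (stgap _ _)); apply: lerD; last first.
  rewrite normrM !ger0_norm ?(ltW ka0)//; apply: ler_wpM2l; [exact: ltW|exact: h3].
apply: le_trans (ler_normD _ _) _; apply: lerD; last by rewrite (ger0_norm a0); exact: h2.
apply: le_trans h1; rewrite normrM ger0_norm; last by nonneg.
by rewrite ler_piMl//; lra.
Qed.

(* Move along the consensus subspace, with [h] such that [Y] is [H v c^T], which has no tracking error. *)
Lemma quadlyap_negative : (exists w : 'cV[R]_m, ip w (H *m w) < 0) ->
  exists2 u, balanced u & quadlyap u < 0.
Proof.
move=> [v v0]; pose X : 'M[R]_(m, n) := v *m ones^T; pose Y : 'M[R]_(m, n) := H *m v *m c^T.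
exists (state X (Y - G X)).
  rewrite /balanced stH_state mulmxBl /X /Y -(mulmxA _ c^T) (mix_c1 mix) mulmx1.
  by rewrite /H (hessian_Fsum_hessF f_C2) subrr.
rewrite /quadlyap /stlyap /stY stX_state stH_state subrK /lyap /resR /resC.
rewrite /X /Y -(mulmxA v) -(mulmxA v) -(mulmxA _ c^T) (mix_1r mix) (ones_perpR mix) (c_perpC mix).
by rewrite !mulmx0 !mul0mx nrm0 mulmx1 expr0n mulr0 !addr0; lra.
Qed.

(* The descent of the quadratic Lyapunov function [q] along the linearized step gives an
   increase of [- q - e |.|^2] by a factor [mu > 1]: the centre directions, in which
   the gap vanishes, are handled by the second term. *)
Lemma expanding_form : (exists w : 'cV[R]_m, ip w (H *m w) < 0) ->
  exists (Q : 'M[R]_(n * m + n * m)) (mu cc : R),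
  [/\ 1 < mu, 0 < cc, exists2 u, balanced u & 0 < ip u (Q *m u)
    & forall u, balanced u ->
      mu * ip u (Q *m u) + cc * nrm u ^+ 2 <= ip (Lam u) (Q *m Lam u)].
Proof.
move=> /quadlyap_negative[u0 Su0 qu0].
have [c0 c00 hd] := stlyap_descent (m := m) mix step alpha_gt0 Lc_ge0 LF_ge0.
have [C1 C10 hq] := quadlyap_gap.
have [C2 C20 hm] := genstep_move (m := m) mix step alpha_gt0.
(* Half of the descent [c0] pays for the growth rate: [d |q|] is at most [c0 / 2] times the gap. *)
pose d := c0 / (2 * (C1 + 1)).
have d0 : 0 < d by rewrite divr_gt0// mulr_gt0// ltr_wpDl.
have dC : d * C1 <= c0 / 2.
  have -> : c0 / 2 = d * (C1 + 1) by rewrite /d; field; rewrite gt_eqF// ltr_wpDl.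
  by apply: ler_wpM2l; [exact: ltW|rewrite lerDl].
pose K := (1 + 2 / d) * C2 + 1.
have K0 : 0 < K by rewrite ltr_wpDl// mulr_ge0// addr_ge0// divr_ge0// ltW.
pose p0 := nrm u0 ^+ 2 + 1; have p00 : 0 < p0 by rewrite ltr_wpDl ?sqr_ge0.
(* The first bound lets the other half of the descent absorb the growth of the squared norm; the
   second keeps the form positive at [u0]. *)
pose e := Num.min (c0 / 2 / K) (- quadlyap u0 / p0).
have e0 : 0 < e by rewrite lt_min !divr_gt0// oppr_gt0.
have eK : e * K <= c0 / 2 by rewrite -ler_pdivlMr// /e ge_min lexx.
have ep : e * nrm u0 ^+ 2 < - quadlyap u0.
  apply: (@lt_le_trans _ _ (e * p0)); first by rewrite ltr_pM2l// ltrDl.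
  by rewrite -ler_pdivlMr// /e ge_min lexx orbT.
have [Q hQ] : quadratic (fun u => - 1 * quadlyap u + - e * ip u u).
  apply: quadraticD; apply: quadraticZ; first exact: quadratic_quadlyap.
  by apply: (@quadratic_ip _ _ _ _ id id).
(* Young's weight [d / 2] uses only half of the rate; the other half remains as the surplus that
   will absorb the nonlinear remainder. *)
exists Q, (1 + d), (e * (d / 2)); split.
- by rewrite ltrDl.
- by rewrite mulr_gt0// divr_gt0.
- by exists u0 => //; rewrite -hQ -nrm_sq; move: ep; lra.
move=> u Su; rewrite -!hQ -!nrm_sq.
have h1 := hd _ _ u (hessF_model f_C2 m_gt0 f_lip F_lip theta) Su.
rewrite -/H -/G -/(quadlyap u) -/Lam -/(quadlyap (Lam u)) in h1.
have h2 := hq u Su; have h3 := hm G u; rewrite -/Lam in h3.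
have h4 : nrm (Lam u) ^+ 2 <= (1 + d / 2) * nrm u ^+ 2 + (1 + 2 / d) * nrm (Lam u - u) ^+ 2.
  rewrite -{1}(subrKC u (Lam u)); apply: le_trans (nrm_young _ _ (_ : 0 < d / 2)) _; first by rewrite divr_gt0.
  by rewrite invf_div.
have g0 : 0 <= stgap (r := r) (c := c) G u by exact: gap_ge0.
move: h1 h2 h3 h4 g0; set g := stgap _ _; set pu := nrm u ^+ 2; set pl := nrm (Lam u) ^+ 2.
set pd := nrm (Lam u - u) ^+ 2; set q := quadlyap u; set ql := quadlyap (Lam u).
move=> h1 h2 h3 h4 g0.
have h5 : - (d * q) <= d * C1 * g.
  rewrite -mulrN -mulrA; apply: ler_wpM2l; first exact: ltW.
  by apply: le_trans h2; rewrite -normrN; exact: ler_norm.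
have h6 : d * C1 * g <= c0 / 2 * g by apply: ler_wpM2r.
have h7 : e * pl <= e * ((1 + d / 2) * pu + (K - 1) * g).
  apply: ler_wpM2l; first exact: ltW.
  apply: le_trans h4 _; rewrite lerD2l /K addrK -mulrA; apply: ler_wpM2l => //.
  by rewrite addr_ge0// divr_ge0// ltW.
have h8 : e * K * g <= c0 / 2 * g by apply: ler_wpM2r.
have h9 : 0 <= e * g by rewrite mulr_ge0// ltW.
move: h1 h5 h6 h7 h8 h9; lra.
Qed.

End Instability.

(** * Orbits trapped near a point *)

Section Iterates.
Context {R : realType} {k : nat}.
Implicit Types (g : 'cV[R]_k -> 'cV[R]_k) (u v : 'cV[R]_k).

Lemma iter_lipschitz g (K : R) : 0 <= K -> (forall u v, nrm (g u - g v) <= K * nrm (u - v)) ->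
  forall j u v, nrm (iter j g u - iter j g v) <= K ^+ j * nrm (u - v).
Proof.
move=> K0 gK; elim=> [|j ih] u v /=; first by rewrite expr0 mul1r.
apply: le_trans (gK _ _) _; rewrite exprS -mulrA; exact: ler_wpM2l.
Qed.

Lemma iter_expanding g (K : R) : 0 <= K -> (forall u v, nrm (u - v) <= K * nrm (g u - g v)) ->
  forall j u v, nrm (u - v) <= K ^+ j * nrm (iter j g u - iter j g v).
Proof.
move=> K0 gK; elim=> [|j ih] u v /=; first by rewrite expr0 mul1r.
apply: le_trans (ih u v) _; rewrite exprSr -mulrA; apply: ler_wpM2l => //.
exact: exprn_ge0.
Qed.

Lemma closed_nrm_preimage g (K : R) (q : 'cV[R]_k) (s : R) : 0 <= K ->
  (forall u v, nrm (g u - g v) <= K * nrm (u - v)) -> closed [set u | nrm (g u - q) <= s].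
Proof.
move=> K0 gK; rewrite -openC openE => u /= /negP; rewrite -ltNge => us.
have K1 : 0 < K + 1 by rewrite ltr_wpDl.
apply/near_nrmP; exists ((nrm (g u - q) - s) / (K + 1)).
  by rewrite divr_gt0 ?subr_gt0// ltr_wpDl.
move=> v; rewrite ltr_pdivlMr// => vu /=; apply/negP; rewrite -ltNge.
have h1 := nrmD_sub (g u) (g v) q; have h2 := gK u v.
have h3 := nrm_ge0 (v - u); rewrite (nrmB u v) in h2; move: vu; lra.
Qed.

(* The form grows geometrically along a pair of trapped orbits on which it is positive. *)
Lemma trapped_form_le0 g (Q : 'M[R]_k) (mu rho : R) (S : set 'cV[R]_k) (us : 'cV[R]_k) :
  1 < mu -> (forall u, S u -> S (g u)) ->
  (forall u v, S u -> S v -> nrm (u - us) < rho -> nrm (v - us) < rho ->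
     mu * ip (u - v) (Q *m (u - v)) <= ip (g u - g v) (Q *m (g u - g v))) ->
  forall u v, S u -> S v -> (forall j, nrm (iter j g u - us) < rho) ->
    (forall j, nrm (iter j g v - us) < rho) -> ip (u - v) (Q *m (u - v)) <= 0.
Proof.
move=> mu1 Sg gQ u v Su Sv ub vb; rewrite leNgt; apply/negP => q0.
have Si w : S w -> forall j, S (iter j g w) by move=> Sw; elim=> //= j; exact: Sg.
have grow j : mu ^+ j * ip (u - v) (Q *m (u - v))
    <= ip (iter j g u - iter j g v) (Q *m (iter j g u - iter j g v)).
  elim: j => [|j ih] /=; first by rewrite expr0 mul1r.
  apply: le_trans (gQ _ _ (Si _ Su j) (Si _ Sv j) (ub j) (vb j)).
  by rewrite exprS -mulrA ler_pM2l// (lt_trans ltr01).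
pose B := nrm Q * (2 * rho) ^+ 2.
have bound j : ip (iter j g u - iter j g v) (Q *m (iter j g u - iter j g v)) <= B.
  apply: le_trans (ler_ip _ _) _; set D := _ - _.
  have hD : nrm D <= 2 * rho.
    apply: le_trans (nrmD_sub _ us _) _; rewrite [nrm (us - _)]nrmB.
    by have := ub j; have := vb j; lra.
  apply: (@le_trans _ _ (nrm Q * nrm D ^+ 2)).
    by rewrite expr2 mulrCA; apply: ler_wpM2l; [exact: nrm_ge0|exact: nrmM].
  apply: ler_wpM2l; first exact: nrm_ge0.
  by rewrite ler_pXn2r ?nnegrE ?nrm_ge0// (le_trans (nrm_ge0 D)).
pose a := B / ip (u - v) (Q *m (u - v)) / (mu - 1).
have mu0 : 0 < mu - 1 by rewrite subr_gt0.
have B0 : 0 <= B by rewrite mulr_ge0 ?nrm_ge0 ?sqr_ge0.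
have a0 : 0 <= a by rewrite /a; apply: divr_ge0; [apply: divr_ge0 => //|]; exact: ltW.
pose j := Num.bound a; have ja : a < j%:R by exact: archi_boundP.
have mj : 1 + j%:R * (mu - 1) <= mu ^+ j.
  elim: (j) => [|i ih]; first by rewrite mul0r addr0 expr0.
  rewrite exprS -natr1; apply: (@le_trans _ _ (mu * (1 + i%:R * (mu - 1)))); last first.
    by rewrite ler_pM2l// (lt_trans ltr01).
  have : 0 <= i%:R * (mu - 1) * (mu - 1) by rewrite !mulr_ge0// ltW.
  by lra.
have h1 := le_trans (grow j) (bound j).
have : B < mu ^+ j * ip (u - v) (Q *m (u - v)).
  rewrite -ltr_pdivrMr//; apply: lt_le_trans mj.
  by rewrite ltr_pdivrMr// in ja; apply: lt_le_trans ja _; rewrite lerDr.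
by rewrite ltNge h1.
Qed.

End Iterates.

Section Perturbation.
Context {R : realType} {k : nat}.

(** The surplus [cc |D|^2] absorbs a linearization error of size [e |D|]; with [e <= 1] the square
    of the error is of first order in [e] too. *)
Lemma expansion_perturbation (Q : 'M[R]_k) (mu cc K : R) : 0 < cc -> 0 <= K ->
  exists2 e : R, 0 < e & forall (D a d : 'cV[R]_k),
    nrm a <= K * nrm D -> nrm d <= e * nrm D ->
    mu * ip D (Q *m D) + cc * nrm D ^+ 2 <= ip a (Q *m a) ->
    mu * ip D (Q *m D) <= ip (a + d) (Q *m (a + d)).
Proof.
move=> cc0 K0; pose B := 2 * nrm Q * K + nrm Q + 1.
have B0 : 0 < B by rewrite ltr_wpDl ?addr_ge0 ?mulr_ge0 ?nrm_ge0.
pose e := Num.min 1 (cc / B); have e0 : 0 < e by rewrite lt_min ltr01 divr_gt0.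
exists e => // D a d aK de h; apply: le_trans (quadratic_perturbation Q a d).
have e1 : e <= 1 by rewrite ge_min lexx.
have eB : e * B <= cc by rewrite -ler_pdivlMr// ge_min lexx orbT.
have nQ := nrm_ge0 Q; have nD := nrm_ge0 D.
have h1 : nrm a * nrm d <= K * nrm D * (e * nrm D) by rewrite ler_pM ?nrm_ge0.
have h2 : nrm d ^+ 2 <= e * nrm D ^+ 2.
  apply: (@le_trans _ _ ((e * nrm D) ^+ 2)).
    by rewrite ler_pXn2r ?nnegrE ?nrm_ge0// mulr_ge0// ltW.
  rewrite exprMn; apply: ler_wpM2r; first exact: sqr_ge0.
  by rewrite expr2 ler_piMr// ltW.
have h3 : 2 * nrm Q * (nrm a * nrm d) <= 2 * nrm Q * (K * nrm D * (e * nrm D)).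
  by apply: ler_wpM2l; rewrite // mulr_ge0.
have h4 : nrm Q * nrm d ^+ 2 <= nrm Q * (e * nrm D ^+ 2) by exact: ler_wpM2l.
have h5 : e * B * nrm D ^+ 2 <= cc * nrm D ^+ 2 by apply: ler_wpM2r; rewrite ?sqr_ge0.
have h6 : 0 <= e * nrm D ^+ 2 by rewrite mulr_ge0 ?sqr_ge0// ltW.
rewrite /B in h5; move: h h3 h4 h5 h6; lra.
Qed.

End Perturbation.

(** * Linearization and bi-Lipschitz bounds of the step *)

Section LocalStructure.
Context {R : realType} {n m : nat} {Rw Cw : 'M[R]_n} {alpha : R}.
Context {f : 'I_n -> 'cV[R]_m -> R} {L : 'I_n -> R}.
Hypothesis alpha_gt0 : 0 < alpha.
Hypothesis f_C2 : forall i, C_class 2 (f i).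
Implicit Types (u v : 'cV[R]_(n * m + n * m)).

Let g := genstep Rw Cw alpha (gradF f).

Lemma strict_differentiability_gradF (theta : 'cV[R]_m) (e : R) : 0 < e ->
  exists2 d, 0 < d & forall X X' : 'M[R]_(m, n),
    nrm (X - theta *m ones^T) < d -> nrm (X' - theta *m ones^T) < d ->
    nrm (gradF f X - gradF f X' - hessF f theta (X - X')) <= e * nrm (X - X').
Proof.
move=> e0; have [d d0 dP] : exists2 d, 0 < d & forall i : 'I_n,
   forall x y, nrm (x - theta) < d -> nrm (y - theta) < d ->
   nrm (gradient (f i) x - gradient (f i) y - hessian (f i) theta *m (x - y)) <= e * nrm (x - y).
  apply: finite_delta => [i d d' dd' + x y xd yd|i]; first by apply; exact: lt_le_trans dd'.
  exact: strict_differentiability_gradient.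
exists d => // X X' Xd X'd; apply: nrm_cols_le => [|i]; first exact: ltW.
have colB (A B : 'M[R]_(m, n)) : col i (A - B) = col i A - col i B.
  by apply/matrixP => a b; rewrite !mxE.
have col_le (A : 'M[R]_(m, n)) : nrm (col i A) <= nrm A.
  apply: le_nrm; first exact: nrm_ge0.
  rewrite nrm_sq [leRHS]ip_cols (bigD1 i)//= lerDl sumr_ge0// => j _; exact: ip_ge0.
rewrite !colB !col_gradF col_hessF colB.
apply: dP; rewrite -[theta](@col_ones _ n _ _ i) -colB; apply: le_lt_trans (col_le _) _ => //.
Qed.

(** The gradient map enters the step linearly, so the residual is [- alpha E] in X and [E (C^T - I)]
    in H, where E is the residual of [gradF f]. *)
Lemma genstep_linearization (theta : 'cV[R]_m) (us : 'cV[R]_(n * m + n * m)) (e : R) :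
  stX us = theta *m ones^T -> 0 < e ->
  exists2 d, 0 < d & forall u v, nrm (u - us) < d -> nrm (v - us) < d ->
    nrm (g u - g v - genstep Rw Cw alpha (hessF f theta) (u - v)) <= e * nrm (u - v).
Proof.
move=> usX e0; pose K := alpha + nrm (Cw^T - 1%:M) + 1.
have K0 : 0 < K by rewrite ltr_wpDl// addr_ge0 ?nrm_ge0// ltW.
have [d d0 dP] := strict_differentiability_gradF theta (divr_gt0 e0 K0).
exists d => // u v ud vd.
have stXd w : nrm (w - us) < d -> nrm (stX w - theta *m ones^T) < d.
  by move=> wd; rewrite -usX -(linmapB_eq linmap_stX); apply: le_lt_trans (nrm_stX _) wd.
have := dP _ _ (stXd _ ud) (stXd _ vd); set E := _ - hessF _ _ _ => hE.
have [w wE] : exists w, w = u - v by exists (u - v).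
rewrite -wE; have wX : stX u - stX v = stX w by rewrite wE (linmapB_eq linmap_stX u).
have wH : stH u - stH v = stH w by rewrite wE (linmapB_eq linmap_stH u).
have aux gu gv gw :
    stX gu = stepX Rw alpha (stX u) (stY (gradF f) u) ->
    stX gv = stepX Rw alpha (stX v) (stY (gradF f) v) ->
    stX gw = stepX Rw alpha (stX w) (stY (hessF f theta) w) ->
    stH gu = stH u *m Cw^T + gradF f (stX u) *m (Cw^T - 1%:M) ->
    stH gv = stH v *m Cw^T + gradF f (stX v) *m (Cw^T - 1%:M) ->
    stH gw = stH w *m Cw^T + hessF f theta (stX w) *m (Cw^T - 1%:M) ->
    nrm (gu - gv - gw) <= e * nrm w; last first.
  by apply: aux; (exact: stX_genstep || exact: stH_genstep).
move=> Xu Xv Xw Hu Hv Hw; apply: le_trans (nrm_state_le _) _.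
rewrite (linmapB_eq linmap_stX (gu - gv)) (linmapB_eq linmap_stX gu).
rewrite (linmapB_eq linmap_stH (gu - gv)) (linmapB_eq linmap_stH gu).
rewrite Xu Xv Xw Hu Hv Hw.
have -> : stepX Rw alpha (stX u) (stY (gradF f) u) - stepX Rw alpha (stX v) (stY (gradF f) v)
   - stepX Rw alpha (stX w) (stY (hessF f theta) w) = - alpha *: E.
  rewrite /stepX /stY /E -wX -wH mulmxBl.
  move: (hessF _ _ _) (stX u *m _) (stX v *m _) (stH u) (stH v) (gradF f _) (gradF f _).
  by move=> a b b' h h' y y'; apply/matrixP => i j; rewrite !mxE; ring.
have -> : stH u *m Cw^T + gradF f (stX u) *m (Cw^T - 1%:M)
    - (stH v *m Cw^T + gradF f (stX v) *m (Cw^T - 1%:M))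
    - (stH w *m Cw^T + hessF f theta (stX w) *m (Cw^T - 1%:M))
  = E *m (Cw^T - 1%:M).
  rewrite /E -wX -wH; move: (Cw^T - 1%:M) => M; rewrite !mulmxBl.
  move: (hessF _ _ _ *m M) (stH u *m _) (stH v *m _) (gradF f _ *m M) (gradF f _ *m M).
  by move=> a b b' h h'; apply/matrixP => i j; rewrite !mxE; ring.
rewrite nrmZ normrN gtr0_norm//.
have h2 := nrmM E (Cw^T - 1%:M).
have h3 : K * nrm E <= e * nrm w.
  rewrite -ler_pdivlMl//; apply: le_trans hE _; rewrite [e / K]mulrC -mulrA.
  apply: ler_wpM2l; first by rewrite invr_ge0 ltW.
  by apply: ler_wpM2l; [exact: ltW|rewrite wX nrm_stX].
have h4 := nrm_ge0 E; move: h3 h2; rewrite /K; lra.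
Qed.

End LocalStructure.

Section BiLipschitz.
Context {R : realType} {n m : nat} {Rw Cw : 'M[R]_n} {Lc alpha : R}.
Variable G : 'M[R]_(m, n) -> 'M[R]_(m, n).
Hypotheses (alpha_gt0 : 0 < alpha) (Lc_ge0 : 0 <= Lc).
Hypothesis G_lip : forall X X', nrm (G X - G X') <= Lc * nrm (X - X').
Implicit Types (u v : 'cV[R]_(n * m + n * m)).

Let g := genstep Rw Cw alpha G.

Lemma stY_lip u v : nrm (stY G u - stY G v) <= (1 + Lc) * nrm (u - v).
Proof.
rewrite /stY opprD addrACA; apply: le_trans (nrmD _ _) _; rewrite mulrDl mul1r; apply: lerD.
  by rewrite -(linmapB_eq linmap_stH) nrm_stH.
apply: le_trans (G_lip _ _) _; apply: ler_wpM2l => //.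
by rewrite -(linmapB_eq linmap_stX) nrm_stX.
Qed.

Lemma genstep_lip : exists2 K : R, 0 <= K & forall u v, nrm (g u - g v) <= K * nrm (u - v).
Proof.
pose K := (nrm Rw^T + alpha * (1 + Lc)) + (nrm Cw^T + Lc * nrm (Cw^T - 1%:M)).
exists K; first by rewrite /K !addr_ge0 ?mulr_ge0 ?addr_ge0 ?nrm_ge0// ltW.
move=> u v; apply: le_trans (nrm_state_le _) _.
rewrite (linmapB_eq linmap_stX (g u)) (linmapB_eq linmap_stH (g u)).
have -> : stX (g u) - stX (g v) = stX (u - v) *m Rw^T + - alpha *: (stY G u - stY G v).
  rewrite (stX_genstep _ _ _ _ u) (stX_genstep _ _ _ _ v) /stepX.
  rewrite (linmapB_eq linmap_stX u) mulmxBl.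
  move: (stX u *m _) (stX v *m _) (stY G u) (stY G v) => x y z w.
  by apply/matrixP => i j; rewrite !mxE; ring.
have -> : stH (g u) - stH (g v) = stH (u - v) *m Cw^T + (G (stX u) - G (stX v)) *m (Cw^T - 1%:M).
  rewrite (stH_genstep _ _ _ _ u) (stH_genstep _ _ _ _ v).
  by rewrite (linmapB_eq linmap_stH u) opprD addrACA; congr (_ + _); rewrite mulmxBl.
rewrite /K [leRHS]mulrDl; apply: lerD; (apply: le_trans (nrmD _ _) _).
  rewrite mulrDl nrmZ normrN gtr0_norm// -mulrA; apply: lerD.
    by apply: le_trans (nrmM _ _) _; rewrite mulrC ler_wpM2l ?nrm_ge0 ?nrm_stX.
  by apply: ler_wpM2l; [exact: ltW|exact: stY_lip].
rewrite mulrDl; apply: lerD.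
  by apply: le_trans (nrmM _ _) _; rewrite mulrC ler_wpM2l ?nrm_ge0 ?nrm_stH.
apply: le_trans (nrmM _ _) _; rewrite mulrAC; apply: ler_wpM2r; first exact: nrm_ge0.
apply: le_trans (G_lip _ _) _; apply: ler_wpM2l => //.
by rewrite -(linmapB_eq linmap_stX) nrm_stX.
Qed.

Lemma sigma_min_mulr (A : 'M[R]_n) (Z : 'M[R]_(m, n)) : 0 <= sigma_min A ->
  sigma_min A * nrm Z <= nrm (Z *m A^T).
Proof.
move=> s0; rewrite -(ler_pXn2r (ltn0Sn 1)) ?nnegrE ?mulr_ge0 ?nrm_ge0//.
rewrite exprMn !nrm_sq !ip_rows mulr_sumr; apply: ler_sum => i _.
rewrite row_mul -!nrm_sq -exprMn ler_pXn2r ?nnegrE ?mulr_ge0 ?nrm_ge0//.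
by rewrite -(nrm_tr (row i Z)) -(nrm_tr (_ *m _)) trmx_mul trmxK; exact: sigma_min_bound.
Qed.

(* With [Y = H + G X], the differences satisfy
   [dX (C R)^T = alpha dG + dX' C^T + alpha dH'], and [sigma_min (C R) > alpha Lc]. *)
Lemma genstep_colip : alpha * Lc < sigma_min (Cw *m Rw) ->
  exists2 K : R, 0 <= K & forall u v, nrm (u - v) <= K * nrm (g u - g v).
Proof.
move=> hs; set s := sigma_min _ in hs; pose d := s - alpha * Lc.
have d0 : 0 < d by rewrite subr_gt0.
have s0 : 0 <= s by apply: le_trans (ltW hs); apply: mulr_ge0 => //; exact: ltW.
pose K1 := (nrm Cw^T + alpha) / d; pose K2 := (nrm Rw^T * K1 + 1) / alpha + Lc * K1.
have K10 : 0 <= K1 by rewrite /K1 divr_ge0 ?(ltW d0)// addr_ge0 ?nrm_ge0// ltW.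
have K20 : 0 <= K2.
  apply: addr_ge0; last exact: mulr_ge0.
  by rewrite divr_ge0 ?(ltW alpha_gt0)// addr_ge0// mulr_ge0 ?nrm_ge0.
exists (K1 + K2); first by rewrite addr_ge0.
move=> u v; pose dX := stX u - stX v; pose dG := G (stX u) - G (stX v).
pose dY := stY G u - stY G v; pose a := stX (g u) - stX (g v); pose b := stH (g u) - stH (g v).
pose N := nrm (g u - g v).
have aN : nrm a <= N by rewrite /a -(linmapB_eq linmap_stX (g u)) nrm_stX.
have bN : nrm b <= N by rewrite /b -(linmapB_eq linmap_stH (g u)) nrm_stH.
have aE : a = dX *m Rw^T - alpha *: dY.
  rewrite /a (stX_genstep _ _ _ _ u) (stX_genstep _ _ _ _ v) /stepX /dX /dY mulmxBl.
  move: (stX u *m _) (stX v *m _) (stY G u) (stY G v) => x y z w.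
  by apply/matrixP => i j; rewrite !mxE; ring.
have bE : b = dY *m Cw^T - dG.
  rewrite /b (stH_genstep _ _ _ _ u) (stH_genstep _ _ _ _ v) /dY /dG /stY.
  rewrite mulmxBl !mulmxDl !mulmxBr !mulmx1.
  move: (G (stX u)) (G (stX v)) (G (stX u) *m _) (G (stX v) *m _) (stH u *m _) (stH v *m _) => x y z w x' y'.
  by apply/matrixP => i j; rewrite !mxE; ring.
have dGX : nrm dG <= Lc * nrm dX by exact: G_lip.
have E : dX *m (Cw *m Rw)^T = alpha *: dG + a *m Cw^T + alpha *: b.
  rewrite trmx_mul mulmxA aE bE; move: (dX) (dG) (dY) => x' z y'.
  rewrite mulmxBl -scalemxAl; move: (x' *m _ *m _) (y' *m _) => x y.
  by apply/matrixP => i j; rewrite !mxE; ring.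
have hX : nrm dX <= K1 * N.
  rewrite /K1 mulrAC ler_pdivlMr// mulrBr mulrC lerBlDr.
  apply: le_trans (sigma_min_mulr dX s0) _; rewrite E.
  apply: le_trans (nrmD _ _) _; apply: le_trans (lerD (nrmD _ _) (lexx _)) _.
  rewrite !nrmZ gtr0_norm//.
  have h1 : alpha * nrm dG <= alpha * (Lc * nrm dX) by rewrite ler_pM2l.
  have h2 : nrm (a *m Cw^T) <= nrm Cw^T * N.
    by apply: le_trans (nrmM _ _) _; rewrite mulrC; apply: ler_wpM2l; rewrite ?nrm_ge0.
  have h3 : alpha * nrm b <= alpha * N by rewrite ler_pM2l.
  by move: h1 h2 h3; lra.
have hY : nrm dY <= (nrm Rw^T * K1 + 1) / alpha * N.
  rewrite mulrAC ler_pdivlMr// -{1}(gtr0_norm alpha_gt0) mulrC -nrmZ.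
  have -> : alpha *: dY = dX *m Rw^T - a by rewrite aE opprB addrC subrK.
  apply: le_trans (nrmD _ _) _; rewrite nrmN mulrDl mul1r; apply: lerD => //.
  apply: le_trans (nrmM _ _) _; rewrite mulrC -mulrA; apply: ler_wpM2l => //.
  exact: nrm_ge0.
apply: le_trans (nrm_state_le _) _.
rewrite (linmapB_eq linmap_stX u) (linmapB_eq linmap_stH u) -/dX mulrDl; apply: lerD => //.
have -> : stH u - stH v = dY - dG by rewrite /dY /dG /stY opprD addrACA addrK.
apply: le_trans (nrmD _ _) _; rewrite nrmN /K2 mulrDl; apply: lerD => //.
apply: le_trans dGX _; rewrite -mulrA; exact: ler_wpM2l.
Qed.

End BiLipschitz.

(** * The initialization subspace *)

Section InitSpace.
Context {R : realType} {n m : nat} {Rw Cw : 'M[R]_n} {r c : 'cV[R]_n}.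
Hypotheses (mix : mixing Rw Cw r c) (rhoC1 : rhoC Cw c < 1).
Implicit Types (u : 'cV[R]_(n * m + n * m)).

Let N := 1%:M - (Cw - c *m ones^T)^T.

(** A vector in the kernel is fixed by the transpose of [C - c 1^T], which contracts strictly in the
    norm weighted by c. *)
Lemma unit_mixing_residual : N \in unitmx.
Proof.
rewrite -row_free_unit -kermx_eq0; apply/eqP; set Z := kermx N.
have ZN : Z = Z *m (Cw - c *m ones^T)^T.
  by apply/eqP; rewrite -subr_eq0 -{1}[Z]mulmx1 -mulmxBr mulmx_ker.
have c0 := vmin_gt0 (mix_c_pos mix).
suff Z0 : Z *m rdiag c = 0.
  by rewrite -[Z]mulmx1 -(rdiag_dsqrt c0) mulmxA Z0 mul0mx.
apply: nrm_eq0; apply/eqP; rewrite eq_le nrm_ge0 andbT leNgt; apply/negP => h.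
have := contractionC mix Z; rewrite -ZN leNgt => /negP; apply.
by rewrite -[ltRHS]mul1r ltr_pM2r.
Qed.

Lemma mat_init (z : 'cV[R]_(n * m)) : mat ((lift_mx m Cw - 1%:M) *m z) = mat z *m (Cw^T - 1%:M).
Proof. by rewrite mulmxBl mul1mx matB mat_lift mulmxBr mulmx1. Qed.

(** To solve [H = Z (I - C^T)] with a singular factor, add [1 c^T]: the sum N is invertible, and
    [N 1 = 1] gives [Z 1 = H 1 = 0], so the added term contributes nothing. *)
Lemma balancedP u : balanced u <-> init_space Cw u.
Proof.
split=> [Su|[z _ zu]]; last first.
  by rewrite /balanced /stH -zu mat_init -mulmxA mulmxBl (mix_CT1 mix) mul1mx subrr mulmx0.
pose Z := stH u *m invmx N.
have ZN : Z *m N = stH u by rewrite mulmxKV// unit_mixing_residual.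
have NE : N = 1%:M - Cw^T + ones *m c^T.
  by rewrite /N [X in _ - X]linearB/= trmx_mul trmxK opprB addrA addrAC.
have Z1 : Z *m (ones : 'cV_n) = 0.
  have := Su; rewrite /balanced -ZN NE -mulmxA mulmxDl mulmxBl mul1mx (mix_CT1 mix) subrr add0r.
  by rewrite -mulmxA (mix_c1 mix) mulmx1.
exists (unmat (- Z)) => //; apply: (can_inj matK); rewrite mat_init unmatK -[RHS]/(stH u) -ZN NE.
by rewrite mulmxDr [Z *m (_ *m _)]mulmxA Z1 mul0mx addr0 mulNmx -mulmxN opprB.
Qed.

Lemma init_space_range : range (fun z : 'cV[R]_(n * m + n * m) =>
    block_mx 1%:M 0 0 (lift_mx m Cw - 1%:M) *m z) = init_space Cw.
Proof.
apply/seteqP; split=> [_ [z _ <-]|u [z _ zu]].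
  rewrite -(vsubmxK z) mul_block_col /init_space /= col_mxKd mul0mx add0r.
  by exists (dsubmx z).
exists (col_mx (usubmx u) z) => //.
by rewrite mul_block_col mul1mx !mul0mx addr0 add0r zu vsubmxK.
Qed.

End InitSpace.

Section Density.
Context {R : realType}.

Lemma rat_dense_cV {k : nat} (u : 'cV[R]_k) (e : R) : 0 < e ->
  exists q : 'cV[rat]_k, nrm (map_mx ratr q - u) < e.
Proof.
move=> e0; pose d := e / (k%:R + 1) / 2.
have k0 : 0 < k%:R + 1 :> R by rewrite ltr_wpDl.
have d0 : 0 < d by rewrite !divr_gt0.
have /choice[q qP] : forall i, exists x : rat, `|ratr x - u i 0| <= d.
  move=> i; have h : u i 0 - d < u i 0 + d by move: d0; lra.
  have [x] := rat_in_itvoo h; rewrite in_itv/= => /andP[h1 h2].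
  by exists x; rewrite ler_norml; apply/andP; split; lra.
exists (\col_i q i); apply: (@le_lt_trans _ _ ((k * 1)%:R * d)).
  apply: nrm_le_entries => [|i j]; first exact: ltW.
  by rewrite !mxE (ord1 j) qP.
have dk : d * (k%:R + 1) = e / 2 by rewrite /d; field; rewrite gt_eqF.
by rewrite muln1; move: dk d0 e0; lra.
Qed.

Lemma cvg_nrm {k : nat} (x : nat -> 'cV[R]_k) (l : 'cV[R]_k) :
  x @ \oo --> l <-> forall e : R, 0 < e -> exists N, forall j, (N <= j)%N -> nrm (x j - l) < e.
Proof.
split=> [xl e e0|h].
  have : nbhs l [set y | nrm (y - l) < e] by apply/near_nrmP; exists e.
  by move=> /xl[N _ hN]; exists N => j Nj; exact: hN.
move=> A /near_nrmP[e e0 hA]; have [N hN] := h e e0.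
by exists N => // j /= Nj; apply: hA; exact: hN.
Qed.

End Density.

(** * Null sets of initial points attracted by a saddle *)

Section TrappedPoints.
Context {R : realType} {k d : nat} (g : 'cV[R]_k -> 'cV[R]_k) (V : set 'cV[R]_k) (B : 'M[R]_(k, d)).
Hypotheses (d_gt0 : (0 < d)%N) (BB : B^T *m B = 1%:M)
  (BV : range (fun t : 'cV[R]_d => B *m t) = V).
Hypothesis gV : forall u, V u -> V (g u).
Variables (Kup Klo : R).
Hypotheses (Kup0 : 0 <= Kup) (Klo0 : 0 <= Klo)
  (g_lip : forall u v, nrm (g u - g v) <= Kup * nrm (u - v))
  (g_colip : forall u v, nrm (u - v) <= Klo * nrm (g u - g v)).

Lemma BBK x : V x -> B *m (B^T *m x) = x.
Proof. by rewrite -BV => -[t _ <-]; rewrite [B^T *m _]mulmxA BB mul1mx. Qed.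

Lemma VB t : V (B *m t).
Proof. by rewrite -BV; exists t. Qed.

Lemma iterV j u : V u -> V (iter j g u).
Proof. by move=> Vu; elim: j => //= j; exact: gV. Qed.

Lemma nrm_isometry (t : 'cV[R]_d) : nrm (B *m t) = nrm t.
Proof. by rewrite /nrm ip_mull mulmxA BB mul1mx. Qed.

Definition trapped (q : 'cV[R]_k) (s : R) : set 'cV[R]_k :=
  [set u | forall j, nrm (iter j g u - q) <= s].

(** A ball about [q] inside the [rho]-ball about [us] traps orbits where the form expands, so
    differences of trapped points have nonpositive form. The cone criterion applies to the form
    pulled back by B, because a positive direction lies in V. *)
Lemma trapped_cube_null (Q : 'M[R]_k) (mu rho : R) (us q : 'cV[R]_k) (s : R) :
  1 < mu -> (exists2 u, V u & 0 < ip u (Q *m u)) ->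
  (forall u v, V u -> V v -> nrm (u - us) < rho -> nrm (v - us) < rho ->
     mu * ip (u - v) (Q *m (u - v)) <= ip (g u - g v) (Q *m (g u - g v))) ->
  nrm (q - us) + s < rho -> cube_null [set t | trapped q s (B *m t)].
Proof.
move=> mu1 [u Vu u0] gQ qs.
have near_us t : trapped q s (B *m t) -> forall j, nrm (iter j g (B *m t) - us) < rho.
  move=> tr j; apply: le_lt_trans (nrmD_sub _ q _) _; apply: le_lt_trans qs.
  by rewrite addrC lerD2l; exact: tr.
apply: (@cube_null_cone _ _ _ (B^T *m Q *m B) (B^T *m u) (rho + nrm us)).
- by rewrite -!mulmxA BBK// -ip_mull BBK.
- move=> t /near_us /(_ 0%N)/= h; rewrite -nrm_isometry -[B *m t](subrK us).
  by apply: le_trans (nrmD _ _) _; rewrite lerD2r ltW.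
move=> t t' Tt Tt'.
have -> : ip (t - t') (B^T *m Q *m B *m (t - t')) = ip (B *m t - B *m t') (Q *m (B *m t - B *m t')).
  by rewrite -!mulmxA -ip_mull mulmxBr.
apply: (trapped_form_le0 mu1 gV gQ) => //; try exact: VB; exact: near_us.
Qed.

(* Countably many closed sets of initial points whose orbits are eventually trapped in
   a ball with rational data on which trapping is a null event. *)
Definition trapping_cell (i : 'cV[rat]_k * nat * nat) : set 'cV[R]_k :=
  if `[< cube_null [set t | trapped (map_mx ratr i.1.1) i.1.2.+1%:R^-1 (B *m t)] >] then
    [set u | trapped (map_mx ratr i.1.1) i.1.2.+1%:R^-1 (iter i.2 g u)]
  else set0.

(** Closed cells are Borel, so absolute continuity can be applied to their countable union. *)
Lemma closed_trapping_cell i : closed (trapping_cell i).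
Proof.
rewrite /trapping_cell; case: ifP => _; last exact: closed0.
rewrite (_ : [set u | _] = \bigcap_j [set u | nrm (iter (j + i.2) g u - map_mx ratr i.1.1) <= i.1.2.+1%:R^-1]).
  apply: closed_bigI => j _.
  by apply: closed_nrm_preimage (exprn_ge0 (j + i.2) Kup0) _; exact: iter_lipschitz.
apply/seteqP; split => u h j; first by move=> _ /=; rewrite iterD; exact: h.
by have := h j I; rewrite /= iterD.
Qed.

(** The orbit is trapped only after [i.2] steps: the cell is a preimage of a null set under the
    iterate read in coordinates, whose inverse is Lipschitz with a constant governed by
    [Klo ^+ i.2]. *)
Lemma null_trapping_cell i : cube_null [set t | trapping_cell i (B *m t)].
Proof.
rewrite /trapping_cell; case: ifPn => [/asboolP h|_]; last exact: cube_null0.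
pose Phi t := B^T *m iter i.2 g (B *m t).
apply: (cube_nullS (B := Phi @^-1` [set t | trapped (map_mx ratr i.1.1) i.1.2.+1%:R^-1 (B *m t)])).
  by move=> t /=; rewrite /Phi BBK //; exact/iterV/VB.
apply: (cube_null_preimage (C := Klo ^+ i.2 * (d * 1)%:R)) h.
- by rewrite mulr_ge0// exprn_ge0.
move=> t t'; apply: le_trans (mx_norm_nrm _) _; rewrite -mulrA.
apply: (@le_trans _ _ (Klo ^+ i.2 * nrm (Phi t - Phi t'))); last first.
  by apply: ler_wpM2l; [exact: exprn_ge0|exact: nrm_mx_norm].
rewrite -[nrm (Phi t - _)]nrm_isometry mulmxBr /Phi !BBK; try exact/iterV/VB.
by rewrite -nrm_isometry mulmxBr; exact: iter_expanding.
Qed.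

Lemma trapping_cell_cover (us u0 : 'cV[R]_k) (rho : R) : 0 < rho ->
  (forall q s, nrm (q - us) + s < rho -> cube_null [set t | trapped q s (B *m t)]) ->
  (fun j => iter j g u0) @ \oo --> us -> (\bigcup_i trapping_cell i) u0.
Proof.
move=> rho0 hnull /cvg_nrm cv.
(* With [q] and the tail of the orbit within [s / 2] of [us], the tail stays within [s] of [q], and
   [|q - us| + s < 2 s < rho]. *)
pose N := Num.truncn (2 / rho); pose s : R := N.+1%:R^-1.
have s0 : 0 < s by rewrite invr_gt0.
have srho : 2 * s < rho.
  have := truncnS_gt (2 / rho); rewrite -/N ltr_pdivrMr// => h.
  by rewrite /s ltr_pdivrMr// mulrC.
have [q q2] := rat_dense_cV us (divr_gt0 s0 (ltr0Sn _ 1)).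
have [j0 hj] := cv (s / 2) (divr_gt0 s0 (ltr0Sn _ 1)).
exists (q, N, j0) => //; rewrite /trapping_cell /= asboolT.
  move=> j /=; rewrite -iterD; apply: le_trans (nrmD_sub _ us _) _.
  have := hj (j + j0)%N (leq_addl _ _); rewrite [nrm (us - _)]nrmB -/s; move: q2; lra.
by apply: hnull; rewrite -/s; move: q2 srho; lra.
Qed.

End TrappedPoints.

Lemma weight_matrices_mixing (R : realType) (n : nat) (e : rel 'I_n) (Rw Cw : 'M[R]_n) (r c : 'cV[R]_n) :
  weight_matrices e Rw Cw -> stochastic r -> r^T *m Rw = r^T -> 0 < vmin r ->
  stochastic c -> Cw *m c = c -> 0 < vmin c -> mixing Rw Cw r c.
Proof.
move=> wm [_ r1] rR rp [_ c1] cC cp; split => //.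
- apply/matrixP => i j; rewrite mxE [RHS]mxE -(wm_R_stoch wm i).
  by apply: eq_bigr => k _; rewrite mxE mulr1.
- apply/matrixP => i j; rewrite mxE [RHS]mxE [RHS]mxE -(wm_C_stoch wm j).
  by apply: eq_bigr => k _; rewrite !mxE mul1r.
- apply/matrixP => i j; rewrite !ord1 mxE [RHS]mxE eqxx mulr1n -r1.
  by apply: eq_bigr => k _; rewrite !mxE mulr1.
- apply/matrixP => i j; rewrite !ord1 mxE [RHS]mxE eqxx mulr1n -c1.
  by apply: eq_bigr => k _; rewrite !mxE mulr1.
Qed.

Section BorelSets.
Context {R : realType} {k : nat}.

Lemma closed_borel (A : set 'cV[R]_k) : closed A -> measurable (A : set (borelType R k)).
Proof.
move=> cA; rewrite -[A]setCK; apply: measurableC.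
by apply: sub_sigma_algebra; rewrite /= openC.
Qed.

(** A itself is not shown measurable; it is enclosed in the Borel set formed by the cover and the
    complement of V, which is null because [P V = 1]. *)
Lemma negligible_of_null_cover (V : set 'cV[R]_k) (P : probability (borelType R k) R)
    (I : countType) (F : I -> set 'cV[R]_k) (A : set 'cV[R]_k) :
  abs_cont_on V P -> closed V -> (forall i, closed (F i)) ->
  lebesgue_null_on V (\bigcup_i F i) ->
  (forall u, V u -> A u -> (\bigcup_i F i) u) -> P.-negligible (A : set (borelType R k)).
Proof.
move=> [PV Pac] cV cF nullF cov.
have mV := closed_borel cV.
have mF : measurable (\bigcup_i F i : set (borelType R k)).
  pose F' m := if unpickle m is Some i then F i else set0.
  have -> : \bigcup_i F i = \bigcup_m F' m.
    apply/seteqP; split => u; first by move=> [i _ Fu]; exists (pickle i) => //; rewrite /F' pickleK.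
    by move=> [m _]; rewrite /F'; case: unpickle => // i Fu; exists i.
  apply: bigcupT_measurable => m; rewrite /F'; case: unpickle => [i|]; last exact: measurable0.
  exact: closed_borel (cF i).
apply: (@negligibleS _ _ _ _ (~` V `|` \bigcup_i F i : set (borelType R k))).
  by move=> u Au; have [Vu|nVu] := pselect (V u); [right; exact: cov|left].
apply: negligibleU.
  apply/negligibleP; first exact: measurableC.
  by have := probability_setC P mV; rewrite PV subee.
by apply/negligibleP => //; exact: Pac.
Qed.

End BorelSets.

Section SaddleSet.
Context {R : realType} {n m : nat} {Rw Cw : 'M[R]_n} {r c : 'cV[R]_n}.
Context {LF eps_x eps_y eps kappa alpha : R} {f : 'I_n -> 'cV[R]_m -> R} {L : 'I_n -> R}.
Hypothesis mix : mixing Rw Cw r c.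
Hypothesis step : step_size Rw Cw r c (sup (range L)) LF eps_x eps_y eps kappa alpha.
Hypotheses (alpha_gt0 : 0 < alpha) (n_gt0 : (0 < n)%N) (m_gt0 : (0 < m)%N).
Hypothesis alpha_lt : alpha < sigma_min (Cw *m Rw) / sup (range L).
Hypothesis f_C2 : forall i, C_class 2 (f i).
Hypotheses (f_lip : forall i, lipschitz2 (L i) (gradient (f i)))
  (F_lip : lipschitz2 LF (gradient (Fsum f))).

Let g := genstep Rw Cw alpha (gradF f).
Let Lc_ge0 : 0 <= sup (range L) := sup_L_ge0 m_gt0 f_lip.

Lemma dogtE u0 : dogt f Rw Cw alpha u0 = (fun nu => iter nu g u0).
Proof.
apply/funext => nu; rewrite /dogt; apply: eq_iter => u.
exact: dogt_stepE.
Qed.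

Lemma init_genstep u : init_space Cw u -> init_space Cw (g u).
Proof.
move/(balancedP mix (rhoC_lt1 step)) => Su.
by apply/(balancedP mix (rhoC_lt1 step)); exact: (balanced_genstep mix).
Qed.

Lemma saddle_local_expansion (theta : 'cV[R]_m) us : strict_saddle (Fsum f) theta ->
  stX us = theta *m ones^T ->
  exists (Q : 'M[R]_(n * m + n * m)) (mu rho : R),
  [/\ 1 < mu, 0 < rho, exists2 u, init_space Cw u & 0 < ip u (Q *m u)
   & forall u v, init_space Cw u -> init_space Cw v ->
     nrm (u - us) < rho -> nrm (v - us) < rho ->
     mu * ip (u - v) (Q *m (u - v)) <= ip (g u - g v) (Q *m (g u - g v))].
Proof.
move=> [_ /lambda_min_lt0 neg] usX; have balP := balancedP mix (rhoC_lt1 step).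
have [Q [mu [cc [mu1 cc0 [u0 Su0 Qu0] hQ]]]] :=
  expanding_form mix step alpha_gt0 m_gt0 f_C2 f_lip F_lip neg.
have [K K0 hK] := linmap_bounded (linmap_genstep_hessF (Rw := Rw) (Cw := Cw) (alpha := alpha) (f := f) theta).
have [e e0 he] := expansion_perturbation Q mu cc0 K0.
have [rho rho0 hrho] := genstep_linearization (Rw := Rw) (Cw := Cw) alpha_gt0 f_C2 usX e0.
exists Q, mu, rho; split => //; first by exists u0 => //; exact/balP.
move=> u v /balP Su /balP Sv ud vd.
rewrite -[g u - g v](subrKC (genstep Rw Cw alpha (hessF f theta) (u - v))).
by apply: he (hK _) (hrho _ _ ud vd) (hQ _ (balancedB Su Sv)).
Qed.

Lemma saddle_null_cover : exists F : 'cV[rat]_(n * m + n * m) * nat * nat -> set 'cV[R]_(n * m + n * m),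
  [/\ closed (init_space Cw : set 'cV[R]_(n * m + n * m)), forall i, closed (F i),
      lebesgue_null_on (init_space Cw) (\bigcup_i F i)
    & forall u0, init_space Cw u0 ->
      (exists2 u, consensual_saddles f u & dogt f Rw Cw alpha u0 @ \oo --> u) ->
      (\bigcup_i F i) u0].
Proof.
have [d [B [BB]]] := orthonormal_basis (block_mx (1%:M : 'M[R]_(n * m)) 0 0 (lift_mx m Cw - 1%:M)).
rewrite init_space_range => BV.
have gV := init_genstep.
have [Kup Kup0 g_lip] := genstep_lip (Rw := Rw) (Cw := Cw) alpha_gt0 Lc_ge0 (gradF_lip m_gt0 f_lip).
have aL : alpha * sup (range L) < sigma_min (Cw *m Rw) by exact: lt_div_mul.
have [Klo Klo0 g_colip] := genstep_colip alpha_gt0 Lc_ge0 (gradF_lip m_gt0 f_lip) aL.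
(* The X component is free in the initialization space, which is therefore not trivial. *)
have d0 : (0 < d)%N.
  rewrite lt0n; apply/eqP => d0.
  have l0 : (0 < n * m)%N by rewrite muln_gt0 n_gt0.
  pose x : 'cV[R]_(n * m) := basis_vec (Ordinal l0).
  have : init_space Cw (col_mx x 0 : 'cV[R]_(n * m + n * m)).
    by exists 0; rewrite ?mulmx0 ?col_mxKd.
  rewrite -BV => -[t _ Bt]; move: B BB BV t Bt; rewrite d0 => B _ _ t.
  rewrite [t]flatmx0 mulmx0 => /(congr1 usubmx); rewrite col_mxKu linear0 => /(congr1 nrm).
  by rewrite nrm0 nrm_basis => /eqP; rewrite eq_sym oner_eq0.
exists (trapping_cell g B); split.
(* The space is the zero set of [I - B B^T], hence closed. *)
- rewrite (_ : init_space Cw = [set u | nrm ((1%:M - B *m B^T) *m u - 0) <= 0]).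
    apply: (closed_nrm_preimage (K := nrm (1%:M - B *m B^T))); first exact: nrm_ge0.
    by move=> u v; rewrite -mulmxBr nrmM.
  apply/seteqP; split => u; rewrite /= subr0 mulmxBl mul1mx -mulmxA.
    by move=> Vu; rewrite (BBK BB BV) // subrr nrm0.
  move=> h; have /nrm_eq0/eqP : nrm (u - B *m (B^T *m u)) = 0 by apply/eqP; rewrite eq_le h nrm_ge0.
  by rewrite subr_eq0 => /eqP ->; rewrite -BV; exists (B^T *m u).
- by move=> i; exact: closed_trapping_cell Kup0 g_lip i.
- exists d, B; split => //; apply: lebesgue_outer_cube_null.
  apply: cube_nullS (cube_null_countable d0 (null_trapping_cell d0 BB BV gV Klo0 g_colip)).
  by move=> t [i _ ti]; exists i.
move=> u0 Vu0 [us [theta sad usE] cv].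
have usX : stX us = theta *m ones^T by rewrite -usE /stX col_mxKu mat_consensus.
have [Q [mu [rho [mu1 rho0 exu hQ]]]] := saddle_local_expansion sad usX.
apply: (trapping_cell_cover rho0) => [q s qs|]; last by rewrite -dogtE; exact: cv.
exact: (trapped_cube_null BB BV gV mu1 exu hQ qs).
Qed.

End SaddleSet.

(** * Convergence under the KL property *)

Section DesingularizingFunctions.
Context {R : realType}.
Implicit Types (phi : R -> R) (s t : R).

Lemma derive1_expansion phi s (e : R) : derivable phi s 1 -> 0 < e ->
  exists2 d, 0 < d & forall x, `|x| < d -> `|phi (s + x) - phi s - derive1 phi s * x| <= e * `|x|.
Proof.
move=> dphi e0; have := dphi; rewrite /derivable => /cvgrPdist_le /(_ e e0).
have -> : lim ((fun h : R => h^-1 *: ((phi \o shift s) (h *: 1) - phi s)) @ 0^') = derive1 phi s.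
  by rewrite derive1E.
move=> /nbhs_normP[d/= d0 hd]; exists d => // x xd.
have [->|x0] := eqVneq x 0; first by rewrite addr0 subrr mulr0 subr0 normr0 mulr0.
have := hd x; rewrite /= sub0r normrN => /(_ xd x0).
rewrite distrC => h; rewrite -ler_pdivrMr ?normr_gt0// -normf_div; apply: le_trans h.
rewrite le_eqVlt; apply/orP; left; apply/eqP; congr `| _ |.
rewrite mulrBl mulfK//; congr (_ - _).
by rewrite [x *: 1]mulr1 [s + x]addrC mulrC.
Qed.

(** Concavity bounds the chord by the difference quotient at s towards t; the step h tends to 0. *)
Lemma concave_tangent phi s t : derivable phi s 1 ->
  (forall l, 0 <= l -> l <= 1 -> l * phi s + (1 - l) * phi t <= phi (l * s + (1 - l) * t)) ->
  phi t - phi s <= derive1 phi s * (t - s).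
Proof.
move=> dphi conc; have [->|ts] := eqVneq t s; first by rewrite !subrr mulr0.
apply/ler_addgt0Pr => e e0; have n0 : 0 < `|t - s| by rewrite normr_gt0 subr_eq0.
have [d d0 hd] := derive1_expansion dphi (divr_gt0 e0 n0).
pose h := Num.min 1 (d / `|t - s| / 2).
have h0 : 0 < h by rewrite lt_min ltr01 !divr_gt0.
have h1 : h <= 1 by rewrite ge_min lexx.
have hd2 : `|h * (t - s)| < d.
  rewrite normrM gtr0_norm// -ltr_pdivlMr//; apply: (@le_lt_trans _ _ (d / `|t - s| / 2)).
    by rewrite ge_min lexx orbT.
  by rewrite gtr_pMr ?divr_gt0// invf_lt1// ltr1n.
have := hd _ hd2; rewrite normrM gtr0_norm// => /ler_normlW k1.
have := conc (1 - h) _ _; rewrite subr_ge0 gerBl (ltW h0) h1 => /(_ isT isT).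
have -> : (1 - h) * s + (1 - (1 - h)) * t = s + h * (t - s) by ring.
move=> k2.
have k3 : e / `|t - s| * (h * `|t - s|) = h * e by rewrite mulrCA divfK// gt_eqF.
rewrite k3 in k1; rewrite -(ler_pM2l h0); move: k1 k2; lra.
Qed.

Lemma desing_real_eta (eta : \bar R) : (0 < eta)%E ->
  exists2 e : R, 0 < e & forall s, s < e -> (s%:E < eta)%E.
Proof.
case: eta => [e||] //; first by rewrite lte_fin => e0; exists e => // s; rewrite lte_fin.
by move=> _; exists 1 => // s _; rewrite ltry.
Qed.

(** [eta] may be infinite, but only small excesses matter, hence a real bound [e]. The tangent
    inequality needs a derivative only at its base point, so it includes [t = 0]. *)
Lemma desing_properties (eta : \bar R) phi : desingularizing eta phi ->
  exists2 e : R, 0 < e &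
  [/\ forall s, s < e -> (s%:E < eta)%E,
      forall s, 0 <= s -> s < e -> 0 <= phi s,
      forall s t, 0 <= t -> t <= s -> 0 < s -> s < e -> derive1 phi s * (s - t) <= phi s - phi t,
      forall s t, 0 < s -> s <= t -> t < e -> derive1 phi t <= derive1 phi s
    & forall x : R, 0 < x -> exists2 d, 0 < d & forall s, 0 <= s -> s < d -> phi s < x].
Proof.
move=> D; have [e e0 he] := desing_real_eta (desing_eta D); exists e => //.
have tang s t : 0 <= t -> t < e -> 0 < s -> s < e -> phi t - phi s <= derive1 phi s * (t - s).
  move=> t0 te s0 se; apply: concave_tangent; first exact: desing_derivable D _ s0 (he _ se).
  by move=> l l0 l1; apply: (desing_concave D) => //; rewrite ?he ?ltW.
split => //.
- by move=> s s0 se; exact: desing_ge0 D _ s0 (he _ se).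
- move=> s t t0 ts s0 se; have := tang s t t0 (le_lt_trans ts se) s0 se; lra.
- move=> s t s0; rewrite le_eqVlt => /predU1P[->//|st] te.
  have h1 := tang s t (le_trans (ltW s0) (ltW st)) te s0 (lt_trans st te).
  have h2 := tang t s (ltW s0) (lt_trans st te) (lt_trans s0 st) te.
  have : (derive1 phi t - derive1 phi s) * (t - s) <= 0 by move: h1 h2; lra.
  by rewrite pmulr_lle0 ?subr_gt0// subr_le0.
move=> x x0; have /subspace_continuousP /(_ 0) := desing_cont D.
move=> /(_ (conj (lexx 0) (desing_eta D)))/cvgrPdist_lt/(_ x x0).
rewrite /within /= => /nbhs_normP[d/= d0 hd]; exists (Num.min d e); first by rewrite lt_min d0.
move=> s s0; rewrite lt_min => /andP[sd se].
have := hd s; rewrite /= sub0r normrN ger0_norm// => /(_ sd (conj s0 (he _ se))).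
by rewrite /from_subspace (desing_0 D) sub0r normrN => /ltr_normlW.
Qed.

End DesingularizingFunctions.

Section ClusterPoints.
Context {R : realType} {k : nat}.

Lemma bounded_cluster (x : nat -> 'cV[R]_k) (M : R) : (forall j, nrm (x j) <= M) ->
  exists l, forall (e : R) (N : nat), 0 < e -> exists2 j, (N <= j)%N & nrm (x j - l) < e.
Proof.
move=> xM; pose y j : 'rV[R]_k := (x j)^T.
have K : compact [set v : 'rV[R]_k | forall i, `[- M, M]%classic (v ord0 i)].
  by apply: (@rV_compact R k (fun=> `[- M, M]%classic)) => i; exact: segment_compact.
have [|l [_ cl]] := K (y @ \oo) _.
  exists 0%N => // j _ i /=; rewrite /y mxE in_itv/= -ler_norml.
  exact: le_trans (norm_entry_nrm _ _ _) (xM j).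
exists l^T => e N e0.
have yN : (y @ \oo) [set y j | j in [set j | (N <= j)%N]] by exists N => // j Nj; exists j.
have nl : nbhs l [set v | nrm (v - l) < e] by apply/near_nrmP; exists e.
have [_ [[j Nj <-] jl]] := cl _ _ yN nl.
by exists j => //; rewrite -nrm_tr linearB/= trmxK.
Qed.

End ClusterPoints.

(** * Finite length from descent and the KL inequality *)

Section KLSequences.
Context {R : realType} {k : nat}.
Variables (x : nat -> 'cV[R]_k) (s D : nat -> R) (c C : R).
Hypotheses (c_gt0 : 0 < c) (C_ge0 : 0 <= C) (s_ge0 : forall j, 0 <= s j) (D_ge0 : forall j, 0 <= D j).
Hypothesis s_dec : forall j, c * D j ^+ 2 <= s j - s j.+1.
Hypothesis x_step : forall j, nrm (x j.+1 - x j) <= C * D j.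

Lemma gap_seq_mono i j : (i <= j)%N -> s j <= s i.
Proof.
elim: j => [|j ih]; first by rewrite leqn0 => /eqP ->.
rewrite leq_eqVlt => /predU1P[->//|ij]; apply: le_trans (ih ij).
have := s_dec j; have : 0 <= c * D j ^+ 2 by rewrite mulr_ge0 ?sqr_ge0 ?ltW.
by lra.
Qed.

Lemma gap_seq_zero i j : s i = 0 -> (i <= j)%N -> s j = 0 /\ D j = 0.
Proof.
move=> si ij; have sj l : (i <= l)%N -> s l = 0.
  by move=> il; apply/eqP; rewrite eq_le s_ge0 andbT -si gap_seq_mono.
split; first exact: sj.
have := s_dec j; rewrite (sj j ij) (sj j.+1 (leqW ij)) subrr => h.
have : D j ^+ 2 <= 0 by rewrite -(pmulr_rle0 _ c_gt0).
by move=> h2; apply/eqP; rewrite -sqrf_eq0 eq_le h2 sqr_ge0.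
Qed.

Variables (psi psid : R -> R) (eta : R).
Hypothesis psi_tangent : forall u t, 0 <= t -> t <= u -> 0 < u -> u < eta ->
  psid u * (u - t) <= psi u - psi t.
Hypothesis psi_ge0 : forall u, 0 <= u -> u < eta -> 0 <= psi u.

(** The tangent inequality gives [psi (s j) - psi (s j.+1) >= psid (s j) c D^2 >= c D]. At
    [s j = 0], outside the reach of KL, descent already forces [D j = 0]. *)
Lemma KL_increment j : s j < eta -> (0 < s j -> 1 <= psid (s j) * D j) ->
  c * D j <= psi (s j) - psi (s j.+1).
Proof.
move=> sj KL; have [s0|s0] := eqVneq (s j) 0.
  have [s1 _] := gap_seq_zero s0 (leqnSn j); have [_ D0] := gap_seq_zero s0 (leqnn j).
  by rewrite s1 s0 D0 mulr0 subrr.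
have {}s0 : 0 < s j by rewrite lt_def s0 s_ge0.
have := psi_tangent (s_ge0 j.+1) (gap_seq_mono (leqnSn j)) s0 sj; apply: le_trans.
have {}KL := KL s0; have p0 : 0 < psid (s j).
  rewrite ltNge; apply/negP => p0; have : psid (s j) * D j <= 0 by rewrite mulr_le0_ge0.
  by rewrite leNgt (lt_le_trans ltr01 KL).
have h1 : psid (s j) * (c * D j ^+ 2) <= psid (s j) * (s j - s j.+1) by rewrite ler_pM2l.
apply: le_trans h1; have -> : psid (s j) * (c * D j ^+ 2) = c * D j * (psid (s j) * D j) by ring.
by rewrite -[leLHS]mulr1 ler_wpM2l// mulr_ge0// ltW.
Qed.

Lemma KL_length N j : (forall i, (N <= i)%N -> (i < j)%N -> s i < eta /\ (0 < s i -> 1 <= psid (s i) * D i)) ->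
  (N <= j)%N -> nrm (x j - x N) <= C / c * (psi (s N) - psi (s j)).
Proof.
elim: j => [|j ih] KL; first by rewrite leqn0 => /eqP ->; rewrite !subrr nrm0 mulr0.
rewrite leq_eqVlt => /predU1P[->|Nj]; first by rewrite !subrr nrm0 mulr0.
have [|sj KLj] := KL j Nj _; first exact: ltnSn.
have {}ih := ih (fun i Ni ij => KL i Ni (ltnW ij)) Nj.
apply: le_trans (nrmD_sub _ (x j) _) _.
have h := KL_increment sj KLj.
have h2 : C * D j <= C / c * (psi (s j) - psi (s j.+1)).
  by rewrite -mulrA; apply: ler_wpM2l => //; rewrite ler_pdivlMl.
have := x_step j; rewrite mulrBr in ih; rewrite mulrBr in h2; rewrite mulrBr; move: ih h2; lra.
Qed.

(** KL is available only near [l]. By strong induction, as long as the earlier iterates are in the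
    ball, the length estimate keeps the next one there. *)
Lemma KL_trap (l : 'cV[R]_k) (delta : R) N :
  (forall j, nrm (x j - l) < delta -> 0 < s j -> s j < eta -> 1 <= psid (s j) * D j) ->
  s N < eta -> nrm (x N - l) + C / c * psi (s N) < delta ->
  forall j, (N <= j)%N -> nrm (x j - l) <= nrm (x N - l) + C / c * psi (s N).
Proof.
move=> KL sN start j; have eta_s i : (N <= i)%N -> s i < eta.
  by move=> Ni; exact: le_lt_trans (gap_seq_mono Ni) sN.
elim/ltn_ind: j => j ih Nj; apply: le_trans (nrmD_sub _ (x N) _) _.
rewrite addrC lerD2l; apply: le_trans (KL_length _ Nj) _.
  move=> i Ni ij; split; first exact: eta_s.
  by move=> si; apply: KL => //; [exact: le_lt_trans (ih i ij Ni) start|exact: eta_s].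
apply: ler_wpM2l; first by rewrite divr_ge0// ltW.
by rewrite gerBl psi_ge0// eta_s.
Qed.

End KLSequences.

Section Convergence.
Context {R : realType} {n m : nat} {Rw Cw : 'M[R]_n} {r c : 'cV[R]_n}.
Context {LF eps_x eps_y eps kappa alpha : R} {f : 'I_n -> 'cV[R]_m -> R} {L : 'I_n -> R}.
Hypothesis mix : mixing Rw Cw r c.
Hypothesis step : step_size Rw Cw r c (sup (range L)) LF eps_x eps_y eps kappa alpha.
Hypotheses (alpha_gt0 : 0 < alpha) (m_gt0 : (0 < m)%N).
Hypothesis f_C2 : forall i, C_class 2 (f i).
Hypotheses (f_lip : forall i, lipschitz2 (L i) (gradient (f i)))
  (F_lip : lipschitz2 LF (gradient (Fsum f))) (F_coercive : coercive (Fsum f)).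

Let g := genstep Rw Cw alpha (gradF f).
Let Lc_ge0 : 0 <= sup (range L) := sup_L_ge0 m_gt0 f_lip.
Let LF_ge0 : 0 <= LF := lipschitz2_ge0 m_gt0 F_lip.
Let G_lip := gradF_lip m_gt0 f_lip.

(** Outside a ball coercivity gives the bound 0; inside it the descent inequality from t to the
    origin bounds F from below. *)
Lemma coercive_bounded_below : exists b, forall t, b <= Fsum f t.
Proof.
have [B hB] := F_coercive 0; pose B' := `|B|.
pose g0 := nrm (gradient (Fsum f) 0).
exists (Num.min 0 (Fsum f 0 - (g0 + LF * B') * B' - LF / 2 * B' ^+ 2)) => t.
have [tB|tB] := leP B (nrm t); first by rewrite ge_min; apply/orP; left; apply: hB; rewrite norm2E.
have {}tB : nrm t <= B' by apply: le_trans (ltW tB) (ler_norm _).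
rewrite ge_min; apply/orP; right.
have := lipschitz_gradient_descent t (- t) (differentiable_Fsum f_C2) F_lip.
rewrite subrr ipNr nrmN => h.
have gt : nrm (gradient (Fsum f) t) <= g0 + LF * B'.
  rewrite -[gradient _ t](subrK (gradient (Fsum f) 0)); apply: le_trans (nrmD _ _) _.
  rewrite addrC lerD2l; have := F_lip t 0; rewrite !norm2E subr0 => h1; apply: le_trans h1 _.
  exact: ler_wpM2l.
have n0 := nrm_ge0 t; have B0 : 0 <= B' by exact: normr_ge0.
have h1 : - ip (gradient (Fsum f) t) t <= (g0 + LF * B') * B'.
  apply: le_trans (ler_norm _) _; rewrite normrN; apply: le_trans (ler_norm_ip _ _) _.
  by apply: ler_pM; rewrite ?nrm_ge0.
have h2 : LF / 2 * nrm t ^+ 2 <= LF / 2 * B' ^+ 2.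
  apply: ler_wpM2l; first by rewrite divr_ge0.
  by rewrite ler_pXn2r.
move: h h1 h2; lra.
Qed.

Variable u0 : 'cV[R]_(n * m + n * m).
Hypothesis u0_bal : balanced u0.

Definition dseq j := iter j (genstep Rw Cw alpha (gradF f)) u0.
Definition lyapseq j := stlyap (r := r) (c := c) (kappa := kappa) (gradF f) (Fsum f) (dseq j).
Definition gapseq j := Num.sqrt (stgap (r := r) (c := c) (gradF f) (dseq j)).
(** The values decrease, so their infimum is also their limit, which is identified at a cluster
    point by [lyapinf_cluster]. *)
Definition lyapinf := inf (range lyapseq).
Definition excess j := lyapseq j - lyapinf.

Lemma dseq_balanced j : balanced (dseq j).
Proof. by elim: j => //= j ih; exact: (balanced_genstep mix). Qed.

Lemma gapseq_ge0 j : 0 <= gapseq j.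
Proof. exact: sqrtr_ge0. Qed.

Lemma gapseq_sq j : gapseq j ^+ 2 = stgap (r := r) (c := c) (gradF f) (dseq j).
Proof. by rewrite sqr_sqrtr//; exact: gap_ge0. Qed.

Lemma lyapseq_descent : exists2 c0, 0 < c0 & forall j, c0 * gapseq j ^+ 2 <= lyapseq j - lyapseq j.+1.
Proof.
have [c0 c00 h] := stlyap_descent (m := m) mix step alpha_gt0 Lc_ge0 LF_ge0.
exists c0 => // j; rewrite gapseq_sq.
have h1 : lyapseq j.+1 <= lyapseq j - c0 * stgap (r := r) (c := c) (gradF f) (dseq j).
  exact: h _ _ _ (gradF_model f_C2 m_gt0 f_lip F_lip) (dseq_balanced j).
by rewrite lerBrDr addrC -lerBrDr.
Qed.

Lemma Fsum_le_lyapseq j : Fsum f (stX (dseq j) *m r) <= lyapseq j.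
Proof.
rewrite /lyapseq /stlyap /lyap -addrA lerDl addr_ge0 ?sqr_ge0// mulr_ge0 ?sqr_ge0//.
exact: ltW (ss_kappa_gt0 step).
Qed.

Lemma lyapseq_lbound : has_lbound (range lyapseq).
Proof.
have [b hb] := coercive_bounded_below; exists b => _ [j _ <-].
exact: le_trans (hb _) (Fsum_le_lyapseq j).
Qed.

Lemma excess_ge0 j : 0 <= excess j.
Proof. by rewrite subr_ge0; apply: ge_inf; [exact: lyapseq_lbound|exists j]. Qed.

Lemma excess_descent : exists2 c0, 0 < c0 & forall j, c0 * gapseq j ^+ 2 <= excess j - excess j.+1.
Proof.
have [c0 c00 h] := lyapseq_descent; exists c0 => // j; apply: le_trans (h j) _.
by rewrite /excess opprB addrA subrK.
Qed.

Lemma excess_to0 (e : R) : 0 < e -> exists N, forall j, (N <= j)%N -> excess j < e.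
Proof.
move=> e0; have hi : has_inf (range lyapseq).
  by split; [exists (lyapseq 0); exists 0%N|exact: lyapseq_lbound].
have [_ [N _ <-] hN] := inf_adherent e0 hi.
have [c0 c00 h] := excess_descent.
exists N => j Nj; apply: le_lt_trans (gap_seq_mono c00 h Nj) _.
by rewrite /excess ltrBlDl.
Qed.

Lemma gapseq_to0 (e : R) : 0 < e -> exists N, forall j, (N <= j)%N -> gapseq j < e.
Proof.
move=> e0; have [c0 c00 h] := excess_descent.
have [N hN] := excess_to0 (mulr_gt0 c00 (exprn_gt0 2 e0)).
exists N => j Nj; rewrite -(ltr_pXn2r (ltn0Sn 1)) ?nnegrE ?gapseq_ge0 ?ltW//.
rewrite -(ltr_pM2l c00); apply: le_lt_trans (h j) _; apply: le_lt_trans (hN j Nj).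
by rewrite gerBl excess_ge0.
Qed.

Lemma dseq_step : exists2 K, 0 <= K & forall j, nrm (dseq j.+1 - dseq j) <= K * gapseq j.
Proof.
have [K K0 h] := genstep_move (m := m) mix step alpha_gt0.
exists (Num.sqrt K); first exact: sqrtr_ge0.
move=> j; rewrite -(ler_pXn2r (ltn0Sn 1)) ?nnegrE ?mulr_ge0 ?nrm_ge0 ?sqrtr_ge0//.
by rewrite exprMn (sqr_sqrtr K0) gapseq_sq; exact: h.
Qed.

Lemma perp_le_gapseq j : nrm (stX (dseq j) *m perpR r) <= K2R r * gapseq j.
Proof.
have K0 : 0 <= K2R r by rewrite /K2R divr_ge0 ?sqrtr_ge0.
rewrite -(ler_pXn2r (ltn0Sn 1)) ?nnegrE ?nrm_ge0 ?mulr_ge0 ?gapseq_ge0//.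
apply: le_trans (nrm_perp_le mix _) _; rewrite [leRHS]exprMn gapseq_sq.
by apply: ler_wpM2l; [exact: sqr_ge0|exact: resR_le_gap].
Qed.

Lemma Y_le_gapseq : exists2 K, 0 <= K & forall j, nrm (stY (gradF f) (dseq j)) <= K * gapseq j.
Proof.
pose K := 2 * (1 + K2C c ^+ 2); have K0 : 0 <= K by rewrite /K mulr_ge0 ?addr_ge0 ?sqr_ge0.
exists (Num.sqrt K); first exact: sqrtr_ge0.
move=> j; rewrite -(ler_pXn2r (ltn0Sn 1)) ?nnegrE ?mulr_ge0 ?nrm_ge0 ?sqrtr_ge0//.
rewrite exprMn (sqr_sqrtr K0) gapseq_sq; exact: nrm_Y_gap mix _ _.
Qed.

Lemma grad_le_gapseq : exists2 K, 0 <= K &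
  forall j, nrm (gradient (Fsum f) (stX (dseq j) *m r)) <= K * gapseq j.
Proof.
have [K K0 h] := mean_gradient_gap (m := m) mix Lc_ge0.
exists (Num.sqrt K); first exact: sqrtr_ge0.
move=> j; rewrite -(ler_pXn2r (ltn0Sn 1)) ?nnegrE ?mulr_ge0 ?nrm_ge0 ?sqrtr_ge0//.
rewrite exprMn (sqr_sqrtr K0) gapseq_sq (gradient_Fsum_gradF f_C2).
exact: h G_lip (dseq_balanced j).
Qed.

(** Coercivity bounds only the mean [X r]; the gap bounds the consensus error and Y, and Lipschitz
    continuity then bounds [H = Y - G X]. *)
Lemma dseq_bounded : exists M, forall j, nrm (dseq j) <= M.
Proof.
have [c0 c00 hd] := excess_descent.
have [B hB] := F_coercive (lyapseq 0 + 1).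
have mono j : lyapseq j <= lyapseq 0.
  by have := gap_seq_mono c00 hd (leq0n j); rewrite /excess lerD2r.
have tB j : nrm (stX (dseq j) *m r) <= B.
  rewrite leNgt; apply/negP => h; have := hB (stX (dseq j) *m r); rewrite norm2E => /(_ (ltW h)).
  have := le_trans (Fsum_le_lyapseq j) (mono j).
  by move: (Fsum f _) (lyapseq 0) => a b h1 h2; lra.
pose Gm := excess 0 / c0 + 1.
have gG j : gapseq j <= Gm.
  have E0 := excess_ge0 0; have q0 : 0 <= excess 0 / c0 by rewrite divr_ge0// ltW.
  have h1 : gapseq j ^+ 2 <= excess 0 / c0.
    rewrite ler_pdivlMr// mulrC; apply: le_trans (hd j) _.
    apply: le_trans (gap_seq_mono c00 hd (leq0n j)).
    by rewrite gerBl excess_ge0.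
  rewrite -(ler_pXn2r (ltn0Sn 1)) ?nnegrE ?gapseq_ge0//; last by rewrite addr_ge0.
  apply: le_trans h1 _; move: q0; rewrite /Gm; move: (excess 0 / c0) => q q0.
  by have := sqr_ge0 q; lra.
have [KY KY0 hY] := Y_le_gapseq.
have K0 : 0 <= K2R r by rewrite /K2R divr_ge0 ?sqrtr_ge0.
pose MX := B * nrm (ones : 'cV[R]_n)^T + K2R r * Gm.
have hX j : nrm (stX (dseq j)) <= MX.
  rewrite {1}(@perpR_split _ _ _ r (stX (dseq j))); apply: le_trans (nrmD _ _) _; apply: lerD.
    apply: le_trans (nrmM _ _) _; apply: ler_wpM2r; [exact: nrm_ge0|exact: tB].
  by apply: le_trans (perp_le_gapseq j) _; exact: ler_wpM2l.
pose MG := nrm (gradF f (0 : 'M[R]_(m, n))) + sup (range L) * MX.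
exists (MX + (KY * Gm + MG)) => j; apply: le_trans (nrm_state_le _) _; apply: lerD => //.
have -> : stH (dseq j) = stY (gradF f) (dseq j) - gradF f (stX (dseq j)) by rewrite /stY addrK.
apply: le_trans (nrmD _ _) _; rewrite nrmN; apply: lerD.
  by apply: le_trans (hY j) _; exact: ler_wpM2l.
rewrite -[gradF f _](subrK (gradF f 0)); apply: le_trans (nrmD _ _) _; rewrite /MG addrC lerD2l.
by apply: le_trans (G_lip _ _) _; rewrite subr0; exact: ler_wpM2l.
Qed.

Lemma nrm_mean_le (u v : 'cV[R]_(n * m + n * m)) : nrm (stX u *m r - stX v *m r) <= nrm (u - v).
Proof.
rewrite -mulmxBl -(linmapB_eq linmap_stX u); apply: le_trans (nrmM _ _) _.
apply: le_trans (nrm_stX _); rewrite ler_piMr ?nrm_ge0//; exact: nrm_r_le1 mix.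
Qed.

(** The error terms vanish with the gap and F is continuous at the mean. Thus the KL inequality of F
    at the cluster point refers to the same level as the excess. *)
Lemma lyapinf_cluster (us : 'cV[R]_(n * m + n * m)) :
  (forall (e : R) N, 0 < e -> exists2 j, (N <= j)%N & nrm (dseq j - us) < e) ->
  lyapinf = Fsum f (stX us *m r).
Proof.
move=> cl; set t := stX us *m r; have ka0 := ss_kappa_gt0 step.
apply/eqP; rewrite -subr_eq0 -normr_le0; apply/ler_addgt0Pr => e e0; rewrite add0r.
have e3 : 0 < e / 3 by rewrite divr_gt0.
have cF : {for t, continuous (Fsum f)} by exact/differentiable_continuous/differentiable_Fsum.
have /near_nrmP[d d0 hd] : \forall y \near t, `|Fsum f t - Fsum f y| < e / 3.
  by move/cvgrPdist_lt: cF; apply.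
have [N1 h1] := excess_to0 e3.
have d20 : 0 < Num.min 1 (e / 3 / (1 + kappa)).
  by rewrite lt_min ltr01 !divr_gt0// addr_gt0.
have [N2 h2] := gapseq_to0 d20.
have [j Nj jd] := cl d (maxn N1 N2) d0; rewrite geq_max in Nj; move/andP: Nj => [Nj1 Nj2].
have {}h1 := h1 j Nj1; have {}h2 := h2 j Nj2.
have {}hd := hd _ (le_lt_trans (nrm_mean_le _ _) jd).
have h3 : lyapseq j - Fsum f (stX (dseq j) *m r) <= e / 3.
  have E : lyapseq j - Fsum f (stX (dseq j) *m r) =
     resR r (stX (dseq j)) + kappa * resC c (stY (gradF f) (dseq j)).
    by rewrite /lyapseq /stlyap /lyap; move: (Fsum f _) (resR _ _) (resC _ _) => x y z; ring.
  have q1 : resR r (stX (dseq j)) <= gapseq j ^+ 2 by rewrite gapseq_sq; exact: resR_le_gap.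
  have q2 : resC c (stY (gradF f) (dseq j)) <= gapseq j ^+ 2 by rewrite gapseq_sq; exact: resC_le_gap.
  rewrite {}E; apply: (@le_trans _ _ ((1 + kappa) * gapseq j ^+ 2)).
    by rewrite mulrDl mul1r; apply: lerD => //; apply: ler_wpM2l => //; exact: ltW.
  rewrite mulrC -ler_pdivlMr ?addr_gt0//; move: h2; rewrite lt_min => /andP[g1 g2].
  apply: le_trans (ltW g2); rewrite expr2 ler_piMr ?gapseq_ge0//; exact: ltW.
have h4 := Fsum_le_lyapseq j; have h5 := excess_ge0 j.
have E : lyapinf - Fsum f t = (lyapseq j - Fsum f (stX (dseq j) *m r)) - excess j
   + - (Fsum f t - Fsum f (stX (dseq j) *m r)) by rewrite /excess; move: (lyapseq j) lyapinf (Fsum f _) (Fsum f _) => x y z w; ring.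
rewrite {}E; apply: le_trans (ler_normD _ _) _; rewrite normrN.
apply: (@le_trans _ _ ((e / 3 + e / 3) + e / 3)); last by lra.
apply: lerD; last exact: ltW.
apply: le_trans (ler_normB _ _) _; apply: lerD.
  by rewrite ger0_norm ?subr_ge0.
by rewrite ger0_norm// ltW.
Qed.

End Convergence.

Lemma sqrt_tangent (R : realType) (u t : R) : 0 <= t -> t <= u -> 0 < u ->
  (Num.sqrt u)^-1 * (u - t) <= 2 * (Num.sqrt u - Num.sqrt t).
Proof.
move=> t0 tu u0; have p0 : 0 < Num.sqrt u by rewrite sqrtr_gt0.
have qp : Num.sqrt t <= Num.sqrt u by rewrite ler_wsqrtr.
have q0 := sqrtr_ge0 t; rewrite ler_pdivrMl//.
rewrite -{1}(sqr_sqrtr (ltW u0)) -{1}(sqr_sqrtr t0).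
move: (Num.sqrt u) (Num.sqrt t) p0 qp q0 => p q p0 qp q0.
have : 0 <= (p - q) * (p - q) by rewrite -expr2 sqr_ge0.
lra.
Qed.

Lemma sqrt_small (R : realType) (e : R) : 0 < e ->
  exists2 d, 0 < d & forall u, 0 <= u -> u < d -> Num.sqrt u < e.
Proof.
move=> e0; exists (e ^+ 2); first by rewrite exprn_gt0.
move=> u u0 ue; rewrite -(ltr_pXn2r (ltn0Sn 1)) ?nnegrE ?sqrtr_ge0 ?ltW//.
by rewrite sqr_sqrtr.
Qed.

Section KLConvergence.
Context {R : realType} {n m : nat} {Rw Cw : 'M[R]_n} {r c : 'cV[R]_n}.
Context {LF eps_x eps_y eps kappa alpha : R} {f : 'I_n -> 'cV[R]_m -> R} {L : 'I_n -> R}.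
Hypothesis mix : mixing Rw Cw r c.
Hypothesis step : step_size Rw Cw r c (sup (range L)) LF eps_x eps_y eps kappa alpha.
Hypotheses (alpha_gt0 : 0 < alpha) (m_gt0 : (0 < m)%N).
Hypothesis f_C2 : forall i, C_class 2 (f i).
Hypotheses (f_lip : forall i, lipschitz2 (L i) (gradient (f i)))
  (F_lip : lipschitz2 LF (gradient (Fsum f))) (F_coercive : coercive (Fsum f)).
Variable u0 : 'cV[R]_(n * m + n * m).
Hypothesis u0_bal : balanced u0.

Let x := dseq (Rw := Rw) (Cw := Cw) (alpha := alpha) (f := f) u0.
Let D := gapseq (Rw := Rw) (Cw := Cw) (r := r) (c := c) (alpha := alpha) (f := f) u0.
Let s := excess (Rw := Rw) (Cw := Cw) (r := r) (c := c) (kappa := kappa) (alpha := alpha) (f := f) u0.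

(* Where the excess [s] is mostly due to the sum, use its KL inequality at [s / 2]; otherwise
   the quadratic terms of the Lyapunov function give [D^2 >= s / (2 (1 + kappa))]. *)
Lemma KL_excess (us : 'cV[R]_(n * m + n * m)) : KL_function (Fsum f) ->
  (forall (e : R) N, 0 < e -> exists2 j, (N <= j)%N & nrm (x j - us) < e) ->
  exists (psi psid : R -> R) (eta delta : R), 0 < eta /\ 0 < delta /\
  [/\ forall u t, 0 <= t -> t <= u -> 0 < u -> u < eta -> psid u * (u - t) <= psi u - psi t,
      forall u, 0 <= u -> u < eta -> 0 <= psi u,
      forall e : R, 0 < e -> exists2 d, 0 < d & forall u, 0 <= u -> u < d -> psi u < e
    & forall j, nrm (x j - us) < delta -> 0 < s j -> s j < eta -> 1 <= psid (s j) * D j].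
Proof.
move=> [_ KLF] cl; have ka0 := ss_kappa_gt0 step.
have infE := lyapinf_cluster mix step alpha_gt0 m_gt0 f_C2 f_lip F_lip F_coercive u0_bal cl.
set t0 := stX us *m r in infE; have [phi [et [dphi KLi]]] := KLF t0.
have [e e0 [he phi0 phiT phiM phiS]] := desing_properties dphi.
have /near_nrmP[delta delta0 hdelta] := KLi.
have [K K0 hK] := grad_le_gapseq (alpha := alpha) mix m_gt0 f_C2 f_lip u0_bal.
pose K3 := Num.sqrt (2 * (1 + kappa)); have k30 : 0 < 2 * (1 + kappa) by rewrite mulr_gt0// addr_gt0.
have K30 : 0 < K3 by rewrite sqrtr_gt0.
pose K' := K + 1; have K'0 : 0 < K' by rewrite /K' ltr_wpDl.
(* The factors 2 are those for which the second function is the derivative of this one. [K'] is made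
   positive by [+ 1], and [K3] comes from the case where the quadratic terms dominate. *)
exists (fun u => 2 * K' * phi (u / 2) + 2 * K3 * Num.sqrt u).
exists (fun u => K' * derive1 phi (u / 2) + K3 * (Num.sqrt u)^-1).
exists e, delta; split => //; split => //; split.
- move=> u t t00 tu u00 ue.
  have h1 : derive1 phi (u / 2) * (u / 2 - t / 2) <= phi (u / 2) - phi (t / 2).
    apply: phiT; [by rewrite divr_ge0|by rewrite ler_pM2r ?invr_gt0|by rewrite divr_gt0|].
    by apply: lt_trans ue; rewrite gtr_pMr// invf_lt1// ltr1n.
  have h2 := sqrt_tangent t00 tu u00.
  have h3 := ler_wpM2l (ltW K'0) h1; have h4 := ler_wpM2l (ltW K30) h2.
  move: (derive1 phi (u / 2)) (phi (u / 2)) (phi (t / 2)) (Num.sqrt u)^-1 (Num.sqrt u) (Num.sqrt t) h3 h4.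
  by move=> d p q i a b h3 h4; lra.
- move=> u u00 ue; have pu : 0 <= phi (u / 2).
    apply: phi0; first by rewrite divr_ge0.
    by apply: le_lt_trans ue; rewrite ler_piMr// invf_le1// ler1n.
  apply: addr_ge0; first by rewrite !mulr_ge0// ltW.
  by rewrite !mulr_ge0 ?sqrtr_ge0// ltW.
- move=> y y0.
  have [d1 d10 h1] := phiS (y / (4 * K')) (divr_gt0 y0 (mulr_gt0 (ltr0Sn _ 3) K'0)).
  have [d2 d20 h2] := sqrt_small (divr_gt0 y0 (mulr_gt0 (ltr0Sn R 3) K30)).
  exists (Num.min d1 d2); first by rewrite lt_min d10.
  move=> u u00; rewrite lt_min => /andP[ud1 ud2].
  have := h2 u u00 ud2; rewrite ltr_pdivlMr ?mulr_gt0// => {}h2.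
  have : phi (u / 2) < y / (4 * K').
    apply: h1; first by rewrite divr_ge0.
    by apply: le_lt_trans ud1; rewrite ler_piMr// invf_le1// ler1n.
  rewrite ltr_pdivlMr ?mulr_gt0//; move: h2; move: (phi _) (Num.sqrt u) => a b h2 h1'; lra.
move=> j jd s0 se; set t := stX (x j) *m r.
have tt0 : nrm (t - t0) < delta by apply: le_lt_trans (nrm_mean_le mix _ _) jd.
pose a := Fsum f t - Fsum f t0.
pose b := resR r (stX (x j)) + kappa * resC c (stY (gradF f) (x j)).
have sE : s j = a + b.
  rewrite /s /excess infE /lyapseq /stlyap /lyap -/x -/t /a /b.
  by move: (Fsum f _) (Fsum f _) (resR _ _) (resC _ _) => y1 y2 y3 y4; ring.
have bD : b <= (1 + kappa) * D j ^+ 2.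
  rewrite /D gapseq_sq mulrDl mul1r; apply: lerD; first exact: resR_le_gap.
  by apply: ler_wpM2l; [exact: ltW|exact: resC_le_gap].
have b0 : 0 <= b by rewrite addr_ge0 ?sqr_ge0// mulr_ge0 ?sqr_ge0// ltW.
have D0 : 0 <= D j by exact: gapseq_ge0.
have rs0 : 0 < Num.sqrt (s j) by rewrite sqrtr_gt0.
have s20 : 0 < s j / 2 by rewrite divr_gt0.
have s2e : s j / 2 < e by apply: lt_trans se; rewrite gtr_pMr// invf_lt1// ltr1n.
have dp (y : R) : 0 < y -> y < e -> 0 < derive1 phi y.
  by move=> y0 ye; apply: (desing_deriv_gt0 dphi) => //; exact: he.
rewrite mulrDl; have [sa|sa] := leP (s j / 2) a.
  have a0 : 0 < a := lt_le_trans s20 sa.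
  have ae : a < e by apply: le_lt_trans se; rewrite sE lerDl.
  have := hdelta t tt0; rewrite -subr_gt0 => /(_ a0).
  have -> : ((Fsum f t)%:E < (Fsum f t0)%:E + et)%E.
    have -> : Fsum f t = Fsum f t0 + a by rewrite /a addrC subrK.
    by rewrite EFinD lteD2lE// he.
  move=> /(_ isT); rewrite -/a norm2E => h1.
  have h2 := phiM _ _ s20 sa ae; have h3 : nrm (gradient (Fsum f) t) <= K' * D j.
    by apply: le_trans (hK j) _; rewrite ler_wpM2r// lerDl.
  apply: (@le_trans _ _ (K' * derive1 phi (s j / 2) * D j)); last first.
    by rewrite lerDl !mulr_ge0// ?invr_ge0 ltW.
  apply: le_trans h1 _; rewrite [K' * _]mulrC -mulrA.
  apply: ler_pM => //; [exact: ltW (dp _ a0 ae)|exact: nrm_ge0].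
apply: (@le_trans _ _ (K3 * (Num.sqrt (s j))^-1 * D j)); last first.
  by rewrite lerDr !mulr_ge0// ltW// dp.
rewrite mulrAC ler_pdivlMr// mul1r.
rewrite -(ler_pXn2r (ltn0Sn 1)) ?nnegrE ?mulr_ge0 ?(ltW K30) ?(ltW rs0)//.
rewrite exprMn (sqr_sqrtr (ltW k30)) (sqr_sqrtr (ltW s0)).
clearbody a b; move: bD sa; rewrite sE; move: (D j ^+ 2) => d h1 h2; lra.
Qed.

(** Start from an iterate close to the cluster point at which the remaining length is also small;
    [KL_trap] then confines the whole tail. *)
Lemma dseq_converges : KL_function (Fsum f) ->
  exists us, forall e : R, 0 < e -> exists N, forall j, (N <= j)%N -> nrm (x j - us) < e.
Proof.
move=> KLF.
have [M hM] := dseq_bounded mix step alpha_gt0 m_gt0 f_C2 f_lip F_lip F_coercive u0_bal.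
have [us cl] := bounded_cluster hM; exists us => e0 e00.
have [psi [psid [eta [delta [eta0 [delta0 [psiT psi0 psiS KL]]]]]]] := KL_excess KLF cl.
have [c0 c00 hs] := excess_descent mix step alpha_gt0 m_gt0 f_C2 f_lip F_lip u0_bal.
have [C C0 hx] := dseq_step (f := f) mix step alpha_gt0 u0.
have s_ge0 j : 0 <= s j by exact: excess_ge0 step m_gt0 f_C2 F_lip F_coercive u0 j.
have D_ge0 j : 0 <= D j by exact: gapseq_ge0.
have trap := KL_trap c00 C0 s_ge0 D_ge0 hs hx psiT psi0 KL.
pose d := Num.min delta e0 / 2; have d0 : 0 < d by rewrite divr_gt0// lt_min delta0.
pose Cc := C / c0 + 1; have Cc0 : 0 < Cc by rewrite ltr_wpDl// divr_ge0// ltW.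
have [d1 d10 hd1] := psiS (d / Cc) (divr_gt0 d0 Cc0).
have m0 : 0 < Num.min d1 eta by rewrite lt_min d10.
have [N0 hN0] := excess_to0 mix step alpha_gt0 m_gt0 f_C2 f_lip F_lip F_coercive u0_bal m0.
have [N N0N xN] := cl d N0 d0.
have := hN0 N N0N; rewrite lt_min => /andP[sN1 sN2].
have h1 : C / c0 * psi (s N) < d.
  have := hd1 (s N) (s_ge0 N) sN1; rewrite ltr_pdivlMr// => h; apply: le_lt_trans h.
  rewrite mulrC; apply: ler_wpM2l; last by rewrite lerDl.
  exact: psi0.
have start : nrm (x N - us) + C / c0 * psi (s N) < Num.min delta e0.
  have -> : Num.min delta e0 = d + d by rewrite /d -splitr.
  exact: ltrD.
exists N => j Nj; apply: le_lt_trans (trap N sN2 _ j Nj) _.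
  by apply: lt_le_trans start _; rewrite ge_min lexx.
by apply: lt_le_trans start _; rewrite ge_min lexx orbT.
Qed.

End KLConvergence.

(** * Convergence rates *)

Section Rates.
Context {R : realType} {s : nat -> R} {q th : R} {N : nat}.
Hypotheses (s_ge0 : forall j, 0 <= s j) (s_mono : forall j, s j.+1 <= s j) (q_gt0 : 0 < q).
Hypothesis s_step : forall j, (N <= j)%N -> 0 < s j -> s j.+1 <= s j - q * s j `^ (2 * th).

(** For exponent 0 every step from a positive value decreases it by at least q, impossible once the
    value is below q. *)
Lemma finite_rate : th = 0 -> (exists2 j, (N <= j)%N & s j < q) -> exists2 j, (N <= j)%N & s j = 0.
Proof.
move=> th0 [j Nj sq]; exists j => //; apply/eqP; rewrite eq_le s_ge0 andbT leNgt; apply/negP => s0.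
have := s_step Nj s0; rewrite th0 mulr0 powRr0 mulr1; have := s_ge0 j.+1; move: sq; lra.
Qed.

(** Values are at most 1 and [2 th <= 1], so the decrease is at least [q s]; the minimum with [1/2]
    keeps the ratio positive. The square root appears because [1 - th >= 1/2]. *)
Lemma linear_rate (k : nat) : 0 < th -> th <= 1 / 2 -> s N <= 1 ->
  s (N + k)%N `^ (1 - th) <= Num.sqrt (1 - Num.min q (1 / 2)) ^+ k.
Proof.
move=> th0 th1 sN; pose t := 1 - Num.min q (1 / 2).
have t0 : 0 < t by rewrite subr_gt0 gt_min; apply/orP; right; lra.
have sk : s (N + k)%N <= t ^+ k.
  elim: k => [|k ih]; first by rewrite addn0 expr0.
  rewrite addnS exprS; have [s0|s0] := ltP 0 (s (N + k)%N); last first.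
    apply: le_trans (s_mono _) _; apply: le_trans s0 _.
    by rewrite mulr_ge0 ?exprn_ge0 ?ltW.
  have s1 : s (N + k)%N <= 1.
    by elim: (k) => [|l ihl]; rewrite ?addn0// addnS; exact: le_trans (s_mono _) ihl.
  apply: le_trans (s_step (leq_addr _ _) s0) _; apply: (@le_trans _ _ (t * s (N + k)%N)); last first.
    by rewrite ler_pM2l.
  have h1 : Num.min q (1 / 2) * s (N + k)%N <= q * s (N + k)%N by rewrite ler_pM2r// ge_min lexx.
  have h2 : q * s (N + k)%N <= q * s (N + k)%N `^ (2 * th).
    by rewrite ler_pM2l//; apply: ger1_powR; [rewrite s0|lra].
  by move: h1 h2; rewrite /t; move: (Num.min q (1 / 2)) (s (N + k)%N `^ (2 * th)) => y z; lra.
rewrite -/t; have [s0|s0] := ltP 0 (s (N + k)%N); last first.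
  have -> : s (N + k)%N = 0 by apply/eqP; rewrite eq_le s0 s_ge0.
  rewrite powR0 ?exprn_ge0 ?sqrtr_ge0//; apply/eqP => h; lra.
have s1 : s (N + k)%N <= 1.
  by elim: (k) => [|l ihl]; rewrite ?addn0// addnS; exact: le_trans (s_mono _) ihl.
apply: (@le_trans _ _ (s (N + k)%N `^ 2^-1)); first by apply: ger_powR; [rewrite s0|lra].
rewrite (powR12_sqrt (s_ge0 _)) -(ler_pXn2r (ltn0Sn 1)) ?nnegrE ?exprn_ge0 ?sqrtr_ge0//.
by rewrite (sqr_sqrtr (s_ge0 _)) exprAC (sqr_sqrtr (ltW t0)).
Qed.

(** Bernoulli's inequality for a negative power, from [expR y >= 1 + y] and [ln t <= t - 1]. *)
Lemma powRN_bernoulli (p t : R) : 0 <= p -> 0 < t -> 1 + p * (1 - t) <= t `^ (- p).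
Proof.
move=> p0 t0; rewrite /powR gt_eqF//; apply: le_trans (expR_ge1Dx _).
rewrite lerD2l mulNr -mulrN; apply: ler_wpM2l => //.
have := @le_ln1Dx R (t - 1); rewrite [1 + _]addrC subrK => h.
by rewrite lerNr opprB; apply: h; lra.
Qed.

(** With [p = 2 th - 1], Bernoulli for the ratio of successive values shows that the power [- p]
    grows by at least [p q] per step. A zero value is split off, since a negative power of 0 is 0
    here. For [nu >= 2 N] the elapsed time is at least [nu / 2], whence the division by 2. *)
Lemma sublinear_rate (nu : nat) : 1 / 2 < th -> th < 1 -> (N.*2 <= nu)%N -> (0 < nu)%N ->
  s nu `^ (1 - th) <=
    ((2 * th - 1) * q / 2) `^ (- ((1 - th) / (2 * th - 1))) * nu%:R `^ (- ((1 - th) / (2 * th - 1))).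
Proof.
move=> th1 th2 Nnu nu0; set p := 2 * th - 1; have p0 : 0 < p by rewrite /p; lra.
have key k : s (N + k)%N = 0 \/ 0 < s (N + k)%N /\ p * q * k%:R <= s (N + k)%N `^ (- p).
  elim: k => [|k ih].
    have [->|s0] := eqVneq (s (N + 0)%N) 0; [by left|right].
    by rewrite mulr0 powR_ge0 lt_def s0 s_ge0.
  rewrite addnS; have [->|s1] := eqVneq (s (N + k).+1) 0; [by left|right].
  have {}s1 : 0 < s (N + k).+1 by rewrite lt_def s1 s_ge0.
  split=> //; have s0 : 0 < s (N + k)%N := lt_le_trans s1 (s_mono _).
  case: ih => [h|[_ ih]]; first by rewrite h ltxx in s0.
  have st := s_step (leq_addr k N) s0; move: ih st s0 s1.
  move: (s (N + k)%N) (s (N + k).+1) => a b ih st a0 b0.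
  have ap : 0 < a `^ p by exact: powR_gt0.
  have E : a `^ (2 * th) = a * a `^ p.
    rewrite -{2}(powRr1 (ltW a0)) -powRD; last by apply/implyP => _; rewrite gt_eqF.
    by congr (_ `^ _); rewrite /p; ring.
  have t0 : 0 < b / a by rewrite divr_gt0.
  have ta : b / a <= 1 - q * a `^ p.
    by rewrite ler_pdivrMr//; move: st; rewrite E; move: (a `^ p) => d; lra.
  have h := powRN_bernoulli (ltW p0) t0.
  have E2 : b `^ (- p) = (b / a) `^ (- p) * a `^ (- p).
    by rewrite -powRM ?(ltW t0) ?(ltW a0)// divfK// gt_eqF.
  rewrite E2; apply: (@le_trans _ _ ((1 + p * q * a `^ p) * a `^ (- p))).
    have F : a `^ p * a `^ (- p) = 1 by rewrite powRN divff ?gt_eqF.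
    have -> : (1 + p * q * a `^ p) * a `^ (- p) = a `^ (- p) + p * q * (a `^ p * a `^ (- p)) by ring.
    rewrite F -natr1; move: ih; move: (a `^ (- p)) => d; lra.
  apply: ler_wpM2r; first exact: powR_ge0.
  apply: le_trans h; rewrite lerD2l -mulrA; apply: ler_wpM2l; first exact: ltW.
  move: ta; move: (b / a) (a `^ p) => d e'; lra.
have E : nu = (N + (nu - N))%N by rewrite subnKC//; apply: leq_trans Nnu; rewrite -addnn leq_addr.
have n0 : 0 < nu%:R :> R by rewrite ltr0n.
have := key (nu - N)%N; rewrite -E => -[->|[s0 h]].
  rewrite powR0 ?mulr_ge0 ?powR_ge0//; apply/eqP => h; lra.
have c0 : 0 < p * q / 2 by rewrite divr_gt0// mulr_gt0.
rewrite -powRM ?(ltW c0) ?(ltW n0)//; set a := (1 - th) / p.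
have a0 : 0 <= a by apply: divr_ge0; [rewrite subr_ge0|]; exact: ltW.
have -> : 1 - th = - p * - a by rewrite mulrNN mulrC divfK// gt_eqF.
rewrite powRrM [leLHS]powRN [leRHS]powRN lef_pV2 ?posrE ?powR_gt0 ?mulr_gt0//.
have x0 : 0 <= p * q / 2 * nu%:R by rewrite mulr_ge0 ?(ltW c0) ?(ltW n0).
apply: (ge0_ler_powR a0 x0 (powR_ge0 _ _)).
apply: le_trans h; rewrite -[leLHS]mulrA -[leLHS]mulrA -[leRHS]mulrA; do 2!(apply: ler_wpM2l; first exact: ltW).
rewrite mulrC ler_pdivrMr// -natrM ler_nat mulnC mul2n -addnn.
by move: Nnu; rewrite {1}E; lia.
Qed.

End Rates.

(** Test the growth along [h v] with v the gradient: at first order it is [h |v|^2], against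
    [h A |v|], and the quadratic term drops out for small h. *)
Lemma gradient_le_growth (R : realType) (k : nat) (U : 'cV[R]_k -> R) (z : 'cV[R]_k) (A K : R) :
  differentiable U z -> 0 <= A -> 0 <= K ->
  (forall w, U (z + w) - U z <= A * nrm w + K * nrm w ^+ 2) -> nrm (gradient U z) <= A.
Proof.
move=> dU A0 K0 growth; set v := gradient U z; have [v0|v0] := leP (nrm v) 0.
  exact: le_trans v0 A0.
have h0 : z + 0 *: v = z by rewrite scale0r addr0.
have dl : is_derive (0 : R) 1 (fun s : R => U (z + s *: v)) (ip v v).
  by have := @is_derive_line R k U z v 0; rewrite h0; apply.
rewrite -(ler_pM2r v0); apply/ler_addgt0Pr => e e0.
have dv : derivable (fun s : R => U (z + s *: v)) 0 1 by [].
have e20 : 0 < e / 2 by rewrite divr_gt0.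
have [d d0 hd] := derive1_expansion dv e20.
pose K' := K * nrm v ^+ 2 + 1; have K'0 : 0 < K' by rewrite ltr_wpDl// mulr_ge0 ?sqr_ge0.
pose h := Num.min (d / 2) (e / 2 / K').
have hp : 0 < h by rewrite lt_min !divr_gt0.
have := hd h; rewrite gtr0_norm// add0r => /(_ _); have hd2 : h < d.
  by apply: (@le_lt_trans _ _ (d / 2)); [rewrite ge_min lexx|lra].
move=> /(_ hd2); have -> : derive1 (fun s : R => U (z + s *: v)) 0 = nrm v ^+ 2.
  by rewrite derive1E derive_val nrm_sq.
rewrite h0 ler_norml => /andP[/= h1 _].
have := growth (h *: v); rewrite nrmZ gtr0_norm// => h2.
have h3 : h * K' <= e / 2 by rewrite -ler_pdivlMr// ge_min lexx orbT.
rewrite -(ler_pM2l hp); have h4 := ler_wpM2l (ltW hp) h3; rewrite /K' in h4.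
have h5 : 0 <= h * h by rewrite mulr_ge0 ?ltW.
clear h3 hd hd2 hp; clearbody h; move: h1 h2 h4 h5; rewrite !expr2; move: (U (z + h *: v)) (U z); move: (nrm v) h => x y a b; lra.
Qed.

Section LyapunovGradient.
Context {R : realType} {n m : nat} {Rw Cw : 'M[R]_n} {r c : 'cV[R]_n}.
Context {LF kappa : R} {f : 'I_n -> 'cV[R]_m -> R}.
Hypothesis mix : mixing Rw Cw r c.
Hypotheses (kappa_ge0 : 0 <= kappa) (LF_ge0 : 0 <= LF).
Hypothesis f_C2 : forall i, C_class 2 (f i).
Hypothesis F_lip : lipschitz2 LF (gradient (Fsum f)).

(** The lower half of [z] stands for the tracker y, so [stH z] takes the place of Y here. *)
Lemma lyapunovE z : lyapunov f r c kappa z = lyap r c kappa (Fsum f) (stX z) (stH z).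
Proof.
rewrite /lyapunov /lyap /resR /resC /normR /normC !norm2E -!(nrm_mat (lift_mx _ _ *m _)).
have -> : Fc f (JR m r *m usubmx z) = Fsum f (stX z *m r).
  apply: eq_bigr => i _; congr (f i _).
  by rewrite block_mat mat_lift trmx_mul trmxK mulmxA col_ones.
congr (_ + _ ^+ 2 + _ * _ ^+ 2).
  rewrite mat_lift mulmxBl mul1mx matB mat_lift trmx_mul trmxK mulmxBr mulmx1.
  by rewrite /dsqrt tr_diag_mx.
rewrite mat_lift mulmxBl mul1mx matB mat_lift trmx_mul trmxK mulmxBr mulmx1.
by rewrite (invmx_dsqrt (vmin_gt0 (mix_c_pos mix))) rdiagT.
Qed.

Lemma nrmD_sq_le (p q : nat) (A B : 'M[R]_(p, q)) (a : R) : nrm A <= a ->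
  nrm (A + B) ^+ 2 - nrm A ^+ 2 <= 2 * a * nrm B + nrm B ^+ 2.
Proof.
move=> Aa; rewrite !nrm_sq ipDl !ipDr (ipC B A); have h := ler_ip A B.
have h2 : nrm A * nrm B <= a * nrm B by rewrite ler_wpM2r ?nrm_ge0.
by move: h h2; lra.
Qed.

(** Each summand grows by at most a multiple of [a |w|] plus a quadratic term, so
    [gradient_le_growth] gives the bound without computing the gradient. *)
Lemma gradient_lyapunov_le : exists2 K : R, 0 <= K & forall z (a : R), 0 <= a ->
  differentiable (lyapunov f r c kappa) z ->
  nrm (gradient (Fsum f) (stX z *m r)) <= a ->
  resR r (stX z) <= a ^+ 2 -> resC c (stH z) <= a ^+ 2 ->
  nrm (gradient (lyapunov f r c kappa) z) <= K * a.
Proof.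
have l1 := linmap_mulr r (@linmap_stX R n m).
have l2 := linmap_mulr (dsqrt r) (linmap_mulr (perpR r) (@linmap_stX R n m)).
have l3 := linmap_mulr (rdiag c) (linmap_mulr (perpC c) (@linmap_stH R n m)).
have [B1 B10 h1] := linmap_bounded l1.
have [B2 B20 h2] := linmap_bounded l2.
have [B3 B30 h3] := linmap_bounded l3.
exists (B1 + 2 * B2 + kappa * (2 * B3)).
  by rewrite !addr_ge0 ?mulr_ge0.
move=> z a a0 dU ga ra ca.
apply: (@gradient_le_growth _ _ _ _ _ (LF / 2 * B1 ^+ 2 + B2 ^+ 2 + kappa * B3 ^+ 2)) => //.
- by rewrite mulr_ge0// !addr_ge0 ?mulr_ge0.
- by rewrite !addr_ge0 ?mulr_ge0 ?sqr_ge0// divr_ge0.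
move=> w; rewrite !lyapunovE /lyap.
have F1 := lipschitz_gradient_descent (stX z *m r) (stX w *m r) (differentiable_Fsum f_C2) F_lip.
have a1 : nrm (stX z *m perpR r *m dsqrt r) <= a.
  by rewrite -(ler_pXn2r (ltn0Sn 1)) ?nnegrE ?nrm_ge0.
have a2 : nrm (stH z *m perpC c *m rdiag c) <= a.
  by rewrite -(ler_pXn2r (ltn0Sn 1)) ?nnegrE ?nrm_ge0.
have F2 := nrmD_sq_le (stX w *m perpR r *m dsqrt r) a1.
have F3 := nrmD_sq_le (stH w *m perpC c *m rdiag c) a2.
have [e1 e2 e3] : [/\ stX z *m r + stX w *m r = stX (z + w) *m r,
   stX z *m perpR r *m dsqrt r + stX w *m perpR r *m dsqrt r = stX (z + w) *m perpR r *m dsqrt r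
 & stH z *m perpC c *m rdiag c + stH w *m perpC c *m rdiag c = stH (z + w) *m perpC c *m rdiag c].
  by have := l1 1 z w; have := l2 1 z w; have := l3 1 z w; rewrite /= !scale1r.
rewrite e1 in F1; rewrite e2 -/(resR r _) -/(resR r _) in F2; rewrite e3 -/(resC c _) -/(resC c _) in F3.
have n0 := nrm_ge0 w; have {}h1 := h1 w; have {}h2 := h2 w; have {}h3 := h3 w.
have G1 : ip (gradient (Fsum f) (stX z *m r)) (stX w *m r) <= a * (B1 * nrm w).
  apply: le_trans (ler_ip _ _) _; apply: ler_pM; rewrite ?nrm_ge0//.
have sq (x b : R) : 0 <= x -> x <= b * nrm w -> x ^+ 2 <= b ^+ 2 * nrm w ^+ 2.
  by move=> x0 xb; rewrite -exprMn; apply: lerXn2r; rewrite ?nnegrE// (le_trans x0).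
have G2 := ler_wpM2l (divr_ge0 LF_ge0 (ler0n R 2)) (sq _ _ (nrm_ge0 _) h1).
have {}F2 := le_trans F2 (lerD (ler_wpM2l (mulr_ge0 (ler0n R 2) a0) h2) (sq _ _ (nrm_ge0 _) h2)).
have {}F3 := le_trans F3 (lerD (ler_wpM2l (mulr_ge0 (ler0n R 2) a0) h3) (sq _ _ (nrm_ge0 _) h3)).
have {}F3 := ler_wpM2l kappa_ge0 F3.
move: F1 G1 G2 F2 F3; clear.
move: (ip _ _) (nrm (stX w *m r) ^+ 2) (Fsum _ _) (Fsum _ _) (resR _ _) (resR _ _) (resC _ _) (resC _ _).
move: (nrm w) => y x1 x2 x3 x4 x5 x6 x7 x8; rewrite !expr2; lra.
Qed.

End LyapunovGradient.

Lemma KL_ineq_ball (R : realType) (k : nat) (U : 'cV[R]_k -> R) z0 eta phi (e : R) :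
  KL_ineq U z0 eta phi -> (forall t, t < e -> (t%:E < eta)%E) ->
  exists2 delta, 0 < delta & forall z t, nrm (z - z0) < delta -> 0 < t -> t < e ->
    U z = U z0 + t -> 1 <= derive1 phi t * nrm (gradient U z).
Proof.
move=> /near_nrmP[delta delta0 hdelta] he; exists delta => // z t zd t0 te E.
have := hdelta z zd; rewrite E ltrDl t0 EFinD lteD2lE// he// => /(_ isT isT).
by rewrite addrAC subrr add0r norm2E.
Qed.

(** * The limit point and the KL exponent *)

Section Limit.
Context {R : realType} {n m : nat} {Rw Cw : 'M[R]_n} {r c : 'cV[R]_n}.
Context {LF eps_x eps_y eps kappa alpha : R} {f : 'I_n -> 'cV[R]_m -> R} {L : 'I_n -> R}.
Hypothesis mix : mixing Rw Cw r c.
Hypothesis step : step_size Rw Cw r c (sup (range L)) LF eps_x eps_y eps kappa alpha.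
Hypotheses (alpha_gt0 : 0 < alpha) (m_gt0 : (0 < m)%N).
Hypothesis f_C2 : forall i, C_class 2 (f i).
Hypotheses (f_lip : forall i, lipschitz2 (L i) (gradient (f i)))
  (F_lip : lipschitz2 LF (gradient (Fsum f))) (F_coercive : coercive (Fsum f)).
Variable u0 : 'cV[R]_(n * m + n * m).
Hypothesis u0_bal : balanced u0.

Let x := dseq (Rw := Rw) (Cw := Cw) (alpha := alpha) (f := f) u0.
Let D := gapseq (Rw := Rw) (Cw := Cw) (r := r) (c := c) (alpha := alpha) (f := f) u0.
Let s := excess (Rw := Rw) (Cw := Cw) (r := r) (c := c) (kappa := kappa) (alpha := alpha) (f := f) u0.
Let Lc_ge0 : 0 <= sup (range L) := sup_L_ge0 m_gt0 f_lip.
Let LF_ge0 : 0 <= LF := lipschitz2_ge0 m_gt0 F_lip.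
Let G_lip := gradF_lip m_gt0 f_lip.

Variable us : 'cV[R]_(n * m + n * m).
Hypothesis x_us : forall e : R, 0 < e -> exists N, forall j, (N <= j)%N -> nrm (x j - us) < e.

(** At late iterates [T] is small with the gap, and its distance to the value at the limit is small
    by Lipschitz continuity. It serves for the consensus error, the tracker and the gradient. *)
Lemma limit_vanish (p q : nat) (T : 'cV[R]_(n * m + n * m) -> 'M[R]_(p, q)) (K K' : R) :
  0 <= K -> (forall j, nrm (T (x j)) <= K * D j) ->
  0 <= K' -> (forall u v, nrm (T u - T v) <= K' * nrm (u - v)) -> T us = 0.
Proof.
move=> K0 TD K'0 Tlip; apply: nrm_eq0; apply/eqP; rewrite eq_le nrm_ge0 andbT.
apply/ler_addgt0Pr => e e0; rewrite add0r.
have p0 : 0 < K + K' + 1 by rewrite ltr_wpDl// addr_ge0.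
have d0 : 0 < e / (K + K' + 1) by rewrite divr_gt0.
have [N1 h1] := gapseq_to0 mix step alpha_gt0 m_gt0 f_C2 f_lip F_lip F_coercive u0_bal d0.
have [N2 h2] := x_us d0; pose j := maxn N1 N2.
have {}h1 : D j <= e / (K + K' + 1) by apply/ltW/h1/leq_maxl.
have {}h2 : nrm (x j - us) <= e / (K + K' + 1) by apply/ltW/h2/leq_maxr.
have -> : T us = T (x j) - (T (x j) - T us) by rewrite subKr.
apply: le_trans (nrmD _ _) _; rewrite nrmN.
apply: le_trans (lerD (TD j) (Tlip _ _)) _.
apply: (@le_trans _ _ ((K + K') * (e / (K + K' + 1)))).
  by rewrite mulrDl; apply: lerD; apply: ler_wpM2l.
rewrite mulrA ler_pdivrMr// mulrC; apply: ler_wpM2l; first exact: ltW.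
by rewrite lerDl.
Qed.

Let theta := stX us *m r.

Lemma limit_stX : stX us = theta *m ones^T.
Proof.
rewrite [LHS](@perpR_split _ _ _ r) (_ : stX us *m perpR r = 0) ?addr0//.
have l := linmap_mulr (perpR r) (@linmap_stX R n m).
have [K' K'0 hK'] := linmap_bounded l.
apply: (@limit_vanish _ _ (fun u => stX u *m perpR r) (K2R r) K') => //.
- by rewrite /K2R divr_ge0 ?sqrtr_ge0.
- by move=> j; exact: perp_le_gapseq mix u0 j.
by move=> u v; rewrite -(linmapB_eq l).
Qed.

Lemma limit_stY : stY (gradF f) us = 0.
Proof.
have [K K0 hK] := Y_le_gapseq (alpha := alpha) (f := f) mix u0.
apply: (@limit_vanish _ _ (stY (gradF f)) K (1 + sup (range L))) => //.
  by rewrite addr_ge0.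
exact: stY_lip Lc_ge0 G_lip.
Qed.

Lemma limit_gradient : gradient (Fsum f) theta = 0.
Proof.
have [K K0 hK] := grad_le_gapseq (alpha := alpha) mix m_gt0 f_C2 f_lip u0_bal.
apply: (@limit_vanish _ _ (fun u => gradient (Fsum f) (stX u *m r)) K LF) => //.
move=> u v; have := F_lip (stX u *m r) (stX v *m r); rewrite !norm2E => h.
by apply: le_trans h _; apply: ler_wpM2l => //; exact: nrm_mean_le mix _ _.
Qed.

Lemma limit_consensual :
  us = col_mx (consensus theta) (- gradient (Fc f) (consensus theta)).
Proof.
have e1 : usubmx us = consensus theta.
  by apply: (can_inj (@matK R n m)); rewrite mat_consensus -limit_stX.
rewrite -[LHS]vsubmxK e1; congr col_mx; apply: (can_inj (@matK R n m)).
rewrite matN mat_gradient_Fc mat_consensus -limit_stX.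
by apply/eqP; rewrite -addr_eq0; apply/eqP; exact: limit_stY.
Qed.

Lemma lyapunov_state u : lyapunov f r c kappa (state (stX u) (stY (gradF f) u)) =
  stlyap (r := r) (c := c) (kappa := kappa) (gradF f) (Fsum f) u.
Proof. by rewrite (lyapunovE mix) stX_state stH_state. Qed.

Lemma lyapinf_limit : lyapinf (Rw := Rw) (Cw := Cw) (r := r) (c := c) (kappa := kappa) (alpha := alpha) (f := f) u0
  = lyapunov f r c kappa (state (stX us) (stY (gradF f) us)).
Proof.
have cl (e : R) N : 0 < e -> exists2 j, (N <= j)%N & nrm (x j - us) < e.
  by move=> e0; have [M hM] := x_us e0; exists (maxn M N); [exact: leq_maxr|exact/hM/leq_maxl].
rewrite (lyapinf_cluster mix step alpha_gt0 m_gt0 f_C2 f_lip F_lip F_coercive u0_bal cl).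
rewrite (lyapunov_state us) /stlyap /lyap limit_stY {3}limit_stX -/theta /resR /resC.
have -> : theta *m ones^T *m perpR r = 0.
  by rewrite -limit_stX /perpR mulmxBr mulmx1 mulmxA -/theta -limit_stX subrr.
by rewrite !mul0mx nrm0 expr0n mulr0 !addr0.
Qed.

Lemma lyapunov_excess j : lyapunov f r c kappa (state (stX (x j)) (stY (gradF f) (x j)))
  = lyapunov f r c kappa (state (stX us) (stY (gradF f) us)) + s j.
Proof.
transitivity (lyapseq (Rw := Rw) (Cw := Cw) (r := r) (c := c) (kappa := kappa) (alpha := alpha) (f := f) u0 j).
  exact: lyapunov_state.
by rewrite -lyapinf_limit /s /excess subrKC.
Qed.

Lemma nrm_stateB (X H X' H' : 'M[R]_(m, n)) :
  nrm (state X H - state X' H') <= nrm (X - X') + nrm (H - H').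
Proof.
apply: le_trans (nrm_state_le _) _.
by rewrite (linmapB_eq (@linmap_stX R n m)) (linmapB_eq (@linmap_stH R n m)) !stX_state !stH_state.
Qed.

Lemma nrm_state_sub u v : nrm (state (stX u) (stY (gradF f) u) - state (stX v) (stY (gradF f) v))
  <= (2 + sup (range L)) * nrm (u - v).
Proof.
apply: le_trans (nrm_stateB _ _ _ _) _.
have h1 := stY_lip Lc_ge0 G_lip u v; have h2 := nrm_stX (u - v).
by rewrite (linmapB_eq (@linmap_stX R n m)) in h2; move: h1 h2; lra.
Qed.

Lemma derive1_scaled_powR (c1 a y : R) : 0 < y -> derive1 (fun t => c1 * t `^ a) y = c1 * (a * y `^ (a - 1)).
Proof.
move=> y0; have h := is_derive1_powR a y0.
by rewrite derive1Ml//; congr (_ * _); rewrite derive1E derive_val.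
Qed.

(** The Lyapunov gradient at [(x, y)] is at most [K D], so KL at the limit yields both the remaining
    length, bounded by the desingularized excess, and a recursion for the excess. *)
Lemma KL_power_bounds th : 0 <= th -> th < 1 -> KL_function_power (lyapunov f r c kappa) th ->
  exists (M q : R) (N : nat), [/\ 0 <= M, 0 < q,
    forall j, (N <= j)%N -> nrm (x j - us) <= M * s j `^ (1 - th)
  & forall j, (N <= j)%N -> 0 < s j -> s j.+1 <= s j - q * s j `^ (2 * th)].
Proof.
move=> th0 th1 [dU KLU]; set U := lyapunov f r c kappa in dU KLU.
pose z u := state (stX u) (stY (gradF f) u).
have [c1 c10 [et [dphi KLi]]] := KLU (z us).
have [e e0 [he phi0 phiT _ _]] := desing_properties dphi.
have [delta delta0 hdelta] := KL_ineq_ball KLi he.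
have ka0 := ss_kappa_gt0 step.
have [K1 K10 hK1] := grad_le_gapseq (alpha := alpha) mix m_gt0 f_C2 f_lip u0_bal.
have [K2 K20 hK2] := gradient_lyapunov_le mix (ltW ka0) LF_ge0 f_C2 F_lip.
pose K := K2 * (K1 + 1) + 1; have K0 : 0 < K by rewrite ltr_wpDl// mulr_ge0 ?addr_ge0.
have D0 j : 0 <= D j by exact: gapseq_ge0.
have gU j : nrm (gradient U (z (x j))) <= K * D j.
  apply: (@le_trans _ _ (K2 * ((K1 + 1) * D j))); last first.
    by rewrite mulrA ler_wpM2r// lerDl.
  have D1 : D j <= (K1 + 1) * D j by rewrite ler_peMl// lerDr.
  have D2 : D j ^+ 2 <= ((K1 + 1) * D j) ^+ 2 by apply: lerXn2r; rewrite ?nnegrE// (le_trans (D0 j)).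
  apply: hK2; rewrite /z ?stX_state ?stH_state.
  - exact: le_trans (D0 j) D1.
  - exact: dU.
  - by apply: le_trans (hK1 j) _; rewrite ler_wpM2r// lerDl.
  - by apply: le_trans D2; rewrite /D gapseq_sq; exact: resR_le_gap.
  - by apply: le_trans D2; rewrite /D gapseq_sq; exact: resC_le_gap.
have [c0 c00 hs] := excess_descent mix step alpha_gt0 m_gt0 f_C2 f_lip F_lip u0_bal.
have [C C0 hx] := dseq_step (f := f) mix step alpha_gt0 u0.
have s_ge0 j : 0 <= s j by exact: excess_ge0 step m_gt0 f_C2 F_lip F_coercive u0 j.
have [N1 hN1] := excess_to0 mix step alpha_gt0 m_gt0 f_C2 f_lip F_lip F_coercive u0_bal e0.
have L20 : 0 < 2 + sup (range L) by rewrite ltr_wpDr.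
have [N2 hN2] := x_us (divr_gt0 delta0 L20).
pose N := maxn N1 N2; pose phi (t : R) := c1 * t `^ (1 - th).
have se j : (N <= j)%N -> s j < e by rewrite geq_max => /andP[/hN1].
have KL j : (N <= j)%N -> 0 < s j -> 1 <= K * derive1 phi (s j) * D j.
  move=> Nj s0; have zd : nrm (z (x j) - z us) < delta.
    apply: le_lt_trans (nrm_state_sub _ _) _; rewrite mulrC -ltr_pdivlMr//.
    by apply: hN2; apply: leq_trans Nj; exact: leq_maxr.
  apply: le_trans (hdelta _ _ zd s0 (se j Nj) (lyapunov_excess j)) _.
  rewrite -/phi mulrAC mulrC; apply: ler_wpM2r; last exact: gU.
  by apply/ltW/(desing_deriv_gt0 dphi) => //; rewrite he// se.
exists (C / c0 * K * c1), (c0 / (K * c1 * (1 - th)) ^+ 2), N.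
have B0 : 0 < K * c1 * (1 - th) by rewrite !mulr_gt0// subr_gt0.
split.
- by rewrite mulr_ge0 ?(ltW c10)// mulr_ge0 ?(ltW K0)// divr_ge0// ltW.
- by rewrite divr_gt0// exprn_gt0.
(* The length estimate runs from j to an index i so late that [x i] is within [d] of the limit. *)
- move=> j Nj; apply/ler_addgt0Pr => d d0; have [M hM] := x_us d0.
  have psiT u t : 0 <= t -> t <= u -> 0 < u -> u < e ->
      K * derive1 phi u * (u - t) <= K * phi u - K * phi t.
    by move=> t0 tu u00 ue; rewrite -mulrBr -mulrA; apply: ler_wpM2l; [exact: ltW|exact: phiT].
  pose i := maxn M j; have h1 := hM i (leq_maxl _ _).
  have h2 := KL_length (psi := fun u => K * phi u) (psid := fun u => K * derive1 phi u)
    c00 C0 s_ge0 D0 hs hx psiT (N := j) (j := i).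
  have {}h2 : nrm (x i - x j) <= C / c0 * (K * phi (s j) - K * phi (s i)).
    apply: (h2 _ (leq_maxr M j)).
    by move=> l jl _; split; [exact: se (leq_trans Nj jl)|exact: KL (leq_trans Nj jl)].
  apply: le_trans (nrmD_sub _ (x i) _) _; apply: lerD; last exact: ltW.
  rewrite nrmB; apply: le_trans h2 _; rewrite -[leRHS]mulrA -[leRHS]mulrA.
  apply: ler_wpM2l; first by rewrite divr_ge0// ltW.
  by rewrite -/(phi _) gerBl mulr_ge0 ?mulr_ge0 ?powR_ge0// ltW.
(* The derivative of [phi] is [c1 (1 - th) s^(-th)], so KL reads [s^th <= K c1 (1 - th) D]; its
   square is inserted into the descent. *)
move=> j Nj s0; have := KL j Nj s0; rewrite /phi derive1_scaled_powR//.
have -> : 1 - th - 1 = - th by ring.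
rewrite powRN => h; have p0 : 0 < s j `^ th by exact: powR_gt0.
have {}h : s j `^ th <= K * c1 * (1 - th) * D j.
  rewrite -(ler_pM2r (_ : 0 < (s j `^ th)^-1)) ?invr_gt0// divff ?gt_eqF//.
  apply: le_trans h _; rewrite le_eqVlt; apply/orP; left; apply/eqP.
  by move: (_^-1) => w; ring.
have E : s j `^ (2 * th) = (s j `^ th) ^+ 2 by rewrite mulrC powRrM powR_mulrn// ltW.
have h2 := hs j; rewrite -/s in h2.
have h3 : (s j `^ th) ^+ 2 <= (K * c1 * (1 - th)) ^+ 2 * D j ^+ 2.
  by rewrite -exprMn; apply: lerXn2r => //; rewrite nnegrE; [exact: ltW|by apply: mulr_ge0; [exact: ltW|]].
have h4 : c0 / (K * c1 * (1 - th)) ^+ 2 * s j `^ (2 * th) <= c0 * D j ^+ 2.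
  rewrite E -mulrA; apply: ler_wpM2l; first exact: ltW.
  by rewrite mulrC ler_pdivrMr ?exprn_gt0// [leRHS]mulrC.
have h5 := le_trans h4 h2; rewrite lerBrDl in h5; rewrite lerBrDr; exact: h5.
Qed.

End Limit.

Lemma convergence_rates (R : realType) (s err : nat -> R) (M q th : R) (N : nat) :
  (forall j, 0 <= s j) -> (forall j, s j.+1 <= s j) ->
  (forall d : R, 0 < d -> exists N, forall j, (N <= j)%N -> s j < d) ->
  0 <= M -> 0 < q -> th < 1 ->
  (forall j, (N <= j)%N -> err j <= M * s j `^ (1 - th)) ->
  (forall j, (N <= j)%N -> 0 < s j -> s j.+1 <= s j - q * s j `^ (2 * th)) ->
  [/\ th = 0 -> \forall nu \near \oo, err nu <= 0,
      0 < th -> th <= 1 / 2 ->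
        exists tau Cb : R, [/\ 0 <= tau, tau < 1, 0 < Cb &
          \forall nu \near \oo, err nu <= Cb * tau ^+ nu]
    & 1 / 2 < th -> exists2 Cb : R, 0 < Cb &
        \forall nu \near \oo, err nu <= Cb * nu%:R `^ (- ((1 - th) / (2 * th - 1)))].
Proof.
move=> s0 s_mono s_to0 M0 q0 th1 err_le s_step.
have mono i j : (i <= j)%N -> s j <= s i.
  by apply: (homo_leq_in (D := predT) (r := fun a b => b <= a)) => // a b c' h1 h2; exact: le_trans h2 h1.
have h1 : 0 < 1 - th by rewrite subr_gt0.
split=> [th0|th0 thh|thh].
- have [N1 hN1] := s_to0 _ q0.
  have [|j Nj sj] := finite_rate s0 s_step th0.
    by exists (maxn N N1); [exact: leq_maxl|exact/hN1/leq_maxr].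
  exists j => // i /= ji; apply: le_trans (err_le i (leq_trans Nj ji)) _.
  have -> : s i = 0 by apply/eqP; rewrite eq_le s0 andbT -sj mono.
  by rewrite powR0 ?mulr0// gt_eqF.
- have [N1 hN1] := s_to0 _ ltr01; pose N' := maxn N N1.
  pose t := 1 - Num.min q (1 / 2).
  have t0 : 0 < t by rewrite subr_gt0 gt_min; apply/orP; right; lra.
  have t1 : t < 1 by rewrite gtrBl lt_min q0 divr_gt0.
  pose tau := Num.sqrt t; have tau0 : 0 < tau by rewrite sqrtr_gt0.
  (* [tau ^- N'] accounts for the late start; [+ 1] keeps the constant positive when [M = 0]. *)
  exists tau, (M * tau ^- N' + 1); split.
  + exact: ltW.
  + by rewrite -sqrtr1 ltr_sqrt.
  + by rewrite ltr_wpDl// mulr_ge0// invr_ge0 exprn_ge0// ltW.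
  exists N' => // nu /= Nnu.
  have st j : (N' <= j)%N -> 0 < s j -> s j.+1 <= s j - q * s j `^ (2 * th).
    by move=> Nj; apply: s_step; apply: leq_trans Nj; exact: leq_maxl.
  have sN : s N' <= 1 by apply/ltW/hN1/leq_maxr.
  have := linear_rate s0 s_mono q0 st (nu - N')%N th0 thh sN; rewrite (subnKC Nnu) -/t -/tau => h.
  apply: le_trans (err_le nu (leq_trans (leq_maxl _ _) Nnu)) _.
  apply: (@le_trans _ _ (M * tau ^+ (nu - N'))); first exact: ler_wpM2l.
  rewrite mulrDl mul1r -{2}(subnKC Nnu) exprD mulrA mulfVK ?expf_neq0 ?gt_eqF//.
  by rewrite lerDl exprn_ge0// ltW.
set a := - (_ / _); set b := ((2 * th - 1) * q / 2) `^ a.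
exists (M * b + 1); first by rewrite ltr_wpDl// mulr_ge0 ?powR_ge0.
exists (maxn N.*2 1) => // nu /=; rewrite geq_max => /andP[Nnu nu0].
have h := sublinear_rate s0 s_mono q0 s_step thh th1 Nnu nu0.
apply: le_trans (err_le nu _) _; first by apply: leq_trans Nnu; rewrite -addnn leq_addr.
apply: le_trans (ler_wpM2l M0 h) _; rewrite -/a -/b mulrDl mulrA lerDl mul1r.
exact: powR_ge0.
Qed.

Lemma nrm_usubmx (R : realType) (n m : nat) (u : 'cV[R]_(n * m + n * m)) : nrm (usubmx u) <= nrm u.
Proof. by have := nrm_stX u; rewrite nrm_mat. Qed.

Theorem theorem4p17 (R : realType) (n m p : nat)
  (n_gt0 : (0 < n)%N) (m_gt0 : (0 < m)%N) (p_ge1 : (1 <= p)%N)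
  (f : 'I_n -> 'cV[R]_m -> R) (L : 'I_n -> R) (LF : R)
  (f_smooth : forall i, C_class p.+1 (f i))
  (f_lip : forall i, lipschitz2 (L i) (gradient (f i)))
  (F_lip : lipschitz2 LF (gradient (Fsum f)))
  (F_coercive : coercive (Fsum f))
  (e : rel 'I_n) (e_conn : strongly_connected e)
  (Rw Cw : 'M[R]_n) (wm : weight_matrices e Rw Cw)
  (Rw_unit : Rw \in unitmx) (Cw_unit : Cw \in unitmx)
  (r c : 'cV[R]_n)
  (r_stoch : stochastic r) (r_fix : r^T *m Rw = r^T) (r_pos : 0 < vmin r)
  (c_stoch : stochastic c) (c_fix : Cw *m c = c) (c_pos : 0 < vmin c)
  (eps_x eps_y eps kappa alpha : R)
  (step : step_size Rw Cw r c (sup (range L)) LF eps_x eps_y eps kappa alpha)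
  (alpha_gt0 : 0 < alpha)
  (alpha_lt : alpha < sigma_min (Cw *m Rw) / sup (range L))
  (sym_or_scalar : (Rw^T = Rw /\ Cw^T = Cw) \/ m = 1%N)
  (P : probability (borelType R (n * m + n * m)) R)
  (P_ac : abs_cont_on (init_space Cw) P) :
  P.-negligible [set u0 | exists2 u, consensual_saddles f u &
                   dogt f Rw Cw alpha u0 @ \oo --> u]
  /\
  (KL_function (Fsum f) ->
   {ae P, forall u0, exists theta : 'cV[R]_m,
     let x := dogt_x f Rw Cw alpha u0 in
     let err := fun nu => norm2 (x nu - consensus theta) in
     [/\ SoS (Fsum f) theta,
         x @ \oo --> (consensus theta : 'cV[R]_(n * m))
       & forall th : R, 0 <= th -> th < 1 ->
         KL_function_power (lyapunov f r c kappa) th ->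
         [/\ th = 0 -> \forall nu \near \oo, x nu = consensus theta,
             0 < th -> th <= 1 / 2 ->
               exists tau Cb : R, [/\ 0 <= tau, tau < 1, 0 < Cb &
                 \forall nu \near \oo, err nu <= Cb * tau ^+ nu]
           & 1 / 2 < th ->
               exists2 Cb : R, 0 < Cb &
                 \forall nu \near \oo,
                   err nu <= Cb * nu%:R `^ (- ((1 - th) / (2 * th - 1)))]]}).
Proof.
have f_C2 i : C_class 2 (f i) by exact: C_class_le (f_smooth i).
have mix := weight_matrices_mixing wm r_stoch r_fix r_pos c_stoch c_fix c_pos.
have [F [cV cF nullF cover]] := saddle_null_cover mix step alpha_gt0 n_gt0 m_gt0 alpha_lt f_C2 f_lip F_lip.
have null := negligible_of_null_cover P_ac cV cF nullF.
split; first exact: null.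
(* Every initial point of the space where the conclusion fails is attracted by a consensual strict
   saddle, so the same null cover serves for the second claim. *)
move=> KLF; apply: null => u0 Vu0 bad; apply: cover => //; apply: contrapT => nsaddle; apply: bad.
have u0_bal : balanced u0 by apply/(balancedP mix (rhoC_lt1 step)).
have [us x_us] := dseq_converges mix step alpha_gt0 m_gt0 f_C2 f_lip F_lip F_coercive u0_bal KLF.
have usE := limit_consensual mix step alpha_gt0 m_gt0 f_C2 f_lip F_lip F_coercive u0_bal x_us.
have gradE := limit_gradient mix step alpha_gt0 m_gt0 f_C2 f_lip F_lip F_coercive u0_bal x_us.
pose theta := stX us *m r; rewrite -/theta in usE gradE; exists theta.
have err_le nu : norm2 (dogt_x f Rw Cw alpha u0 nu - consensus theta) <=
    nrm (dseq (Rw := Rw) (Cw := Cw) (alpha := alpha) (f := f) u0 nu - us).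
  rewrite norm2E; apply: le_trans (nrm_usubmx _).
  by rewrite linearB/= {1}usE col_mxKu /dogt_x dogtE.
have xcvg : dogt_x f Rw Cw alpha u0 @ \oo --> (consensus theta : 'cV[R]_(n * m)).
  apply/cvg_nrm => d d0; have [N hN] := x_us d d0; exists N => j Nj.
  by apply: le_lt_trans (hN j Nj); rewrite -norm2E; exact: err_le.
split => //.
  split => //; apply: psd_lambda_min; first by apply: hessian_sym; exact: Fsum_C2.
  move=> neg; apply: nsaddle; exists us; first by rewrite usE; exists theta.
  by rewrite dogtE; apply/cvg_nrm => d d0; exact: x_us.
move=> th th0 th1 KLth.
have [M [q [N [M0 q0 bound stepN]]]] := KL_power_bounds mix step alpha_gt0 m_gt0 f_C2 f_lip F_lip
  F_coercive u0_bal x_us th0 th1 KLth.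
have [c0 c00 hs] := excess_descent mix step alpha_gt0 m_gt0 f_C2 f_lip F_lip u0_bal.
have [r1 r2 r3] := convergence_rates (excess_ge0 step m_gt0 f_C2 F_lip F_coercive u0)
  (fun j => gap_seq_mono c00 hs (leqnSn j))
  (excess_to0 mix step alpha_gt0 m_gt0 f_C2 f_lip F_lip F_coercive u0_bal)
  M0 q0 th1 (fun j Nj => le_trans (err_le j) (bound j Nj)) stepN.
(* For exponent 0 the rate says that the error is eventually at most 0, so the iterate equals its
   limit. *)
split => // z; near=> nu.
apply/eqP; rewrite -subr_eq0; apply/eqP/nrm_eq0; rewrite -norm2E; apply/eqP.
rewrite eq_le; apply/andP; split; first by near: nu; exact: r1.
by rewrite norm2E nrm_ge0.
Unshelve. all: by end_near.
Qed.
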